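(* Let $E$ be a translation-invariant Banach space of tempered distributions on $\mathbb{R}^n$. If $E$ is reflexive, then $\mathcal{D}_{E}$ is an FS$^{\ast}$-space and $\mathcal{D}'_{E'}$ is a DFS$^{\ast}$-space. In addition, $\mathcal{S}(\mathbb{R}^{n})$ is dense in $\mathcal{D}'_{E'}$.
   Context: Notation: $(T_hg)(x)=g(x+h)$. $X\hookrightarrow Y$ means a dense and continuous linear embedding. Duals carry the strong topology. A translation-invariant Banach space of tempered distributions is a Banach space $E$ such that: $(a)'$ $\mathcal{D}(\mathbb{R}^n)\hookrightarrow E\hookrightarrow \mathcal{D}'(\mathbb{R}^n)$; $(b)'$ $T_h(E)\subseteq E$ for every $h\in\mathbb{R}^{n}$; $(c)'$ for any $g\in E$ there are $M=M_g>0$, $\tau=\tau_{g}\geq 0$ with $\|T_{h} g\|_E\leq M(1+|h|)^\tau$ for all $h\in \mathbb{R}^n$. For such $E$ one has $\mathcal{S}(\mathbb{R}^n)\hookrightarrow E\hookrightarrow \mathcal{S}'(\mathbb{R}^n)$, and $\mathcal{S}(\mathbb{R}^n)\subset E'\subset\mathcal{S}'(\mathbb{R}^n)$. $\mathcal{D}_E$ is the Fréchet space of $\varphi\in\mathcal{S}'(\mathbb{R}^n)$ with $\varphi^{(\alpha)}\in E$ for all $\alpha\in\mathbb{N}_0^n$, topologized by the norms $\|\varphi\|_{E,N}=\max_{|\alpha|\le N}\|\varphi^{(\alpha)}\|_E$, $N\in\mathbb{N}_0$. When $E$ is reflexive, $\mathcal{D}'_{E'}$ denotes the strong dual of $\mathcal{D}_E$,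 regarded as a subspace of $\mathcal{S}'(\mathbb{R}^n)$ (since $\mathcal{S}(\mathbb{R}^n)\hookrightarrow\mathcal{D}_E$). An FS$^\ast$-space is a locally convex space that is (isomorphic to) the projective limit of a sequence of Banach spaces $X_1\leftarrow X_2\leftarrow\cdots$ with weakly compact linking maps; a DFS$^\ast$-space is a locally convex space that is (isomorphic to) the inductive limit of a sequence of Banach spaces $Y_1\to Y_2\to\cdots$ with injective weakly compact linking maps (Komatsu). A continuous linear map is weakly compact if it maps the unit ball to a relatively weakly compact set. *)

(* Defs.v *)
From HB Require Import structures.
From mathcomp Require Import all_boot all_order all_algebra.
From mathcomp Require Import complex.
From mathcomp Require Import all_classical all_reals all_analysis.

Set Implicit Arguments.
Unset Strict Implicit.
Unset Printing Implicit Defensive.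
Import Order.TTheory GRing.Theory Num.Theory.
Import numFieldNormedType.Exports.
Local Open Scope classical_set_scope.
Local Open Scope ring_scope.

Section absconvex.
Context {K : numFieldType} {V : lmodType K}.

Definition absconvex (U : set V) :=
  forall (x y : V) (a b : K),
    U x -> U y -> `|a| + `|b| <= 1 -> U (a *: x + b *: y).

Definition absorbing (U : set V) :=
  forall x : V, exists2 r : K, 0 < r & U (r *: x).

Lemma absconvexZ (U : set V) (a : K) (x : V) :
  absconvex U -> `|a| <= 1 -> U x -> U (a *: x).
Proof.
move=> Ucvx a1 Ux; rewrite -[_ *: _]addr0 -(scale0r x).
by apply: Ucvx; rewrite // normr0 addr0.
Qed.

End absconvex.

(* Data generating a locally convex topology: the neighbourhoods of 0 in
   [lctvs B] are the supersets of multiples of finite intersections of members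
   of B.  The members play the role of closed unit balls of seminorms. *)
Record lcbase (K : numFieldType) (V : lmodType K) := LcBase {
  lcbase_sets : set (set V);
  _ : forall U, lcbase_sets U -> absconvex U;
  _ : forall U, lcbase_sets U -> absorbing U }.

Definition lctvs (K : numFieldType) (V : lmodType K) (B : lcbase V) : Type := V.

HB.instance Definition _ (K : numFieldType) (V : lmodType K) (B : lcbase V) :=
  GRing.Lmodule.on (lctvs B).

Section lctvs.
Context (K : numFieldType) (V : lmodType K) (B : lcbase V).
Local Notation W := (lctvs B).

Definition lctvs_nbhs0 (A : set V) :=
  exists (m : nat) (U : 'I_m -> set V) (r : K),
    [/\ 0 < r, forall i, lcbase_sets B (U i) &
        forall v : V, (forall i, U i (r *: v)) -> A v].

Definition lctvs_nbhs (x : W) (A : set W) := lctvs_nbhs0 [set v | A (x + v)].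

HB.instance Definition _ := hasNbhs.Build W lctvs_nbhs.

Let Bcvx U : lcbase_sets B U -> absconvex U. Proof. by case: B => ? /= + _; apply. Qed.
Let Babs U : lcbase_sets B U -> absorbing U. Proof. by case: B => ? /= _; apply. Qed.

Let absconvex0 (U : set V) : absconvex U -> absorbing U -> U 0.
Proof.
move=> Ucvx /(_ 0)[r _]; rewrite scaler0 => U0; exact: U0.
Qed.

Let nbhs0S (A A' : set V) : A `<=` A' -> lctvs_nbhs0 A -> lctvs_nbhs0 A'.
Proof.
by move=> AA' [m [U [r [r0 BU UA]]]]; exists m, U, r; split => // v /UA /AA'.
Qed.

Let nbhs0T : lctvs_nbhs0 setT.
Proof. by exists 0%N, (fun=> setT), 1; split => // -[]. Qed.

Let nbhs0Z (A : set V) (k : K) : 0 < k -> lctvs_nbhs0 A ->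
  lctvs_nbhs0 [set v | A (k *: v)].
Proof.
move=> k0 [m [U [r [r0 BU UA]]]]; exists m, U, (r * k); split => //.
  exact: mulr_gt0.
by move=> v Uv; apply: UA => i; rewrite scalerA; exact: Uv.
Qed.

Let nbhs0I (A A' : set V) : lctvs_nbhs0 A -> lctvs_nbhs0 A' ->
  lctvs_nbhs0 (A `&` A').
Proof.
move=> [m [U [r [r0 BU UA]]]] [m' [U' [r' [r'0 BU' UA']]]].
exists (m + m')%N,
  (fun i => match fintype.split i with inl j => U j | inr j => U' j end), (r + r').
split; first exact: addr_gt0.
  by move=> i; case: (fintype.split i).
have s0 : 0 < r + r' by exact: addr_gt0.
have shrink (X : set V) (t : K) v : absconvex X -> 0 < t -> t <= r + r' ->
    X ((r + r') *: v) -> X (t *: v).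
  move=> Xc t0 tr Xv.
  have -> : t *: v = (t / (r + r')) *: ((r + r') *: v).
    by rewrite scalerA divfK ?gt_eqF.
  apply: absconvexZ => //.
  by rewrite ger0_norm ?(divr_ge0 (ltW t0) (ltW s0))// ler_pdivrMr ?mul1r.
move=> v H; split.
- apply: UA => i; apply: shrink => //; first exact: Bcvx.
    by rewrite lerDl ltW.
  by have := H (unsplit (inl i)); rewrite unsplitK.
- apply: UA' => i; apply: shrink => //; first exact: Bcvx.
    by rewrite lerDr ltW.
  by have := H (unsplit (inr i)); rewrite unsplitK.
Qed.

Let nbhs0_absconvex (A : set V) : lctvs_nbhs0 A ->
  exists C : set V, [/\ lctvs_nbhs0 C, absconvex C, absorbing C & C `<=` A].
Proof.
move=> [m [U [r [r0 BU UA]]]].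
exists [set v | forall i, U i (r *: v)]; split => //.
- by exists m, U, r; split.
- move=> x y a b Ux Uy ab i; rewrite scalerDr !scalerA ![r * _]mulrC -!scalerA.
  by apply: (Bcvx (BU i)); [exact: Ux|exact: Uy|].
- move=> x /=.
  have [s s0 Hs] : exists2 s : K, 0 < s & forall i, U i (s *: x).
    clear UA; elim: m U BU => [|m IH] U BU; first by exists 1 => // -[].
    have [s s0 Hs] := IH (fun i => U (lift ord0 i)) (fun i => BU _).
    have [t t0 Ht] := Babs (BU ord0) x.
    have st0 : 0 < s + t by exact: addr_gt0.
    exists (s * t / (s + t)); first by rewrite divr_gt0// mulr_gt0.
    move=> i; case: (unliftP ord0 i) => [j ->|->].
    + rewrite -mulrA mulrC -scalerA; apply: absconvexZ; [exact: Bcvx| |exact: Hs].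
      rewrite gtr0_norm ?divr_gt0// ler_pdivrMr// mul1r.
      by rewrite lerDr ltW.
    + rewrite mulrAC -scalerA; apply: absconvexZ; [exact: Bcvx| |exact: Ht].
      rewrite gtr0_norm ?divr_gt0// ler_pdivrMr// mul1r.
      by rewrite lerDl ltW.
  exists (s / r); first exact: divr_gt0.
  by move=> i; rewrite scalerA mulrCA mulfV ?gt_eqF// mulr1.
Qed.

Let nbhs0_0 (A : set V) : lctvs_nbhs0 A -> A 0.
Proof.
by move=> /nbhs0_absconvex[C [_ Cc Ca CA]]; apply: CA; exact: absconvex0.
Qed.

Let nbhs0_half (C : set V) : absconvex C -> forall x y,
  C (2 *: x) -> C (2 *: y) -> C (x + y).
Proof.
move=> Cc x y Cx Cy.
have -> : x + y = 2^-1 *: (2 *: x) + 2^-1 *: (2 *: y).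
  by rewrite !scalerA mulVf ?scale1r// pnatr_eq0.
apply: Cc => //; rewrite ger0_norm ?invr_ge0//.
by rewrite -mulr2n -(mulr_natr (2^-1) 2) mulVf ?pnatr_eq0.
Qed.

Let lctvs_filter (x : W) : ProperFilter (lctvs_nbhs x).
Proof.
split; first by move=> /nbhs0_0.
split; [exact: nbhs0T|by move=> P Q; exact: nbhs0I|].
by move=> P Q PQ; apply: nbhs0S => v /=; exact: PQ.
Qed.

Let lctvs_singleton (x : W) (A : set W) : lctvs_nbhs x A -> A x.
Proof. by move=> /nbhs0_0 /=; rewrite addr0. Qed.

Let lctvs_nbhs_nbhs (x : W) (A : set W) :
  lctvs_nbhs x A -> lctvs_nbhs x (lctvs_nbhs^~ A).
Proof.
move=> /nbhs0_absconvex[C [C0 Cc Ca CA]].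
apply: (@nbhs0S [set v | C (2 *: v)]); last exact: nbhs0Z.
move=> v /= Cv; apply: (@nbhs0S [set w | C (2 *: w)]); last exact: nbhs0Z.
move=> w /= Cw; rewrite -addrA; apply: CA; exact: nbhs0_half.
Qed.

HB.instance Definition _ := Nbhs_isNbhsTopological.Build W
  lctvs_filter lctvs_singleton lctvs_nbhs_nbhs.

Let lctvs_add_continuous : continuous (fun x : W * W => x.1 + x.2).
Proof.
move=> [x y] A /= /nbhs0_absconvex[C [C0 Cc Ca CA]].
have H (z : W) : lctvs_nbhs z [set t | C (2 *: (t - z))].
  apply: (@nbhs0S [set w | C (2 *: w)]); last exact: nbhs0Z.
  by move=> w /=; rewrite addrAC subrr add0r.
exists ([set t | C (2 *: (t - x))], [set t | C (2 *: (t - y))]); first by split; exact: H.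
move=> [s t] /= [Cs Ct].
have -> : s + t = x + y + ((s - x) + (t - y)).
  by rewrite addrACA [x + _]addrC [y + _]addrC !subrK.
apply: CA; exact: nbhs0_half.
Qed.

Let lctvs_scale_continuous : continuous (fun z : K^o * W => z.1 *: z.2).
Proof.
move=> [k x] A /= /nbhs0_absconvex[C [C0 Cc Ca CA]].
have [r r0 Cx] := Ca x.
have k1 : 0 < `|k| + 1 by rewrite ltr_wpDl.
pose M := `|k| + 1.
have M0 : 0 < 2 * M by exact: mulr_gt0.
exists ([set l | `|k - l| < 1] `&` [set l | `|k - l| < r / 2],
        [set t | C ((2 * M) *: (t - x))]).
  split.
    by apply: filterI; apply: (@nbhsx_ballx K K^o k); rewrite ?divr_gt0.
  apply: (@nbhs0S [set w | C ((2 * M) *: w)]); last exact: nbhs0Z.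
  by move=> w /=; rewrite addrAC subrr add0r.
move=> [l t] /= [[kl1 klr] Ct].
have -> : l *: t = k *: x + (l *: (t - x) + (l - k) *: x).
  by rewrite scalerBr scalerBl addrC [X in X + _]addrA subrK subrK.
apply: CA; apply: nbhs0_half => //.
- have -> : 2 *: (l *: (t - x)) = (l / M) *: ((2 * M) *: (t - x)).
    by rewrite !scalerA mulrCA (divfK (lt0r_neq0 k1)).
  apply: absconvexZ => //.
  rewrite normf_div (gtr0_norm k1) ler_pdivrMr// mul1r.
  rewrite -[l](subrK k) (le_trans (ler_normD _ _))// addrC lerD2l.
  by rewrite distrC ltW.
- have -> : 2 *: ((l - k) *: x) = (2 * (l - k) / r) *: (r *: x).
    by rewrite !scalerA divfK ?gt_eqF.
  apply: absconvexZ => //.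
  rewrite normf_div normrM (gtr0_norm r0) ler_pdivrMr// mul1r.
  by rewrite ger0_norm// mulrC -ler_pdivlMr// distrC ltW.
Qed.

Let lctvs_locally_convex :
  exists2 b : set_system W, (forall c, c \in b -> convex_set c) & basis b.
Proof.
exists [set A : set W | open A /\ convex_set A].
  by move=> c /set_mem[].
split; first by move=> A [].
move=> x A /nbhs0_absconvex[C [C0 Cc Ca CA]].
pose D := [set t : W | C (t - x)].
have Dx : nbhs x D.
  by apply: nbhs0S C0 => v /= Cv; rewrite /D /= [x + v]addrC addrK.
exists (interior D); last first.
  move=> t /nbhs_singleton Dt; rewrite -[t](subrK x) addrC; exact: CA.
split; last exact: Dx.
split; first exact: open_interior.
move=> y z l /set_mem yD /set_mem zD; apply/mem_set.
have := nbhs0I yD zD; apply: nbhs0S => v /= [Dy Dz].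
rewrite /D /=.
have -> : (conv l (y : convex_lmodType W) z : W) + v - x =
    l%:num *: (y + v - x) + (1 - l%:num) *: (z + v - x).
  have E (t : W) : t + v - x = t + (v - x) by rewrite addrA.
  rewrite !E; move: (v - x) => d; rewrite !scalerDr addrACA -scalerDl.
  by rewrite [X in _ + X *: d]addrC subrK scale1r.
apply: Cc => //.
rewrite !ger0_norm ?subr_ge0 ?ge0 ?le1//.
by rewrite addrC subrK.
Qed.

(* This factory only builds the uniform structure. *)
HB.instance Definition _ := PreTopologicalLmod_isTvs.Build K W
  lctvs_add_continuous lctvs_scale_continuous lctvs_locally_convex.
HB.instance Definition _ :=
  PreTopologicalNmodule_isTopologicalNmodule.Build W lctvs_add_continuous.
HB.instance Definition _ :=
  TopologicalNmodule_isTopologicalLmodule.Build K W lctvs_scale_continuous.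
HB.instance Definition _ := Uniform_isTvs.Build K W lctvs_locally_convex.

End lctvs.

Section topdual.
Context (K : numFieldType) (V : tvsType K).

Definition topdual_pred : {pred V -> K^o} :=
  [pred f : V -> K^o | `[< linear f /\ continuous f >]].

Let topdual_pred_submod_closed : submod_closed topdual_pred.
Proof.
split.
  apply/asboolP; split; last by move=> x; exact: cvg_cst.
  by move=> a x y; rewrite /= scaler0 addr0.
move=> a f g /asboolP[lf cf] /asboolP[lg cg]; apply/asboolP; split.
  move=> b x y; rewrite !fctE lf lg !scalerDr addrACA.
  by congr (_ + _ + _); exact: mulrCA.
move=> x; apply: (@cvgD K K^o _ _ _ (a \*: f) g); last exact: cg.
by apply: cvgZl_tmp; exact: cf.
Qed.

HB.instance Definition _ :=
  GRing.isSubmodClosed.Build _ _ topdual_pred topdual_pred_submod_closed.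

Record topdual := TopDual { topdual_fun :> V -> K^o; _ : topdual_fun \in topdual_pred }.

HB.instance Definition _ := [isSub for topdual_fun].
HB.instance Definition _ := [Choice of topdual by <:].
HB.instance Definition _ := [SubChoice_isSubLmodule of topdual by <:].

Lemma topdual_linear (f : topdual) : linear f.
Proof. by case: f => f /= /asboolP[]. Qed.

Lemma topdual_continuous (f : topdual) : continuous f.
Proof. by case: f => f /= /asboolP[]. Qed.

HB.instance Definition _ (f : topdual) :=
  GRing.isLinear.Build K V K^o *:%R (topdual_fun f) (topdual_linear f).
End topdual.

Section strong_weak.
Context (K : numFieldType) (V : tvsType K).

Definition tvs_bounded (A : set V) := forall U : set V, nbhs 0 U ->
  exists2 r : K, 0 < r & forall x, A x -> U (r *: x).

Definition strong_sets : set (set (topdual V)) :=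
  [set U | exists2 A : set V, tvs_bounded A &
           U = [set f : topdual V | forall x, A x -> `|f x| <= 1]].

Fact strong_absconvex U : strong_sets U -> absconvex U.
Proof.
move=> [A _ ->] f g a b /= fA gA ab x Ax.
rewrite (le_trans (ler_normD _ _))// !normrM (le_trans _ ab)//.
by rewrite lerD// ler_piMr// ?fA ?gA.
Qed.

Fact strong_absorbing U : strong_sets U -> absorbing U.
Proof.
move=> [A bA ->] f /=.
have /bA[r r0 rA] : nbhs (0 : V) [set x | `|f x| < 1].
  have := @topdual_continuous _ _ f 0; rewrite /continuous_at linear0 => f0.
  have : nbhs (0 : V) (topdual_fun f @^-1` ball (0 : K^o) 1).
    by apply: f0; exact: nbhsx_ballx.
  by apply: filterS => x; rewrite /= -ball_normE /= sub0r normrN.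
exists r => // x Ax.
by move: (rA x Ax) => /=; rewrite linearZ => /ltW.
Qed.

Definition strong_base : lcbase (topdual V) :=
  LcBase strong_absconvex strong_absorbing.

Definition strong_dual : Type := lctvs strong_base.
HB.instance Definition _ := Tvs.copy strong_dual (lctvs strong_base).

Definition weak_sets : set (set V) :=
  [set U | exists f : topdual V, U = [set x | `|f x| <= 1]].

Fact weak_absconvex U : weak_sets U -> absconvex U.
Proof.
move=> [f ->] x y a b /= fx fy ab; rewrite linearP linearZ /=.
rewrite (le_trans (ler_normD _ _))// !normrM (le_trans _ ab)//.
by rewrite lerD// ler_piMr.
Qed.

Fact weak_absorbing U : weak_sets U -> absorbing U.
Proof.
move=> [f ->] x /=.
have f0 : 0 < `|f x| + 1 by rewrite ltr_wpDl.
exists (`|f x| + 1)^-1; first by rewrite invr_gt0.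
by rewrite linearZ /= normrM gtr0_norm ?invr_gt0// ler_pdivrMl// mulr1 lerDl.
Qed.

Definition weak_base : lcbase V := LcBase weak_absconvex weak_absorbing.

Definition weak_space : Type := lctvs weak_base.
HB.instance Definition _ := Tvs.copy weak_space (lctvs weak_base).

End strong_weak.

Section limits.
Context (K : numFieldType).

(* Surjectivity of the canonical map E -> E''. *)
Definition reflexive_space (E : normedModType K) :=
  forall F : topdual (strong_dual E), exists x : E, forall f : topdual E, F f = f x.

Definition weakly_compact (X Y : normedModType K) (u : X -> Y) :=
  precompact (u @` [set x | `|x| <= 1] : set (weak_space Y)).

(* V is the space of threads of X_0 <- X_1 <- ..., with the topology induced by
   the product. *)
Definition projective_limit (V : tvsType K)
    (X : nat -> completeNormedModType K)
    (u : forall k, {linear X k.+1 -> X k}) (p : forall k, {linear V -> X k}) :=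
  let P : V -> prod_topology X := fun v k => p k v in
  [/\ injective P,
      range P = [set x : prod_topology X | forall k, u k (x k.+1) = x k] &
      forall A : set V, open A <-> open (A : set (initial_topology P))].

(* For injective v: V is the union of Y_0 -> Y_1 -> ..., with the finest locally
   convex topology making every i_k continuous (every locally convex topology on
   V is that of some [lctvs B]). *)
Definition inductive_limit (V : tvsType K)
    (Y : nat -> completeNormedModType K)
    (v : forall k, {linear Y k -> Y k.+1}) (i : forall k, {linear Y k -> V}) :=
  [/\ forall k y, i k.+1 (v k y) = i k y,
      forall k, injective (i k),
      forall x : V, exists k y, i k y = x,
      forall k, continuous (i k) &
      forall B : lcbase V,
        (forall k, continuous (i k : Y k -> lctvs B)) ->
        continuous (id : V -> lctvs B)].

Definition FS_star (V : tvsType K) :=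
  exists (X : nat -> completeNormedModType K)
         (u : forall k, {linear X k.+1 -> X k}) (p : forall k, {linear V -> X k}),
    [/\ forall k, continuous (u k),
        forall k, weakly_compact (u k) &
        projective_limit u p].

Definition DFS_star (V : tvsType K) :=
  exists (Y : nat -> completeNormedModType K)
         (v : forall k, {linear Y k -> Y k.+1}) (i : forall k, {linear Y k -> V}),
    [/\ forall k, continuous (v k), forall k, injective (v k),
        forall k, weakly_compact (v k) &
        inductive_limit v i].

Definition dense_embedding (X Y : tvsType K) (f : {linear X -> Y}) :=
  [/\ injective f, continuous f & dense (range f)].

End limits.

Section smooth.
Context {R : realType} {n : nat}.
Local Notation Rn := 'rV[R]_n.
Local Notation C := R[i].
Implicit Types (f g : Rn -> C^o) (s : seq 'I_n).

Definition re f : Rn -> R^o := fun x => complex.Re (f x).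
Definition im f : Rn -> R^o := fun x => complex.Im (f x).

Definition partial (j : 'I_n) f : Rn -> C^o := fun x =>
  ('D_('e_j) (re f) x +i* 'D_('e_j) (im f) x)%C.

(* Iterated partial derivatives are indexed by words s : seq 'I_n; on smooth
   functions the order of the letters is immaterial (Schwarz), so that words of
   length <= N and multi-indices of order <= N give the same derivatives. *)
Definition partials s f : Rn -> C^o := foldr partial f s.

Definition C1 f := [/\ continuous (re f), continuous (im f) &
  forall j x, derivable (re f) x 'e_j /\ derivable (im f) x 'e_j].

Definition smooth f := forall s, C1 (partials s f).

Definition tsupport f : set Rn := closure [set x | f x != 0].

Lemma re_lin (a : C) f g : re (a *: f + g) =
  (complex.Re a *: re f - complex.Im a *: im f) + re g.
Proof.
by apply/funext => x; rewrite /re /im !fctE; case: a (f x) (g x) => [? ?] [? ?] [? ?].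
Qed.

Lemma im_lin (a : C) f g : im (a *: f + g) =
  (complex.Re a *: im f + complex.Im a *: re f) + im g.
Proof.
by apply/funext => x; rewrite /re /im !fctE; case: a (f x) (g x) => [? ?] [? ?] [? ?].
Qed.

Lemma C1_lin (a : C) f g : C1 f -> C1 g -> C1 (a *: f + g).
Proof.
move=> [cf1 cf2 df] [cg1 cg2 dg]; split.
- rewrite re_lin => x; pose u : Rn -> R^o := re f; pose v : Rn -> R^o := im f.
  pose w : Rn -> R^o := re g.
  have h1 : u @ x --> u x by exact: cf1.
  have h2 : v @ x --> v x by exact: cf2.
  have h3 : w @ x --> w x by exact: cg1.
  exact: (cvgD (cvgB (cvgZl_tmp h1) (cvgZl_tmp h2)) h3).
- rewrite im_lin => x; pose u : Rn -> R^o := re f; pose v : Rn -> R^o := im f.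
  pose w : Rn -> R^o := im g.
  have h1 : u @ x --> u x by exact: cf1.
  have h2 : v @ x --> v x by exact: cf2.
  have h3 : w @ x --> w x by exact: cg2.
  exact: (cvgD (cvgD (cvgZl_tmp h2) (cvgZl_tmp h1)) h3).
- move=> j x; have [f1 f2] := df j x; have [g1 g2] := dg j x.
  rewrite re_lin im_lin; split.
    exact: (derivableD (derivableB (derivableZ f1) (derivableZ f2)) g1).
  exact: (derivableD (derivableD (derivableZ f2) (derivableZ f1)) g2).
Qed.

Lemma partial_lin j (a : C) f g : C1 f -> C1 g ->
  partial j (a *: f + g) = a *: partial j f + partial j g.
Proof.
move=> [_ _ df] [_ _ dg]; apply/funext => x.
have [f1 f2] := df j x; have [g1 g2] := dg j x.
have Z1 (b : R) := @derivableZ _ _ _ _ b _ _ f1; have Z2 (b : R) := @derivableZ _ _ _ _ b _ _ f2.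
rewrite !fctE /partial re_lin im_lin.
rewrite (deriveD (derivableB (Z1 _) (Z2 _)) g1) (deriveB (Z1 _) (Z2 _)).
rewrite (deriveD (derivableD (Z2 _) (Z1 _)) g2) (deriveD (Z2 _) (Z1 _)).
by rewrite !(deriveZ _ f1) !(deriveZ _ f2); case: a.
Qed.

Lemma partials_lin s (a : C) f g : smooth f -> smooth g ->
  partials s (a *: f + g) = a *: partials s f + partials s g.
Proof.
move=> sf sg; elim: s => //= j s ->; exact: partial_lin.
Qed.

Lemma smooth_lin (a : C) f g : smooth f -> smooth g -> smooth (a *: f + g).
Proof. by move=> sf sg s; rewrite partials_lin//; exact: C1_lin. Qed.

Lemma partial0 j : partial j 0 = 0.
Proof.
have re0 : re 0 = cst 0 by []. have im0 : im 0 = cst 0 by [].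
by apply/funext => x; rewrite /partial re0 im0 !derive_cst.
Qed.

Lemma partials0 s : partials s 0 = 0.
Proof. by elim: s => //= j s ->; exact: partial0. Qed.

Lemma C1_0 : C1 0.
Proof.
have re0 : re 0 = cst 0 by []. have im0 : im 0 = cst 0 by [].
split; rewrite ?re0 ?im0; [exact: cst_continuous..|].
by move=> j x; split; exact: derivable_cst.
Qed.

Lemma smooth0 : smooth 0.
Proof. by move=> s; rewrite partials0; exact: C1_0. Qed.

Lemma partialsZ s (a : C) f : smooth f -> partials s (a *: f) = a *: partials s f.
Proof.
move=> sf; have := partials_lin s a sf smooth0.
by rewrite addr0 partials0 addr0.
Qed.

Lemma partials_comb s (a b : C) f g : smooth f -> smooth g ->
  partials s (a *: f + b *: g) = a *: partials s f + b *: partials s g.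
Proof.
move=> sf sg; have sbg : smooth (b *: g).
  by have := smooth_lin b sg smooth0; rewrite addr0.
by rewrite (partials_lin s a sf sbg) (partialsZ s b sg).
Qed.

Lemma smooth_partial j f : smooth f -> smooth (partial j f).
Proof.
by move=> sf s; have := sf (rcons s j); rewrite /partials foldr_rcons.
Qed.

Let quotient_shift (u : Rn -> R^o) h x v :
  (fun t : R => t^-1 *: (((fun y => u (y + h)) \o shift x) (t *: v) - u (x + h)))
  = (fun t : R => t^-1 *: ((u \o shift (x + h)) (t *: v) - u (x + h))).
Proof. by apply/funext => t /=; rewrite addrA. Qed.

Lemma derive_shift (u : Rn -> R^o) h x v :
  'D_v (fun y => u (y + h)) x = 'D_v u (x + h).
Proof. by rewrite /derive quotient_shift. Qed.

Lemma derivable_shift (u : Rn -> R^o) h x v :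
  derivable (fun y => u (y + h)) x v = derivable u (x + h) v.
Proof. by rewrite /derivable quotient_shift. Qed.

Lemma re_shift f h : re (fun x => f (x + h)) = (fun x => re f (x + h)).
Proof. by []. Qed.

Lemma im_shift f h : im (fun x => f (x + h)) = (fun x => im f (x + h)).
Proof. by []. Qed.

Lemma partials_shift s f h :
  partials s (fun x => f (x + h)) = (fun x => partials s f (x + h)).
Proof.
elim: s => //= j s ->; apply/funext => x.
by rewrite /partial re_shift im_shift !derive_shift.
Qed.

Lemma smooth_shift f h : smooth f -> smooth (fun x => f (x + h)).
Proof.
move=> sf s; rewrite partials_shift; have [c1 c2 d] := sf s.
have ch : continuous (fun x : Rn => x + h).
  by move=> x; exact: (cvgD (@cvg_id _ (nbhs x)) (@cvg_cst _ h _ _ _)).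
split.
- by move=> x; exact: (continuous_comp (ch x) (c1 (x + h))).
- by move=> x; exact: (continuous_comp (ch x) (c2 (x + h))).
- by move=> j x; rewrite re_shift im_shift !derivable_shift; exact: d.
Qed.

End smooth.

Section spaces.
Context (R : realType) (n : nat).
Local Notation Rn := 'rV[R]_n.
Local Notation C := R[i].

Definition test_pred : {pred Rn -> C^o} :=
  [pred f : Rn -> C^o | `[< smooth f /\ compact (tsupport f) >]].

Let test_pred_submod_closed : submod_closed test_pred.
Proof.
split.
  apply/asboolP; split; first exact: smooth0.
  rewrite /tsupport (_ : [set x | _] = set0); last first.
    by apply/seteqP; split => x //=; rewrite eqxx.
  by rewrite closure0; exact: compact0.
move=> a f g /asboolP[sf kf] /asboolP[sg kg]; apply/asboolP; split.
  exact: smooth_lin.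
apply: (subclosed_compact _ (compactU kf kg)); first exact: closed_closure.
rewrite /tsupport -closureU; apply: closure_subset => x /= afg.
apply: contrapT => /not_orP[/negP/negPn/eqP f0 /negP/negPn/eqP g0].
by move: afg; rewrite !fctE f0 g0 scaler0 addr0 eqxx.
Qed.

HB.instance Definition _ :=
  GRing.isSubmodClosed.Build _ _ test_pred test_pred_submod_closed.

Record testfun :=
  TestFun { test_fun :> Rn -> C^o; _ : test_fun \in test_pred }.

HB.instance Definition _ := [isSub for test_fun].
HB.instance Definition _ := [Choice of testfun by <:].
HB.instance Definition _ := [SubChoice_isSubLmodule of testfun by <:].

Lemma testP (f : testfun) : smooth f /\ compact (tsupport f).
Proof. by case: f => f /= /asboolP. Qed.

Definition monom (a : 'I_n -> nat) (x : Rn) : R := \prod_i x ord0 i ^+ a i.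

Definition schwartz_pred : {pred Rn -> C^o} :=
  [pred f : Rn -> C^o | `[< smooth f /\
     forall (a : 'I_n -> nat) (s : seq 'I_n), exists M : R,
       forall x, `|(monom a x)%:C%C * partials s f x| <= M%:C%C >]].

Let schwartz_pred_submod_closed : submod_closed schwartz_pred.
Proof.
split.
  apply/asboolP; split; first exact: smooth0.
  by move=> a s; exists 0 => x; rewrite partials0 mulr0 normr0.
move=> a f g /asboolP[sf Sf] /asboolP[sg Sg]; apply/asboolP; split.
  exact: smooth_lin.
move=> b s; have [M fM] := Sf b s; have [M' gM'] := Sg b s.
exists (complex.Re `|a| * M + M') => x; rewrite partials_lin// !fctE.
rewrite mulrDr (le_trans (ler_normD _ _))// rmorphD/= lerD//.
rewrite (_ : _ * _ = a * ((monom b x)%:C%C * partials s f x)); last exact: mulrCA.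
rewrite normrM rmorphM/= ler_pM//.
Qed.

HB.instance Definition _ :=
  GRing.isSubmodClosed.Build _ _ schwartz_pred schwartz_pred_submod_closed.

Record schwartzfun :=
  SchwartzFun { schwartz_fun :> Rn -> C^o; _ : schwartz_fun \in schwartz_pred }.

HB.instance Definition _ := [isSub for schwartz_fun].
HB.instance Definition _ := [Choice of schwartzfun by <:].
HB.instance Definition _ := [SubChoice_isSubLmodule of schwartzfun by <:].

Lemma schwartzP (f : schwartzfun) : smooth f /\
  forall (a : 'I_n -> nat) (s : seq 'I_n), exists M : R,
    forall x, `|(monom a x)%:C%C * partials s f x| <= M%:C%C.
Proof. by case: f => f /= /asboolP. Qed.

(* The usual inductive limit topology: an absolutely convex U is a neighbourhood
   of 0 iff its trace on every D_A, A compact, is one. *)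
Definition test_sets : set (set testfun) :=
  [set U | [/\ absconvex U, absorbing U &
    forall A : set Rn, compact A -> exists (N : nat) (e : R), 0 < e /\
      forall f : testfun, tsupport f `<=` A ->
        (forall s, (size s <= N)%N -> forall x, `|partials s f x| <= e%:C%C) ->
        U f]].

Definition test_base : lcbase testfun :=
  @LcBase _ testfun test_sets (fun U h => let: And3 c _ _ := h in c)
    (fun U h => let: And3 _ a _ := h in a).

Definition test_space : Type := lctvs test_base.
HB.instance Definition _ := Tvs.copy test_space (lctvs test_base).

Definition schwartz_sets : set (set schwartzfun) :=
  [set U | exists (a : 'I_n -> nat) (s : seq 'I_n), U =
    [set f : schwartzfun | forall x, `|(monom a x)%:C%C * partials s f x| <= 1]].

Fact schwartz_absconvex U : schwartz_sets U -> absconvex U.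
Proof.
move=> [m [s ->]] f g a b /= fU gU ab x.
rewrite [X in partials s X](_ : _ = a *: (f : Rn -> C^o) + b *: (g : Rn -> C^o))//.
have [sf _] := schwartzP f; have [sg _] := schwartzP g.
rewrite partials_comb// !fctE mulrDr (le_trans _ ab)//.
rewrite (le_trans (ler_normD _ _))// lerD//.
  rewrite (_ : _ * _ = a * ((monom m x)%:C%C * partials s f x)); last exact: mulrCA.
  by rewrite normrM ler_piMr.
rewrite (_ : _ * _ = b * ((monom m x)%:C%C * partials s g x)); last exact: mulrCA.
by rewrite normrM ler_piMr.
Qed.

Fact schwartz_absorbing U : schwartz_sets U -> absorbing U.
Proof.
move=> [m [s ->]] f /=; have [sf /(_ m s)[M fM]] := schwartzP f.
have M0 : 0 < (`|M| + 1)%:C%C :> C.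
  by rewrite ltcR ltr_wpDl.
exists ((`|M| + 1)%:C%C^-1); first by rewrite invr_gt0.
move=> x.
rewrite [X in partials s X](_ : _ = (`|M| + 1)%:C%C^-1 *: (f : Rn -> C^o))//.
rewrite partialsZ// !fctE.
rewrite (_ : _ * _ = (`|M| + 1)%:C%C^-1 * ((monom m x)%:C%C * partials s f x)); last exact: mulrCA.
rewrite normrM gtr0_norm ?invr_gt0// ler_pdivrMl// mulr1.
by rewrite (le_trans (fM x))// lecR (le_trans (ler_norm _))// lerDl.
Qed.

Definition schwartz_base : lcbase schwartzfun :=
  LcBase schwartz_absconvex schwartz_absorbing.

Definition schwartz_space : Type := lctvs schwartz_base.
HB.instance Definition _ := Tvs.copy schwartz_space (lctvs schwartz_base).

End spaces.

Section maps.
Context (R : realType) (n : nat).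
Local Notation Rn := 'rV[R]_n.
Local Notation C := R[i].
Implicit Types (f : Rn -> C^o) (s : seq 'I_n).

Lemma partial_out (A : set Rn) j f : closed A ->
  (forall x, ~ A x -> f x = 0) -> forall x, ~ A x -> partial j f x = 0.
Proof.
move=> cA f0 x Ax.
have nA : nbhs x (~` A) by apply: open_nbhs_nbhs; split => //; exact: closed_openC.
rewrite /partial (@near_eq_derive _ _ _ _ (cst 0)); last first.
  by apply: filterS nA => y /f0; rewrite /re => ->.
rewrite (@near_eq_derive _ _ _ (im f) (cst 0)); last first.
  by apply: filterS nA => y /f0; rewrite /im => ->.
by rewrite !derive_cst.
Qed.

Lemma partials_out (A : set Rn) s f : closed A ->
  (forall x, ~ A x -> f x = 0) -> forall x, ~ A x -> partials s f x = 0.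
Proof. by move=> cA f0; elim: s => //= j s; exact: partial_out. Qed.

Lemma tsupport_out f x : ~ tsupport f x -> f x = 0.
Proof.
by move=> fx; apply: contrapT => /eqP f0; apply: fx; exact: subset_closure.
Qed.

Let compact_bound (A : set Rn) (u : Rn -> R^o) : compact A -> continuous u ->
  exists M : R, forall x, A x -> `|u x| <= M.
Proof.
move=> cA cu.
have : compact (u @` A) by apply: continuous_compact => //; exact: continuous_subspaceT.
move=> /compact_bounded[M [_ /(_ (M + 1))]]; rewrite ltrDl ltr01 => /(_ isT) H.
by exists (M + 1) => x Ax; apply: H; exists x.
Qed.

Lemma test_schwartz_subproof (f : testfun R n) :
  test_fun f \in @schwartz_pred R n.
Proof.
apply/asboolP; have [sf kf] := testP f; split => // a s.
have [cre cim _] := sf s.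
have [M1 fM1] := compact_bound kf cre; have [M2 fM2] := compact_bound kf cim.
have /compact_bounded[M [_ /(_ (M + 1))]] := kf.
rewrite ltrDl ltr01 => /(_ isT) HM.
exists (Num.max 0 ((\prod_i (M + 1) ^+ a i) * (M1 + M2))) => x.
have [fx|fx] := pselect (tsupport f x); last first.
  rewrite (partials_out s (@closed_closure _ _) (@tsupport_out f) fx).
  by rewrite mulr0 normr0 lecR le_max lexx.
rewrite normrM (@le_trans _ _ (((\prod_i (M + 1) ^+ a i) * (M1 + M2))%:C)%C)//; last first.
  by rewrite lecR le_max lexx orbT.
rewrite rmorphM/= ler_pM//.
  rewrite normc_def/= expr0n addr0 sqrtr_sqr lecR /monom normr_prod.
  apply: ler_prod => i _; rewrite normr_ge0/= normrX lerXn2r ?nnegrE//.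
    by rewrite (le_trans (normr_ge0 x))//; exact: HM.
  apply: le_trans (HM _ fx); rewrite [leRHS](_ : _ = mx_norm x)// mx_normrE.
  by apply/bigmax_geP; right; exists (ord0, i).
rewrite [partials s f x]complexE (le_trans (ler_normD _ _))// rmorphD lerD//.
  by rewrite normc_def/= expr0n addr0 sqrtr_sqr lecR; exact: fM1.
rewrite normrM (_ : `|_| = 1) ?mul1r; last first.
  by rewrite normc_def/= expr0n expr1n add0r sqrtr1.
by rewrite normc_def/= expr0n addr0 sqrtr_sqr lecR; exact: fM2.
Qed.

Definition test_schwartz (f : testfun R n) : schwartzfun R n :=
  SchwartzFun (test_schwartz_subproof f).

Lemma translate_subproof (h : Rn) (f : testfun R n) :
  (fun x => f (x + h)) \in @test_pred R n.
Proof.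
apply/asboolP; have [sf kf] := testP f; split; first exact: smooth_shift.
have ch : continuous (fun x : Rn => x - h).
  by move=> x; exact: (cvgD (@cvg_id _ (nbhs x)) (@cvg_cst _ (- h) _ _ _)).
have : compact ((fun x : Rn => x - h) @` tsupport f).
  by apply: continuous_compact => //; exact: continuous_subspaceT.
move=> cK; apply: (subclosed_compact _ cK); first exact: closed_closure.
move=> x xs; exists (x + h); last by rewrite addrK.
move=> B /= Bxh.
have ch' : continuous (fun x : Rn => x + h).
  by move=> y; exact: (cvgD (@cvg_id _ (nbhs y)) (@cvg_cst _ h _ _ _)).
have [y [fy By]] := xs _ (ch' x _ Bxh).
by exists (y + h).
Qed.

Definition translate (h : Rn) (f : testfun R n) : testfun R n :=
  TestFun (translate_subproof h f).

Lemma schwartz_partials_subproof s (f : schwartzfun R n) :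
  partials s f \in @schwartz_pred R n.
Proof.
apply/asboolP; have [sf Sf] := schwartzP f.
split=> [t|a t]; first by have := sf (t ++ s); rewrite /partials foldr_cat.
by have := Sf a (t ++ s); rewrite /partials foldr_cat.
Qed.

Definition schwartz_partials s (f : schwartzfun R n) : schwartzfun R n :=
  SchwartzFun (schwartz_partials_subproof s f).

End maps.

(* Lebesgue integral on R^n, as an iterated integral; by Fubini the two agree on
   the products of smooth rapidly decreasing functions it is used for. *)
Fixpoint rintegral (R : realType) (n : nat) : ('rV[R]_n -> R) -> R :=
  match n with
  | 0 => fun f => f 0
  | m.+1 => fun f : 'rV[R]_(1 + m) -> R =>
     (\int[@lebesgue_measure R]_(x in setT)
        rintegral (fun y : 'rV[R]_m => f (row_mx x%:M y)))%R
  end.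

Definition cintegral (R : realType) (n : nat) (f : 'rV[R]_n -> R[i]) : R[i] :=
  (rintegral (re f) +i* rintegral (im f))%C.

Definition pairing (R : realType) (n : nat) (f g : 'rV[R]_n -> R[i]) : R[i] :=
  cintegral (fun x => f x * g x).

(* The word with a_j letters j, so that [partials (multi_seq a)] is the
   derivative of multi-index a. *)
Definition multi_seq n (a : 'I_n -> nat) : seq 'I_n :=
  flatten [seq nseq (a j) j | j <- enum 'I_n].

Definition eucl_norm (R : realType) n (x : 'rV[R]_n) : R :=
  Num.sqrt (\sum_j x ord0 j ^+ 2).

Definition distr (R : realType) n := strong_dual (test_space R n).
HB.instance Definition _ (R : realType) n :=
  Tvs.copy (distr R n) (strong_dual (test_space R n)).
Definition tempered (R : realType) n := strong_dual (schwartz_space R n).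
HB.instance Definition _ (R : realType) n :=
  Tvs.copy (tempered R n) (strong_dual (schwartz_space R n)).

(* <T_h f, phi> = <f, T_(-h) phi> and <f^(a), phi> = (-1)^|a| <f, phi^(a)>. *)
Definition distr_translate (R : realType) n (h : 'rV[R]_n) (f : distr R n) :
  testfun R n -> R[i]^o := fun phi => f (translate (- h) phi).

Definition tempered_derivative (R : realType) n (a : 'I_n -> nat)
    (f : tempered R n) : schwartzfun R n -> R[i]^o :=
  fun phi => (-1) ^+ (\sum_j a j) * f (schwartz_partials (multi_seq a) phi).

(* Translation-invariant Banach space of tempered distributions; [tibs_incl] is
   the embedding of E in D', and [tibs_testE] says that D -> E -> D' is the usual
   identification of a test function with a regular distribution. *)
Record tibs (R : realType) (n : nat) := TIBS {
  tibs_sort :> completeNormedModType R[i];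
  tibs_test : {linear test_space R n -> tibs_sort};
  tibs_incl : {linear tibs_sort -> distr R n};
  tibs_testE : forall phi psi : testfun R n,
    tibs_incl (tibs_test phi) psi = pairing phi psi;
  tibs_test_emb : dense_embedding tibs_test;
  tibs_incl_emb : dense_embedding tibs_incl;
  tibs_translate : forall (h : 'rV[R]_n) (g : tibs_sort),
    exists g' : tibs_sort, distr_translate h (tibs_incl g) = tibs_incl g';
  tibs_growth : forall g : tibs_sort,
    exists M tau : R, [/\ 0 < M, 0 <= tau &
      forall (h : 'rV[R]_n) (g' : tibs_sort),
        distr_translate h (tibs_incl g) = tibs_incl g' ->
        `|g'| <= (M * (1 + eucl_norm h) `^ tau)%:C%C] }.

Section DE.
Context (R : realType) (n : nat) (E : tibs R n).

(* f^(a) = e in D', i.e. after restriction of f^(a) to test functions. *)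
Definition derivative_in (a : 'I_n -> nat) (f : tempered R n) (e : E) :=
  forall phi : testfun R n,
    tibs_incl E e phi = tempered_derivative a f (test_schwartz phi).

Definition DE_pred : {pred tempered R n} :=
  [pred f | `[< forall a, exists e, derivative_in a f e >]].

Lemma derivative_in_inj a f e e' :
  derivative_in a f e -> derivative_in a f e' -> e = e'.
Proof.
move=> h h'; have [inj _ _] := tibs_incl_emb E; apply: inj.
apply: val_inj; apply/funext => phi; exact: etrans (h phi) (esym (h' phi)).
Qed.

Lemma derivative_in_lin a c f e f' e' :
  derivative_in a f e -> derivative_in a f' e' ->
  derivative_in a (c *: f + f') (c *: e + e').
Proof.
move=> h h' phi; rewrite linearP.
rewrite [RHS](_ : _ = c * tempered_derivative a f (test_schwartz phi)
   + tempered_derivative a f' (test_schwartz phi)).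
  by rewrite -h -h'.
by rewrite /tempered_derivative mulrCA -mulrDr.
Qed.

Let DE_pred_submod_closed : submod_closed DE_pred.
Proof.
split.
  apply/asboolP => a; exists 0 => phi; rewrite linear0.
  by rewrite /tempered_derivative [LHS](_ : _ = 0)// [X in _ * X](_ : _ = 0)// mulr0.
move=> c f g /asboolP Hf /asboolP Hg; apply/asboolP => a.
have [e he] := Hf a; have [e' he'] := Hg a.
by exists (c *: e + e'); exact: derivative_in_lin.
Qed.

HB.instance Definition _ :=
  GRing.isSubmodClosed.Build _ _ DE_pred DE_pred_submod_closed.

Record DE_type := DEType { DE_val :> tempered R n; _ : DE_val \in DE_pred }.
HB.instance Definition _ := [isSub for DE_val].
HB.instance Definition _ := [Choice of DE_type by <:].
HB.instance Definition _ := [SubChoice_isSubLmodule of DE_type by <:].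

Lemma DE_ex (f : DE_type) (a : 'I_n -> nat) :
  exists e, derivative_in a f e.
Proof. by case: f => f /= /asboolP. Qed.

Definition DE_derivative (a : 'I_n -> nat) (f : DE_type) : E :=
  projT1 (cid (DE_ex f a)).

Lemma DE_derivativeP a (f : DE_type) : derivative_in a f (DE_derivative a f).
Proof. exact: projT2 (cid (DE_ex f a)). Qed.

Lemma DE_derivative_lin a c (f g : DE_type) : DE_derivative a (c *: f + g) =
  c *: DE_derivative a f + DE_derivative a g.
Proof.
apply: (@derivative_in_inj a (c *: f + g)); first exact: DE_derivativeP.
by apply: derivative_in_lin; exact: DE_derivativeP.
Qed.
HB.instance Definition _ a :=
  GRing.isLinear.Build R[i] DE_type E *:%R (DE_derivative a) (DE_derivative_lin a).

(* The closed unit balls of the norms ||f||_(E,N) = max_(|a| <= N) ||f^(a)||_E. *)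
Definition DE_sets : set (set DE_type) :=
  [set U | exists N : nat, U = [set f | forall a : 'I_n -> nat,
    (\sum_j a j <= N)%N -> `|DE_derivative a f| <= 1]].

Fact DE_absconvex U : DE_sets U -> absconvex U.
Proof.
move=> [N ->] f g c d /= fN gN cd a aN; rewrite linearP linearZ /=.
rewrite (le_trans (ler_normD _ _))// !normrZ (le_trans _ cd)//.
by rewrite lerD// ler_piMr// ?fN ?gN.
Qed.

Let DE_bound (N : nat) (f : DE_type) : exists2 M : R[i], 0 < M &
  forall a : 'I_n -> nat, (\sum_j a j <= N)%N -> `|DE_derivative a f| <= M.
Proof.
pose F (a : {ffun 'I_n -> 'I_N.+1}) :=
  `|DE_derivative (fun j => a j : nat) f| : R[i].
exists (\sum_a F a + 1) => [|a aN].
  by rewrite ltr_wpDl// sumr_ge0// => b _; exact: normr_ge0.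
pose b : {ffun 'I_n -> 'I_N.+1} := [ffun j => inord (a j)].
have -> : a = (fun j => b j : nat).
  apply/funext => j; rewrite ffunE inordK// ltnS (leq_trans _ aN)//.
  by rewrite (bigD1 j)//= leq_addr.
rewrite (bigD1 b)//= -addrA lerDl addr_ge0// sumr_ge0// => c _.
exact: normr_ge0.
Qed.

Fact DE_absorbing U : DE_sets U -> absorbing U.
Proof.
move=> [N ->] f; have [M M0 fM] := DE_bound N f.
exists M^-1; first by rewrite invr_gt0.
move=> a aN; rewrite linearZ /= normrZ gtr0_norm ?invr_gt0//.
by rewrite ler_pdivrMl// mulr1 fM.
Qed.

Definition DE_base : lcbase DE_type := LcBase DE_absconvex DE_absorbing.

Definition DE : Type := lctvs DE_base.
HB.instance Definition _ := Tvs.copy DE (lctvs DE_base).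

Definition DE' : Type := strong_dual DE.
HB.instance Definition _ := Tvs.copy DE' (strong_dual DE).

Definition regular_tempered (f : tempered R n) (psi : schwartzfun R n) :=
  forall chi : schwartzfun R n, f chi = pairing psi chi.

(* The restriction of F to S (a subspace of DE) is the tempered distribution psi. *)
Definition restricts_to (F : DE') (psi : schwartzfun R n) :=
  forall phi : schwartzfun R n,
    exists2 f : DE_type, regular_tempered f phi &
      (F : topdual DE) f = pairing psi phi.

Definition schwartz_in_DE' : set DE' :=
  [set F | exists psi : schwartzfun R n, restricts_to F psi].

End DE.
Arguments schwartz_in_DE' {R n} E.

(* Main.v *)
(* Reflexivity of E is used in one form: bounded families in E have weak limits
   along every ultrafilter, and bounded families in E' have weak-star limits.

   By Baire category the translations of E grow polynomially in norm, uniformly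
   on E; cutting a Schwartz function into lattice translates of compactly
   supported pieces then gives S -> E -> S'.

   D_E is the limit of the spaces X_k of k-jets in E, and D'_E' is the union of
   the spaces Y_k of functionals bounded by the k-th norm of D_E.  By Hahn-Banach
   a functional on X_k, or an element of Y_k, is a finite sum of functionals of
   E' applied to derivatives, so the balls of X_k and Y_k are weakly compact.

   For the inductive topology, let W be absolutely convex and contain the
   r_k-ball of Y_k for every k.  Put eps_k = 2^-(k+2) r_k and let A be the bounded
   set of all f with eps_k |f|_k <= 1 for all k.  If |F| <= 1 on A, then |F| <= 2
   already on the set given by finitely many of these inequalities, since a weak
   limit of counterexamples would lie in A; by Hahn-Banach F is then a finite sum
   of elements of the Y_k small enough for F to be in W.

   Test functions are dense in E' because E is reflexive; replacing by test
   functions the functionals in F = sum_a f_a o D^a gives the density of S. *)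
Require Import Defs.
From HB Require Import structures.
From mathcomp Require Import all_boot all_order all_algebra.
From mathcomp Require Import complex ring lra.
From mathcomp Require Import all_classical all_reals all_analysis measurable_realfun.

Set Implicit Arguments.
Unset Strict Implicit.
Unset Printing Implicit Defensive.
Import Order.TTheory GRing.Theory Num.Theory.
Import numFieldNormedType.Exports.
Local Open Scope classical_set_scope.
Local Open Scope ring_scope.

(** * The Hahn-Banach theorem *)

(** Only the embeddings of D in [E] and of [E] in D' are given, and each controls test functions
    with support in a fixed compact set, where a seminorm that is bounded on bounded sets has finite
    order. Passing to S needs translations whose growth is uniform over [E], whereas the hypothesis
    has constants depending on the element and no translation is known in advance to be continuous.
    For this reason the Baire argument runs on sets stable under convergent series instead of closed
    sets. The resulting bounds on cut-offs do not depend on the cut-off radius, and a bounded family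
    already has a weak limit in [E]. Ultrafilters replace subsequences: one ultrafilter gives the
    limits for all functionals at once, linearly in the functional, and no separability enters. The
    inductive topology is the delicate point. A strong neighbourhood is the polar of a set
    restricted by infinitely many norms, while an element of the dual is controlled by one norm;
    going from infinitely many inequalities to finitely many is a compactness argument in D_E
    itself. *)

Section hahn_banach.
Context (R : realType) (Z : lmodType R[i]) (p : Z -> R).
Context (pD : forall x y, p (x + y) <= p x + p y).
Context (pZ : forall (t : R) x, 0 <= t -> p (t%:C%C *: x) = t * p x).

(** Partial functionals are graphs in [Z * R]. Stability under combinations and domination by [p]
    already force such a graph to be single-valued, since [p 0 = 0]. *)
Let good (G : set (Z * R)) :=
  (forall t x y, G x -> G y -> G (t%:C%C *: x.1 + y.1, t * x.2 + y.2)) /\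
  (forall x, G x -> x.2 <= p x.1).

Let extend (G : set (Z * R)) (z0 : Z) : G (0, 0) -> good G ->
  exists c, good [set w | exists2 x, G x & exists t : R,
    w = (x.1 + t%:C%C *: z0, x.2 + t * c)].
Proof.
move=> G0 [Glin Gp].
(* The value c at [z0] has to lie above [S] and below all p (y + z0) - y.2; subadditivity separates
   the two families, and homogeneity reduces every multiple t of [z0] to t = 1 or t = -1. *)
pose S := [set r | exists2 x, G x & r = x.2 - p (x.1 - z0)].
have ub y : G y -> ubound S (p (y.1 + z0) - y.2).
  move=> Gy _ [x Gx ->].
  have := Gp _ (Glin 1 _ _ Gx Gy); rewrite /= scale1r mul1r => h.
  have := pD (x.1 - z0) (y.1 + z0); rewrite addrACA addNr addr0; lra.
have hS : has_sup S.
  split; first by exists (0 - p (0 - z0)), (0, 0).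
  by exists (p (0 + z0) - 0); exact: (ub (0, 0)).
exists (sup S); split.
  move=> t _ _ [x Gx [a ->]] [y Gy [b ->]].
  exists (t%:C%C *: x.1 + y.1, t * x.2 + y.2); first exact: Glin.
  exists (t * a + b); congr (_, _) => /=; last by ring.
  by rewrite rmorphD rmorphM/= scalerDr scalerDl scalerA addrACA.
move=> _ [x Gx [t ->]] /=.
have Gs s : G (s%:C%C *: x.1, s * x.2).
  by have := Glin s _ _ Gx G0; rewrite /= !addr0.
have [t0|t0|->] := ltgtP t 0; last first.
- by rewrite scale0r mul0r !addr0 Gp.
- have : sup S <= p ((t^-1)%:C%C *: x.1 + z0) - t^-1 * x.2.
    apply: ge_sup; first by case: hS.
    exact: (ub ((t^-1)%:C%C *: x.1, t^-1 * x.2)).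
  rewrite -(ler_pM2l t0) mulrBr mulrA mulfV ?gt_eqF// mul1r -(pZ _ (ltW t0)).
  rewrite scalerDr scalerA -rmorphM/= mulfV ?gt_eqF// scale1r; lra.
- pose s := - t; have s0 : 0 < s by rewrite oppr_gt0.
  have : s^-1 * x.2 - p ((s^-1)%:C%C *: x.1 - z0) <= sup S.
    apply: ub_le_sup; first by case: hS.
    by exists ((s^-1)%:C%C *: x.1, s^-1 * x.2).
  rewrite -(ler_pM2l s0) mulrBr mulrA mulfV ?gt_eqF// mul1r -(pZ _ (ltW s0)).
  rewrite scalerBr scalerA -rmorphM/= mulfV ?gt_eqF// scale1r /s.
  rewrite rmorphN/= scaleNr opprK; lra.
Qed.

Lemma hahn_banach_real (G0 : set (Z * R)) : G0 (0, 0) -> good G0 ->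
  exists u : Z -> R, [/\ forall (t : R) x y, u (t%:C%C *: x + y) = t * u x + u y,
    forall x, u x <= p x & forall w, G0 w -> u w.1 = w.2].
Proof.
move=> G00 G0g.
(* Adding [G0] makes the property hold for the union of the empty chain, which is empty. *)
pose P (G : set (Z * R)) := good (G0 `|` G).
have [|A [[Alin Ap] Amax]] := @Zorn_bigcup _ P.
  move=> F FP Ftot; split.
    move=> t x y.
    have H X : F X -> (G0 `|` X) x -> (G0 `|` X) y ->
        (G0 `|` \bigcup_(X in F) X) (t%:C%C *: x.1 + y.1, t * x.2 + y.2).
      move=> FX Hx Hy; have [lin _] := FP _ FX.
      by case: (lin t _ _ Hx Hy) => h; [left|right; exists X].
    move=> [x0|[X FX Xx]] [y0|[Y FY Yy]].
    - by left; apply: (proj1 G0g).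
    - by apply: (H Y) => //; [left|right].
    - by apply: (H X) => //; [right|left].
    - have [XY|YX] := Ftot _ _ FX FY.
        by apply: (H Y) => //; right => //; exact: XY.
      by apply: (H X) => //; right => //; exact: YX.
  move=> x [|[X FX Xx]]; first exact: (proj2 G0g).
  by apply: (proj2 (FP _ FX)); right.
set H := G0 `|` A in Alin Ap.
have H00 : H (0, 0) by left.
have HB x r s : H (x, r) -> H (x, s) -> r = s.
  suff half r' s' : H (x, r') -> H (x, s') -> r' <= s'.
    by move=> h1 h2; apply/eqP; rewrite eq_le !half.
  move=> h1 h2; have := Ap _ (Alin (-1) _ _ h2 h1).
  rewrite /= rmorphN/= scaleN1r addNr.
  have -> : p 0 = 0 by rewrite -[0 in LHS](scale0r (0 : Z)) (pZ 0)// mul0r.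
  lra.
have tot z0 : exists r, H (z0, r).
  apply: contrapT => nH.
  have [c gc] := extend z0 H00 (conj Alin Ap).
  set H' := (X in good X) in gc.
  have HH' : H `<=` H'.
    by move=> [x r] Hx; exists (x, r) => //; exists 0; rewrite /= scale0r mul0r !addr0.
  have nz : H' (z0, c).
    by exists (0, 0) => //; exists 1; rewrite /= scale1r mul1r !add0r.
  apply: (Amax H'); last first.
    by rewrite /P (_ : _ `|` _ = H')//; apply/setUidPr => x x0; apply: HH'; left.
  split; first by move=> x Ax; apply: HH'; right.
  by move=> h; apply: nH; exists c; right; apply: h.
have {tot}[u uP] := choice tot.
exists u; split.
- by move=> t x y; apply: (HB (t%:C%C *: x + y)) => //; exact: (Alin t _ _ (uP x) (uP y)).
- by move=> x; exact: (Ap _ (uP x)).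
- by move=> [x r] G0x; apply: (HB x) => //; left.
Qed.

End hahn_banach.

Section complex_hahn_banach.
Context (R : realType).
Local Notation C := R[i].

Lemma Re_mulC (t : R) (z : C) : complex.Re (t%:C%C * z) = t * complex.Re z.
Proof. by case: z => a b /=; rewrite mul0r subr0. Qed.

(** The functional is given upstairs, on [V], and extended along [L]: the pairs (L v, Re (g v)) form
    a dominated graph, so that [g] automatically factors through the range of [L]. With [L] mapping
    into a finite power this yields representations by finite sums. *)
Lemma hahn_banach (V Z : lmodType C) (p : Z -> R) (L : {linear V -> Z})
    (g : V -> C) :
  (forall x y, p (x + y) <= p x + p y) ->
  (forall c x, (p (c *: x))%:C%C = `|c| * (p x)%:C%C) ->
  linear (g : V -> C^o) -> (forall v, `|g v| <= (p (L v))%:C%C) ->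
  exists G : Z -> C, [/\ linear (G : Z -> C^o), forall z, `|G z| <= (p z)%:C%C &
    forall v, G (L v) = g v].
Proof.
move=> pD pZ glin gp.
have pZr (t : R) x : 0 <= t -> p (t%:C%C *: x) = t * p x.
  move=> t0; apply: complexI; rewrite pZ normc_def/= expr0n addr0 sqrtr_sqr.
  by rewrite ger0_norm// rmorphM.
have Reg (x : C) : complex.Re x <= complex.Re `|x|.
  rewrite normc_def/= (le_trans (ler_norm _))// -sqrtr_sqr ler_wsqrtr//.
  by rewrite lerDl sqr_ge0.
pose G0 := [set w : Z * R | exists v, w = (L v, complex.Re (g v))].
have g0 : g 0 = 0.
  by have := glin (-1) 0 0; rewrite scaler0 addr0 scaleN1r addNr.
have [] := @hahn_banach_real R Z p pD pZr G0.
- by exists 0; rewrite linear0 g0.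
- split.
    move=> t _ _ [v ->] [w ->] /=; exists (t%:C%C *: v + w).
    by rewrite linearP glin raddfD/= Re_mulC.
  move=> _ [v ->]; rewrite /=; apply: (le_trans (Reg (g v))).
  by have := gp v; rewrite lecE => /andP[].
move=> u [ulin up uG].
have uD x y : u (x + y) = u x + u y by have := ulin 1 x y; rewrite scale1r mul1r.
have u0 : u 0 = 0 by have := uD 0 0; rewrite addr0; lra.
have uZ t x : u (t%:C%C *: x) = t * u x by have := ulin t x 0; rewrite u0 !addr0.
pose G z : C := (u z +i* (- u ('i%C *: z)))%C.
have Glin : linear (G : Z -> C^o).
  have uC c x : u (c *: x) = complex.Re c * u x + complex.Im c * u ('i%C *: x).
    by rewrite {1}[c]complexE scalerDl uD uZ ['i%C * _]mulrC -scalerA uZ.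
  move=> c x y; rewrite /G scalerDr !uD scalerA !(uC c) (uC ('i%C * c)).
  case: c => a b /=; rewrite !mul0r !mul1r sub0r add0r.
  by apply/eqP; rewrite eq_complex /=; apply/andP; split; apply/eqP; ring.
exists G; split => //.
- move=> z.
  have GZ c x : G (c *: x) = c * G x.
    by have := Glin c x 0; rewrite /= !addr0 => ->; rewrite /G scaler0 u0 oppr0 addr0.
  have pz0 : 0 <= p z.
    have := pD z (- z); rewrite subrr -(scale0r z) (pZr 0)// mul0r.
    have := pZ (-1) z; rewrite normrN1 mul1r scaleN1r => /complexI ->; lra.
  have [->|Gz0] := eqVneq (G z) 0; first by rewrite normr0 ler0c.
  pose c := `|G z| / G z.
  have c1 : `|c| = 1 by rewrite /c normf_div normr_id divff// normr_eq0.
  have Gcz : G (c *: z) = `|G z| by rewrite GZ /c divfK.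
  have -> : `|G z| = (u (c *: z))%:C%C.
    by rewrite (_ : u _ = complex.Re (G (c *: z)))// Gcz normc_def.
  rewrite lecR (le_trans (up _))//.
  by have := pZ c z; rewrite c1 mul1r => /complexI ->.
- move=> v; have uL w : u (L w) = complex.Re (g w) by apply: (uG (L w, _)); exists w.
  have giv : g ('i%C *: v) = 'i%C * g v.
    by have := glin 'i%C v 0; rewrite g0 !addr0.
  rewrite /G -linearZ !uL giv.
  case: (g v) => a b /=; congr (_ +i* _)%C; ring.
Qed.

End complex_hahn_banach.

(** * Complex norms and Banach spaces *)

Section complex_norms.
Context {R : realType}.
Local Notation C := R[i].

(** Norms take values in [R[i]]. Their real parts carry the same information and place all estimates
    in the ordered field [R], with its suprema and linear arithmetic. *)
Definition cabs (c : C) : R := complex.Re `|c|.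
Definition nrm (V : normedModType C) (x : V) : R := complex.Re `|x|.

Lemma Re_ge0 (z : C) : 0 <= z -> (complex.Re z)%:C%C = z /\ 0 <= complex.Re z.
Proof. by case: z => a b; rewrite lecE /= => /andP[/eqP -> ]. Qed.

Lemma cabsE c : `|c| = (cabs c)%:C%C.
Proof. by rewrite /cabs (proj1 (Re_ge0 _)). Qed.

Lemma nrmE (V : normedModType C) (x : V) : `|x| = (nrm x)%:C%C.
Proof. by rewrite /nrm (proj1 (Re_ge0 _)). Qed.

Lemma cabs_ge0 c : 0 <= cabs c. Proof. exact: (proj2 (Re_ge0 _)). Qed.

Lemma cabs_def c : cabs c = Num.sqrt (complex.Re c ^+ 2 + complex.Im c ^+ 2).
Proof. by rewrite /cabs normc_def. Qed.

Lemma cabsM a b : cabs (a * b) = cabs a * cabs b.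
Proof. by apply: complexI; rewrite rmorphM/= -!cabsE normrM. Qed.

Lemma cabsD a b : cabs (a + b) <= cabs a + cabs b.
Proof. by rewrite -lecR rmorphD/= -!cabsE ler_normD. Qed.

Lemma cabsN a : cabs (- a) = cabs a.
Proof. by rewrite /cabs normrN. Qed.

Lemma cabs_distC a b : cabs (a - b) = cabs (b - a).
Proof. by rewrite -cabsN opprB. Qed.

Lemma cabs0 : cabs 0 = 0. Proof. by rewrite /cabs normr0. Qed.
Lemma cabs1 : cabs 1 = 1. Proof. by rewrite /cabs normr1. Qed.

Lemma cabs_real t : cabs t%:C%C = `|t|.
Proof. by rewrite cabs_def /= expr0n addr0 sqrtr_sqr. Qed.

Lemma cabs_nneg t : 0 <= t -> cabs t%:C%C = t.
Proof. by move=> t0; rewrite cabs_real ger0_norm. Qed.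

Lemma cabsV c : cabs c^-1 = (cabs c)^-1.
Proof. by apply: complexI; rewrite fmorphV -!cabsE normfV. Qed.

Lemma cabs_eq0 c : (cabs c == 0) = (c == 0).
Proof. by rewrite -(inj_eq (@complexI R)) -cabsE normr_eq0. Qed.

Lemma Re_le_cabs c : `|complex.Re c| <= cabs c.
Proof. by rewrite cabs_def -sqrtr_sqr ler_wsqrtr// lerDl sqr_ge0. Qed.

Lemma Im_le_cabs c : `|complex.Im c| <= cabs c.
Proof. by rewrite cabs_def -sqrtr_sqr ler_wsqrtr// lerDr sqr_ge0. Qed.

Lemma cabs_le c : cabs c <= `|complex.Re c| + `|complex.Im c|.
Proof.
rewrite {1}[c]complexE (le_trans (cabsD _ _))// cabsM !cabs_real.
by rewrite [cabs 'i%C]cabs_def /= expr0n expr1n add0r sqrtr1 mul1r.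
Qed.

Lemma le_cabs c t : (`|c| <= t%:C%C) = (cabs c <= t).
Proof. by rewrite cabsE lecR. Qed.

Lemma cabs_sum I (r : seq I) (P : pred I) (F : I -> C) :
  cabs (\sum_(i <- r | P i) F i) <= \sum_(i <- r | P i) cabs (F i).
Proof.
elim/big_ind2 : _ => //; first by rewrite cabs0.
by move=> a b c d ab cd; rewrite (le_trans (cabsD _ _))// lerD.
Qed.

Section nrm.
Context (V : normedModType C).
Implicit Types x y : V.

Lemma nrm_ge0 x : 0 <= nrm x. Proof. exact: (proj2 (Re_ge0 _)). Qed.

Lemma nrmD x y : nrm (x + y) <= nrm x + nrm y.
Proof. by rewrite -lecR rmorphD/= -!nrmE ler_normD. Qed.

Lemma nrmN x : nrm (- x) = nrm x.
Proof. by rewrite /nrm normrN. Qed.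

Lemma nrm_distC x y : nrm (x - y) = nrm (y - x).
Proof. by rewrite -nrmN opprB. Qed.

Lemma nrmZ c x : nrm (c *: x) = cabs c * nrm x.
Proof. by apply: complexI; rewrite rmorphM/= -!nrmE -cabsE normrZ. Qed.

Lemma nrmZr (t : R) x : 0 <= t -> nrm (t%:C%C *: x) = t * nrm x.
Proof. by move=> t0; rewrite nrmZ cabs_nneg. Qed.

Lemma nrm0 : nrm (0 : V) = 0. Proof. by rewrite /nrm normr0. Qed.

Lemma nrm_eq0 x : (nrm x == 0) = (x == 0).
Proof. by rewrite -(inj_eq (@complexI R)) -nrmE normr_eq0. Qed.

Lemma le_nrm x t : (`|x| <= t%:C%C) = (nrm x <= t).
Proof. by rewrite nrmE lecR. Qed.

Lemma nrm_tri x y z : nrm (x - z) <= nrm (x - y) + nrm (y - z).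
Proof. by rewrite (le_trans _ (nrmD _ _))// addrA subrK. Qed.

Definition lim_to (u : nat -> V) (l : V) := forall e : R, 0 < e ->
  exists N, forall k, (N <= k)%N -> nrm (u k - l) <= e.

Lemma lim_to_unique u l l' : lim_to u l -> lim_to u l' -> l = l'.
Proof.
move=> h h'; apply/eqP; rewrite -subr_eq0 -nrm_eq0 eq_le nrm_ge0 andbT.
apply/ler_addgt0Pl => e e0; rewrite addr0.
have e2 : 0 < e / 2 by rewrite divr_gt0.
have [N H] := h _ e2; have [N' H'] := h' _ e2.
rewrite (le_trans (nrm_tri _ (u (maxn N N')) _))//.
rewrite [leRHS](splitr e) lerD//; first by rewrite nrm_distC H// leq_maxl.
by rewrite H'// leq_maxr.
Qed.

Lemma lim_to_le u l (M : R) : lim_to u l -> (forall k, nrm (u k) <= M) -> nrm l <= M.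
Proof.
move=> h uM; apply/ler_addgt0Pl => e e0.
have [N /(_ N (leqnn N)) H] := h _ e0.
by rewrite -(subrK (u N) l) (le_trans (nrmD _ _))// lerD// nrm_distC.
Qed.

End nrm.

Lemma complete_seq (V : completeNormedModType C) (u : nat -> V) :
  (forall e : R, 0 < e -> exists N, forall j k, (N <= j)%N -> (N <= k)%N ->
     nrm (u j - u k) <= e) -> exists l, lim_to u l.
Proof.
move=> H.
have cu : cauchy (u @ \oo).
  apply/cauchy_ballP => e e0; have [eE _] := Re_ge0 (ltW e0).
  have r0 : 0 < complex.Re e by rewrite -ltcR eE.
  have [N HN] := H (complex.Re e / 2) ltac:(by rewrite divr_gt0).
  exists ([set u k | k in [set k | (N <= k)%N]], [set u k | k in [set k | (N <= k)%N]]).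
    by split; exists N => //= k Nk; exists k.
  move=> [_ _] /= [[j Nj <-] [k Nk <-]].
  rewrite -ball_normE /= nrmE -eE ltcR (le_lt_trans (HN _ _ Nj Nk))//.
  by rewrite ltr_pdivrMr// ltr_pMr// ltr1n.
have cv : cvg (u @ \oo) by exact: cauchy_cvg.
move/cvg_ex: cv => [l ul]; exists l => e e0.
have := ul _ (nbhsx_ballx l e%:C%C ltac:(by rewrite ltcR)).
move=> [N _ HN]; exists N => k Nk; have := HN k Nk.
by rewrite -ball_normE /= nrmE ltcR nrm_distC => /ltW.
Qed.

End complex_norms.

Section banach_space.
Context (R : realType) (V : lmodType R[i]).
Local Notation C := R[i].

(** Completeness is asked for sequences only, the form in which it is verified for jets and for
    functionals of finite order; [banach_of] then provides completeness for Cauchy filters. *)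
Record banach_norm := BanachNorm {
  bnorm :> V -> R;
  bnormD : forall x y, bnorm (x + y) <= bnorm x + bnorm y;
  bnormZ : forall c x, bnorm (c *: x) = cabs c * bnorm x;
  bnorm_eq0 : forall x, bnorm x = 0 -> x = 0;
  bnorm_complete : forall u : nat -> V,
    (forall e : R, 0 < e -> exists N, forall j k, (N <= j)%N -> (N <= k)%N ->
       bnorm (u j - u k) <= e) ->
    exists l, forall e : R, 0 < e -> exists N, forall k, (N <= k)%N ->
       bnorm (u k - l) <= e }.

Definition banach_of (p : banach_norm) : Type := V.
HB.instance Definition _ (p : banach_norm) := GRing.Lmodule.on (banach_of p).

Section instance.
Context (p : banach_norm).
Local Notation W := (banach_of p).

Definition cnorm (x : W) : C := (p x)%:C%C.

Let cnormD (x y : W) : cnorm (x + y) <= cnorm x + cnorm y.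
Proof. by rewrite /cnorm -rmorphD lecR bnormD. Qed.

Let cnormZ (c : C) (x : W) : cnorm (c *: x) = `|c| * cnorm x.
Proof. by rewrite /cnorm bnormZ rmorphM/= -cabsE. Qed.

Let cnorm_eq0 (x : W) : cnorm x = 0 -> x = 0.
Proof. by move=> /complexI /bnorm_eq0. Qed.

HB.instance Definition _ := Lmodule_isNormed.Build C W cnormD cnormZ cnorm_eq0.

Lemma bnormE (x : W) : nrm x = p x.
Proof. by []. Qed.

Let complete (F : set_system W) : ProperFilter F -> cauchy F -> cvg F.
Proof.
move=> FF cF; apply/cvg_ex.
have e0 k : 0 < (2^-1 ^+ k : R) by rewrite exprn_gt0.
have cex : cauchy_ex F by exact/cauchyP.
(* Centres of balls of radius 2^-k belonging to the filter form a Cauchy sequence, whose limit is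
   that of the filter. *)
have H k : exists x : W, F [set y | p (x - y) <= 2^-1 ^+ k].
  have [|x Fx] := cex (2^-1 ^+ k)%:C%C; first by rewrite ltcR.
  exists x; apply: filterS Fx => y.
  by rewrite -ball_normE /= nrmE ltcR => /ltW.
have [u uP] := choice H.
have u2 j k : p (u j - u k) <= 2^-1 ^+ j + 2^-1 ^+ k.
  have [y [yj yk]] := filter_ex (filterI (uP j) (uP k)).
  have -> : u j - u k = (u j - y) - (u k - y) by rewrite opprB addrA subrK.
  rewrite (le_trans (nrmD (_ : W) _))// lerD//; last by rewrite nrmN.
have small e : 0 < e -> exists N, forall k, (N <= k)%N -> (2^-1 ^+ k : R) <= e.
  move=> e_gt0; have : (fun k => 2^-1 ^+ k : R^o) @ \oo --> (0 : R^o).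
    by apply: cvg_expr; rewrite ger0_norm ?invr_ge0// invf_lt1 ?ltr1n.
  move=> /cvgrPdist_le /(_ _ e_gt0)[N _ HN]; exists N => k /HN /=.
  by rewrite sub0r normrN ger0_norm// ltW.
have [|l ul] := @bnorm_complete p u.
  move=> e e_gt0; have [N HN] := small (e / 2) ltac:(by rewrite divr_gt0).
  exists N => j k Nj Nk; rewrite (le_trans (u2 _ _))//.
  by rewrite [leRHS](splitr e) lerD ?HN.
exists l; apply/cvg_ballP => e e_gt0.
have [eE _] := Re_ge0 (ltW e_gt0).
have r0 : 0 < complex.Re e by rewrite -ltcR eE.
have e3 : 0 < complex.Re e / 3 by rewrite divr_gt0.
have [N HN] := small _ e3; have [N' HN'] := ul _ e3.
apply: filterS (uP (maxn N N')) => y /= hy.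
rewrite -ball_normE /= -eE nrmE ltcR.
rewrite (le_lt_trans (nrm_tri _ (u (maxn N N') : W) _))//.
have h1 := HN' _ (leq_maxr N N'); have h2 := HN _ (leq_maxl N N').
rewrite (@le_lt_trans _ _ (complex.Re e / 3 + complex.Re e / 3))//; last by lra.
by rewrite lerD// ?(le_trans hy)// nrm_distC.
Qed.

HB.instance Definition _ := Uniform_isComplete.Build W complete.

End instance.
End banach_space.

(** * Locally convex spaces and duals *)

Section tvs_lemmas.
Context {R : realType}.
Local Notation C := R[i].

Section linear_prop.
Context (V W : lmodType C) (g : V -> W) (lg : linear g).

Lemma lin0 : g 0 = 0.
Proof. by have := lg (-1) 0 0; rewrite scaler0 addr0 scaleN1r addNr. Qed.

Lemma linZ c x : g (c *: x) = c *: g x.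
Proof. by have := lg c x 0; rewrite lin0 !addr0. Qed.

Lemma linD x y : g (x + y) = g x + g y.
Proof. by have := lg 1 x y; rewrite !scale1r. Qed.

Lemma linB x y : g (x - y) = g x - g y.
Proof. by rewrite linD -scaleN1r linZ scaleN1r. Qed.

Lemma lin_sum I (r : seq I) (P : pred I) (F : I -> V) :
  g (\sum_(i <- r | P i) F i) = \sum_(i <- r | P i) g (F i).
Proof. exact: (big_morph g linD lin0). Qed.

End linear_prop.

Lemma nbhs0_translate (V : tvsType C) (x : V) (A : set V) :
  nbhs x A <-> nbhs 0 [set v | A (x + v)].
Proof.
split=> [xA|/(nbhsT x)]; last by apply: filterS => _ [v ? <-].
have := nbhsB (- x) xA; rewrite addNr; apply: filterS => _ [v Av <-] /=.
by rewrite addrA subrr add0r.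
Qed.

Lemma linear_continuous0 (V W : tvsType C) (f : {linear V -> W}) :
  (forall U, nbhs (0 : W) U -> nbhs (0 : V) (f @^-1` U)) -> continuous f.
Proof.
move=> H x U /nbhs0_translate/H fU; apply/nbhs0_translate.
by apply: filterS fU => v /=; rewrite linearD.
Qed.

Lemma continuous_linear0 (V W : tvsType C) (f : {linear V -> W}) U :
  continuous f -> nbhs (0 : W) U -> nbhs (0 : V) (f @^-1` U).
Proof. by move=> cf U0; apply: cf; rewrite linear0. Qed.

Lemma nbhs0_normed (V : normedModType C) (A : set V) :
  nbhs 0 A <-> exists2 r : R, 0 < r & forall x, nrm x <= r -> A x.
Proof.
split=> [/nbhs_ballP[e e0 eA]|[r r0 rA]].
  have [eE _] := Re_ge0 (ltW e0).
  have r0 : 0 < complex.Re e by rewrite -ltcR eE.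
  exists (complex.Re e / 2); first by rewrite divr_gt0.
  move=> x xr; apply: eA; rewrite -ball_normE /= sub0r nrmE nrmN -eE ltcR.
  by rewrite (le_lt_trans xr)// ltr_pdivrMr// ltr_pMr// ltr1n.
apply/nbhs_ballP; exists r%:C%C; first by rewrite /= ltcR.
move=> x; rewrite -ball_normE /= sub0r nrmE nrmN ltcR => /ltW; exact: rA.
Qed.

Lemma nbhs0_lctvs (V : lmodType C) (B : lcbase V) (A : set V) :
  nbhs (0 : lctvs B) A <-> exists (m : nat) (U : 'I_m -> set V) (r : R),
    [/\ 0 < r, forall i, lcbase_sets B (U i) &
      forall v : V, (forall i, U i (r%:C%C *: v)) -> A v].
Proof.
have E : nbhs (0 : lctvs B) A = lctvs_nbhs0 B [set v | A (0 + v)] by [].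
rewrite E; split=> -[m [U [r [r0 BU UA]]]].
  exists m, U, (complex.Re r); have [rE _] := Re_ge0 (ltW r0); split => //.
    by rewrite -ltcR rE.
  by rewrite rE => v /UA; rewrite /= add0r.
exists m, U, r%:C%C; split => //; first by rewrite ltcR.
by move=> v /UA; rewrite /= add0r.
Qed.

Lemma lcbase_absconvex (V : lmodType C) (B : lcbase V) U :
  lcbase_sets B U -> absconvex U.
Proof. by case: B => ? /= + _; apply. Qed.

Lemma lcbase_absorbing (V : lmodType C) (B : lcbase V) U :
  lcbase_sets B U -> absorbing U.
Proof. by case: B => ? /= _; apply. Qed.

Lemma absconvexZr (V : lmodType C) (U : set V) (s t : R) (x : V) :
  absconvex U -> 0 <= s -> s <= t -> U (t%:C%C *: x) -> U (s%:C%C *: x).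
Proof.
move=> Uc s0 st Ux; have [t0|t0] := leP t 0.
  by have -> : s = t by apply/eqP; rewrite eq_le st (le_trans t0).
have -> : s%:C%C *: x = (s / t)%:C%C *: (t%:C%C *: x).
  by rewrite scalerA -rmorphM divfK// gt_eqF.
by apply: absconvexZ => //; rewrite le_cabs cabs_nneg ?divr_ge0 ?(ltW t0)// ler_pdivrMr// mul1r.
Qed.

Lemma lcbase_nbhs (V : lmodType C) (B : lcbase V) (U : set V) (r : R) :
  lcbase_sets B U -> 0 < r -> nbhs (0 : lctvs B) [set v | U (r%:C%C *: v)].
Proof.
move=> BU r0; apply/nbhs0_lctvs; exists 1%N, (fun=> U), r; split => //.
by move=> v /(_ ord0).
Qed.

Lemma lcbase_nbhs1 (V : lmodType C) (B : lcbase V) (U : set V) :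
  lcbase_sets B U -> nbhs (0 : lctvs B) U.
Proof.
move=> BU; have := lcbase_nbhs BU ltr01.
by apply: (@filterS (lctvs B) (nbhs (0 : lctvs B))) => v /=; rewrite scale1r.
Qed.

Lemma scaled_nbhs0 (V : tvsType C) (A : set V) (r : R) : 0 < r ->
  nbhs 0 A -> nbhs 0 [set v | A (r%:C%C *: v)].
Proof.
move=> r0 A0; have r0' : (r%:C%C)^-1 != 0 :> C by rewrite invr_eq0 gt_eqF ?ltcR.
apply: filterS (nbhs0Z r0' A0) => _ [v Av <-] /=.
by rewrite scalerA mulfV ?scale1r// gt_eqF ?ltcR.
Qed.

Lemma linear_continuous_lctvs (V : tvsType C) (W : lmodType C) (B : lcbase W)
    (f : {linear V -> W}) :
  (forall U, lcbase_sets B U -> nbhs (0 : V) (f @^-1` U)) ->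
  continuous (f : V -> lctvs B).
Proof.
move=> H; have H0 U : nbhs (0 : lctvs B) U -> nbhs (0 : V) (f @^-1` U).
  move=> /nbhs0_lctvs[m [W' [r [r0 BW WU]]]].
  have : nbhs (0 : V) [set v | forall i, W' i (f (r%:C%C *: v))].
    apply: (@filter_forall V _ (fun i v => W' i (f (r%:C%C *: v))) (nbhs (0 : V))) => i.
    exact: scaled_nbhs0 (H _ (BW i)).
  by apply: filterS => v /= Hv; apply: WU => i; rewrite -linearZ.
exact: (@linear_continuous0 V (lctvs B) f).
Qed.

Lemma linear_continuous_normed (V : tvsType C) (W : normedModType C)
    (f : {linear V -> W}) :
  nbhs (0 : V) [set v | nrm (f v) <= 1] -> continuous f.
Proof.
move=> H; apply: linear_continuous0 => U /nbhs0_normed[r r0 rU].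
have r1 : 0 < r^-1 by rewrite invr_gt0.
apply: filterS (scaled_nbhs0 r1 H) => v /=; rewrite linearZ nrmZr ?(ltW r1)//.
by rewrite ler_pdivrMl// mulr1 => /rU.
Qed.

Lemma continuous_linear_normed (V : tvsType C) (W : normedModType C)
    (f : {linear V -> W}) (e : R) :
  0 < e -> continuous f -> nbhs (0 : V) [set v | nrm (f v) <= e].
Proof.
move=> e0 cf; apply: (@continuous_linear0 _ _ f [set v | nrm v <= e]) => //.
by apply/nbhs0_normed; exists e.
Qed.

Lemma bounded_of_ball (V : normedModType C) (q : V -> R) (r M : R) :
  0 < r -> (forall c x, q (c *: x) = cabs c * q x) ->
  (forall x, nrm x <= r -> q x <= M) -> 0 <= M -> forall x, q x <= M / r * nrm x.
Proof.
move=> r0 qZ qM M0 x; have [->|x0] := eqVneq x 0.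
  by rewrite -(scale0r 0) qZ cabs0 mul0r !mulr_ge0 ?invr_ge0 ?nrm_ge0// ltW.
have nx : 0 < nrm x by rewrite lt_neqAle eq_sym nrm_eq0 x0 nrm_ge0.
have := qM ((r / nrm x)%:C%C *: x); rewrite nrmZr ?divr_ge0 ?nrm_ge0 ?(ltW r0)//.
rewrite divfK ?gt_eqF// qZ cabs_nneg ?divr_ge0 ?(ltW r0) ?(ltW nx)// => /(_ (lexx _)).
have k0 : 0 < r / nrm x by rewrite divr_gt0.
move=> h; rewrite -(ler_pM2l k0) (le_trans h)// le_eqVlt; apply/orP; left.
by apply/eqP; field; rewrite !gt_eqF.
Qed.

Lemma continuous_linear_bounded (V W : normedModType C) (f : {linear V -> W}) :
  continuous f -> exists2 M : R, 0 < M & forall x, nrm (f x) <= M * nrm x.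
Proof.
move=> /(continuous_linear_normed (@ltr01 R)) /nbhs0_normed[r r0 rf].
exists (1 / r); first by rewrite divr_gt0.
apply: (bounded_of_ball (q := fun x => nrm (f x))) => // c x.
by rewrite linearZ nrmZ.
Qed.

Lemma bounded_continuous_linear (V W : normedModType C) (f : {linear V -> W}) (M : R) :
  (forall x, nrm (f x) <= M * nrm x) -> continuous f.
Proof.
move=> fM; apply: linear_continuous_normed; apply/nbhs0_normed.
have M0 : 0 < `|M| + 1 by rewrite ltr_wpDl.
exists (`|M| + 1)^-1; first by rewrite invr_gt0.
move=> x xM /=; rewrite (le_trans (fM _))//.
rewrite (le_trans (ler_wpM2r (nrm_ge0 _) (ler_norm M)))//.
rewrite (@le_trans _ _ ((`|M| + 1) * nrm x)) ?ler_wpM2r ?nrm_ge0 ?lerDl//.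
by rewrite -ler_pdivlMl// mulr1.
Qed.

Lemma tvs_bounded_lctvs (V : lmodType C) (B : lcbase V) (A : set V) :
  (forall U, lcbase_sets B U -> exists2 r : R, 0 < r & forall x, A x -> U (r%:C%C *: x)) ->
  tvs_bounded (A : set (lctvs B)).
Proof.
move=> H U /nbhs0_lctvs[m [W [r [r0 BW WU]]]].
have [s s0 Hs] : exists2 s : R, 0 < s & forall i x, A x -> W i (s%:C%C *: x).
  have /choice[s sP] i : exists s : R, 0 < s /\ forall x, A x -> W i (s%:C%C *: x).
    by have [s s0 Hs] := H _ (BW i); exists s.
  exists (\big[Num.min/1]_i s i).
    by apply: lt_bigmin => // i _; have [] := sP i.
  move=> i x Ax; apply: (absconvexZr (lcbase_absconvex (BW i)) _ (bigmin_le_cond _ _ _)) => //.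
    by apply/ltW/lt_bigmin => // j _; have [] := sP j.
  by have [_] := sP i; apply.
exists (s / r)%:C%C; first by rewrite ltcR divr_gt0.
move=> x Ax; apply: WU => i; rewrite scalerA -rmorphM mulrC divfK ?gt_eqF//.
exact: Hs.
Qed.

Lemma tvs_bounded_normed (V : normedModType C) (A : set V) (M : R) :
  (forall x, A x -> nrm x <= M) -> tvs_bounded A.
Proof.
move=> AM U /nbhs0_normed[r r0 rU]; have M0 : 0 < `|M| + 1 by rewrite ltr_wpDl.
exists (r / (`|M| + 1))%:C%C; first by rewrite ltcR divr_gt0.
move=> x /AM xM; apply: rU; rewrite nrmZr ?divr_ge0 ?(ltW r0) ?(ltW M0)//.
rewrite mulrAC ler_pdivrMr// ler_wpM2l ?(ltW r0)//.
by rewrite (le_trans xM)// (le_trans (ler_norm M))// lerDl.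
Qed.

Section topdual.
Context (V : tvsType C).

Lemma topdual_ex (f : V -> C^o) : linear f -> nbhs (0 : V) [set v | cabs (f v) <= 1] ->
  exists F : topdual V, forall v, F v = f v.
Proof.
move=> lf f1.
pose g : {linear V -> C^o} := HB.pack f (GRing.isLinear.Build _ _ _ _ f lf).
have cf : continuous g by apply: linear_continuous_normed.
have fP : f \in @topdual_pred _ V by apply/asboolP; split.
by exists (TopDual fP).
Qed.

Lemma topdual_nbhs (f : topdual V) : nbhs (0 : V) [set v | cabs (f v) <= 1].
Proof. exact: (continuous_linear_normed (f := f) ltr01 (@topdual_continuous _ _ f)). Qed.

Lemma topdual_ext (f g : topdual V) : (forall v, f v = g v) -> f = g.
Proof. by move=> fg; apply: val_inj; apply/funext. Qed.

Lemma topdual_lin (c : C) (f g : topdual V) v : (c *: f + g) v = c * f v + g v.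
Proof. by []. Qed.

Lemma topdualZ c (f : topdual V) v : (c *: f) v = c * f v. Proof. by []. Qed.

Lemma topdual_sum I (r : seq I) (P : pred I) (F : I -> topdual V) v :
  (\sum_(i <- r | P i) F i) v = \sum_(i <- r | P i) F i v.
Proof. by elim/big_ind2 : _ => // f c g d <- <-. Qed.

End topdual.

Lemma topdual_bounded (E : normedModType C) (f : topdual E) :
  exists2 M : R, 0 < M & forall x, cabs (f x) <= M * nrm x.
Proof. exact: (continuous_linear_bounded (f := f) (@topdual_continuous _ _ f)). Qed.

Lemma topdual_lim (E : normedModType C) (F : topdual E) (u : nat -> E) l :
  lim_to u l -> lim_to (fun k => F (u k) : C^o) (F l : C^o).
Proof.
move=> ul e e0; have [K K0 FK] := topdual_bounded F.
have [M HM] := ul (e / K) ltac:(by rewrite divr_gt0); exists M => k /HM Hk.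
rewrite -linearB (le_trans (FK _))// -ler_pdivlMl// mulrC; exact: Hk.
Qed.

Lemma topdual_ex_bounded (E : normedModType C) (f : E -> C^o) (M : R) : linear f ->
  (forall x, cabs (f x) <= M * nrm x) -> exists F : topdual E, forall v, F v = f v.
Proof.
move=> lf fM; apply: topdual_ex => //.
pose g : {linear E -> C^o} := HB.pack f (GRing.isLinear.Build _ _ _ _ f lf).
exact: (continuous_linear_normed (f := g) ltr01 (bounded_continuous_linear (f := g) fM)).
Qed.

(** Reflexivity concerns functionals continuous for the strong topology. A bound on the dual unit
    ball suffices for that continuity, since this ball is the polar of the bounded unit ball of
    [E]. *)
Lemma reflexive_rep (E : normedModType C) (Phi : topdual E -> C^o) (M : R) :
  reflexive_space E -> linear Phi ->
  (forall f : topdual E, (forall x, cabs (f x) <= nrm x) -> cabs (Phi f) <= M) ->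
  exists x : E, forall f : topdual E, Phi f = f x.
Proof.
move=> rE lPhi PhiM.
have M0 : 0 < `|M| + 1 by rewrite ltr_wpDl.
have ball_bdd : tvs_bounded [set x : E | nrm x <= 1] by apply: (@tvs_bounded_normed E _ 1).
have nb : nbhs (0 : strong_dual E) [set f | cabs (Phi f) <= 1].
  have BU : lcbase_sets (strong_base E)
      [set f : topdual E | forall x, [set x : E | nrm x <= 1] x -> `|f x| <= 1].
    by exists [set x : E | nrm x <= 1].
  have := lcbase_nbhs BU M0.
  apply: (@filterS (strong_dual E) (nbhs (0 : strong_dual E))) => f /= Hf.
  rewrite -(ler_pM2l M0) -{1}(cabs_nneg (ltW M0)) -cabsM mulr1.
  rewrite (_ : _ * Phi f = Phi ((`|M| + 1)%:C%C *: f)); last first.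
    by rewrite (linZ lPhi).
  rewrite (@le_trans _ _ M)//; last by rewrite (le_trans (ler_norm M))// lerDl.
  apply: PhiM => x; set g := _ *: f in Hf *.
  have := @bounded_of_ball E (fun x => cabs (g x)) 1 1 ltr01.
  rewrite divr1 => h; rewrite -[leRHS]mul1r; apply: h => //.
    by move=> c y; rewrite linearZ cabsM.
  by move=> y /Hf; rewrite le_cabs.
have [F FE] := @topdual_ex (strong_dual E) Phi lPhi nb.
have [x xE] := rE F; exists x => f; rewrite -xE; exact: esym (FE f).
Qed.

End tvs_lemmas.

(** * Operator norms with respect to a nonnegative function *)

Section operator_norm.
Context {R : realType} (V : lmodType R[i]) (N : V -> R).
Context (N0 : forall v, 0 <= N v).
Implicit Types F G : V -> R[i].

Definition op_bound F (M : R) := 0 <= M /\ forall v, cabs (F v) <= M * N v.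
(* Equal to 0, the infimum of the empty set, when F is unbounded. *)
Definition op_norm F : R := inf (op_bound F).

Lemma op_norm_le F M : op_bound F M -> op_norm F <= M.
Proof. by move=> FM; apply: ge_inf => //; exists 0 => x []. Qed.

Lemma op_norm_ge0 F : 0 <= op_norm F.
Proof.
rewrite /op_norm; have [->|/set0P S0] := eqVneq (op_bound F) set0.
  by rewrite inf0.
by apply: lb_le_inf => // x [].
Qed.

Lemma op_normP F v : op_bound F !=set0 -> cabs (F v) <= op_norm F * N v.
Proof.
move=> S0; have [v0|v0] := leP (N v) 0.
  have -> : N v = 0 by apply/eqP; rewrite eq_le v0 N0.
  have [M [_ /(_ v)]] := S0; rewrite mulr0.
  by have -> : N v = 0 by [apply/eqP; rewrite eq_le v0 N0]; rewrite mulr0.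
rewrite -ler_pdivrMr//; apply: lb_le_inf => // M [_ /(_ v)].
by rewrite ler_pdivrMr.
Qed.

Lemma op_boundD F G M M' : op_bound F M -> op_bound G M' ->
  op_bound (fun v => F v + G v) (M + M').
Proof.
move=> [M0 FM] [M0' GM]; split => [|v]; first exact: addr_ge0.
by rewrite (le_trans (cabsD _ _))// mulrDl lerD.
Qed.

Lemma op_boundZ c F M : op_bound F M -> op_bound (fun v => c * F v) (cabs c * M).
Proof.
move=> [M0 FM]; split => [|v]; first by rewrite mulr_ge0 ?cabs_ge0.
by rewrite cabsM -mulrA ler_wpM2l ?cabs_ge0.
Qed.

Lemma op_bound_norm F : op_bound F !=set0 -> op_bound F (op_norm F).
Proof. by move=> F0; split => [|v]; [exact: op_norm_ge0|exact: op_normP]. Qed.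

Lemma op_normD F G : op_bound F !=set0 -> op_bound G !=set0 ->
  op_norm (fun v => F v + G v) <= op_norm F + op_norm G.
Proof. by move=> F0 G0; apply: op_norm_le; apply: op_boundD; exact: op_bound_norm. Qed.

Lemma op_normZ c F : op_bound F !=set0 ->
  op_norm (fun v => c * F v) = cabs c * op_norm F.
Proof.
move=> F0; apply/eqP; rewrite eq_le; apply/andP; split.
  by apply/op_norm_le/op_boundZ/op_bound_norm.
have [->|c0] := eqVneq c 0; first by rewrite cabs0 mul0r op_norm_ge0.
have cc : 0 < cabs c by rewrite lt_neqAle eq_sym cabs_eq0 c0 cabs_ge0.
rewrite -ler_pdivlMl// -cabsV; apply: op_norm_le.
rewrite [X in op_bound X](_ : F = (fun v => c^-1 * (c * F v))); last first.
  by apply/funext => v; rewrite mulrA mulVf// mul1r.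
have [M FM] := F0; apply/op_boundZ/op_bound_norm.
by exists (cabs c * M); exact: op_boundZ.
Qed.

End operator_norm.

(** * Limits along ultrafilters *)

Section ultrafilter_limits.
Context {R : realType} (T : Type) (F : set_system T) (UF : UltraFilter F).
Local Notation C := R[i].

(** The limit is the supremum of the numbers that lie below [h] on some set of the ultrafilter; the
    ultrafilter decides whether [h] exceeds this supremum by more than e, and it cannot. *)
Lemma ultra_limR (h : T -> R) (M : R) : F [set t | `|h t| <= M] ->
  exists l, forall e, 0 < e -> F [set t | `|h t - l| <= e].
Proof.
move=> hM; pose S := [set x | F [set t | x <= h t]].
have SM : S (- M).
  by apply: filterS hM => t /=; rewrite ler_norml => /andP[].
have ubS : ubound S M.
  move=> x Sx; have [t [/= xt]] := filter_ex (filterI Sx hM).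
  by rewrite ler_norml => /andP[_]; exact: le_trans.
have hS : has_sup S by split; [exists (- M)|exists M].
exists (sup S) => e e0.
have [x Sx xe] := sup_adherent e0 hS.
have [Fu|Fn] := in_ultra_setVsetC [set t | sup S + e < h t] UF.
  suff /(ub_le_sup (proj2 hS)) : S (sup S + e) by rewrite gerDl leNgt e0.
  by apply: filterS Fu => t /= /ltW.
apply: filterS (filterI Sx Fn) => t /= [xt /negP]; rewrite -leNgt => te.
by rewrite ler_distl te andbT (le_trans _ xt)// ltW.
Qed.

Lemma ultra_lim (h : T -> C) (M : R) : F [set t | cabs (h t) <= M] ->
  exists l, forall e : R, 0 < e -> F [set t | cabs (h t - l) <= e].
Proof.
move=> hM.
have [|a ha] := @ultra_limR (fun t => complex.Re (h t)) M.
  by apply: filterS hM => t /=; apply: le_trans (Re_le_cabs _).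
have [|b hb] := @ultra_limR (fun t => complex.Im (h t)) M.
  by apply: filterS hM => t /=; apply: le_trans (Im_le_cabs _).
exists (a +i* b)%C => e e0; have e2 : 0 < e / 2 by rewrite divr_gt0.
apply: filterS (filterI (ha _ e2) (hb _ e2)) => t /= [h1 h2].
rewrite (le_trans (cabs_le _))// [leRHS]splitr.
by case: (h t) h1 h2 => x y /= h1 h2; rewrite lerD.
Qed.

Lemma ultra_lim_unique (h : T -> C) l l' :
  (forall e : R, 0 < e -> F [set t | cabs (h t - l) <= e]) ->
  (forall e : R, 0 < e -> F [set t | cabs (h t - l') <= e]) -> l = l'.
Proof.
move=> hl hl'; apply/eqP; rewrite -subr_eq0 -cabs_eq0 eq_le cabs_ge0 andbT.
apply/ler_addgt0Pl => e e0; rewrite addr0; have e2 : 0 < e / 2 by rewrite divr_gt0.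
have [t /= [h1 h2]] := filter_ex (filterI (hl _ e2) (hl' _ e2)).
have -> : l - l' = (h t - l') - (h t - l) by rewrite opprB [RHS]addrC addrA subrK.
by rewrite (le_trans (cabsD _ _))// cabsN [leRHS]splitr lerD.
Qed.

Lemma ultra_lim_lin c (h k : T -> C) l m :
  (forall e : R, 0 < e -> F [set t | cabs (h t - l) <= e]) ->
  (forall e : R, 0 < e -> F [set t | cabs (k t - m) <= e]) ->
  forall e : R, 0 < e -> F [set t | cabs (c * h t + k t - (c * l + m)) <= e].
Proof.
move=> hl km e e0; have c0 : 0 < cabs c + 1 by rewrite ltr_wpDl ?cabs_ge0.
have e1 : 0 < e / 2 / (cabs c + 1) by rewrite !divr_gt0.
have e2 : 0 < e / 2 by rewrite divr_gt0.
apply: filterS (filterI (hl _ e1) (km _ e2)) => t /= [h1 h2].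
rewrite opprD addrACA -mulrBr (le_trans (cabsD _ _))// cabsM [leRHS]splitr lerD//.
rewrite (le_trans (ler_wpM2l (cabs_ge0 c) h1))//.
by rewrite mulrCA ler_piMr ?(ltW e2)// ler_pdivrMr// mul1r lerDl.
Qed.

Lemma ultra_lim_sum (I : finType) (h : I -> T -> C) (l : I -> C) :
  (forall i (e : R), 0 < e -> F [set t | cabs (h i t - l i) <= e]) ->
  forall e : R, 0 < e -> F [set t | cabs (\sum_i h i t - \sum_i l i) <= e].
Proof.
move=> hl.
elim: (index_enum I) => [|i s IH] e e0.
  by apply: filterS (filterT) => t _ /=; rewrite !big_nil subrr cabs0 ltW.
have := @ultra_lim_lin 1 _ _ _ _ (hl i) IH e e0.
by apply: filterS => t /=; rewrite !big_cons !mul1r.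
Qed.

Lemma ultra_lim_le (h : T -> C) l M :
  (forall e : R, 0 < e -> F [set t | cabs (h t - l) <= e]) ->
  F [set t | cabs (h t) <= M] -> cabs l <= M.
Proof.
move=> hl hM; apply/ler_addgt0Pl => e e0.
have [t /= [h1 h2]] := filter_ex (filterI (hl _ e0) hM).
by rewrite -(subrK (h t) l) (le_trans (cabsD _ _))// lerD// cabs_distC.
Qed.

(** The limits of f (e t) depend linearly on f and are bounded by [M] on the dual unit ball;
    reflexivity represents this functional by a point. *)
Lemma weak_limit (E : normedModType C) (e : T -> E) (M : R) :
  reflexive_space E -> F [set t | nrm (e t) <= M] ->
  exists x, forall (f : topdual E) (eps : R), 0 < eps ->
    F [set t | cabs (f (e t) - f x) <= eps].
Proof.
move=> rE eM.
have H (f : topdual E) : exists l, forall eps : R, 0 < eps -> F [set t | cabs (f (e t) - l) <= eps].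
  have [K K0 fK] := topdual_bounded f; apply: (@ultra_lim _ (K * M)).
  by apply: filterS eM => t /= etM; rewrite (le_trans (fK _))// ler_wpM2l ?(ltW K0).
have [Phi PhiP] := choice H.
have [|f fM|x xP] := @reflexive_rep _ E Phi M rE.
- move=> c f g; apply: (ultra_lim_unique (PhiP _)) => eps eps0.
  have := ultra_lim_lin c (PhiP f) (PhiP g) eps0.
  by apply: filterS => t.
- apply: (ultra_lim_le (PhiP f)); apply: filterS eM => t /=; exact: le_trans.
- by exists x => f eps eps0; rewrite -xP; exact: PhiP.
Qed.

(** This is the Banach-Alaoglu theorem in ultrafilter form: pointwise limits keep linearity and the
    bound. *)
Lemma weakstar_limit (E : normedModType C) (f : T -> topdual E) (M : R) :
  F [set t | forall x, cabs (f t x) <= M * nrm x] ->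
  exists2 f0 : topdual E, forall x, cabs (f0 x) <= M * nrm x &
    forall x (eps : R), 0 < eps -> F [set t | cabs (f t x - f0 x) <= eps].
Proof.
move=> fM.
have H x : exists l, forall eps : R, 0 < eps -> F [set t | cabs (f t x - l) <= eps].
  by apply: (@ultra_lim _ (M * nrm x)); apply: filterS fM => t /=.
have [phi phiP] := choice H.
have phiM x : cabs (phi x) <= M * nrm x.
  by apply: (ultra_lim_le (phiP x)); apply: filterS fM => t /=.
have [|f0 f0E] := @topdual_ex_bounded _ E phi M _ phiM.
  move=> c x y; apply: (ultra_lim_unique (phiP _)) => e e0.
  have := ultra_lim_lin c (phiP x) (phiP y) e0.
  by apply: filterS => t; rewrite /= (topdual_linear (f t) c x y).
by exists f0 => x; rewrite f0E//; exact: phiP.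
Qed.

End ultrafilter_limits.

(** * Consequences of the Hahn-Banach theorem *)

Section hahn_banach_applications.
Context {R : realType}.
Local Notation C := R[i].

(** The D_i map [V] into the finite power of [E] with the weighted sum norm. An extension to the
    whole power is the sum of its restrictions to the factors, and each restriction is bounded by
    its own weight. Separate weights matter when norms of several orders occur together. *)
Lemma hahn_banach_family (V : lmodType C) (E : normedModType C) (I : finType)
    (D : I -> {linear V -> E}) (M : I -> R) (g : V -> C^o) :
  (forall i, 0 <= M i) -> linear g ->
  (forall v, cabs (g v) <= \sum_i M i * nrm (D i v)) ->
  exists2 f : I -> topdual E, forall i x, cabs (f i x) <= M i * nrm x &
    forall v, g v = \sum_i f i (D i v).
Proof.
move=> M0 lg gM.
pose Lf v : {ffun I -> E} := [ffun i => D i v].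
have linL : linear Lf.
  by move=> c x y; apply/ffunP => i; rewrite !ffunE linearP.
pose L : {linear V -> {ffun I -> E}} := HB.pack Lf (GRing.isLinear.Build _ _ _ _ Lf linL).
pose p (z : {ffun I -> E}) := \sum_i M i * nrm (z i).
have [||v|G [lG Gp GL]] := @hahn_banach R V {ffun I -> E} p L g _ _ lg.
- move=> x y; rewrite -big_split; apply: ler_sum => i _ /=.
  by rewrite ffunE -mulrDr ler_wpM2l// nrmD.
- move=> c x; rewrite cabsE -rmorphM; congr (_%:C%C); rewrite mulr_sumr.
  by apply: eq_bigr => i _; rewrite ffunE nrmZ mulrCA.
- rewrite le_cabs (le_trans (gM v))//; apply: ler_sum => i _; by rewrite ffunE.
pose d i x : {ffun I -> E} := [ffun j => if j == i then x else 0].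
have dlin i : linear (d i).
  by move=> c x y; apply/ffunP => j; rewrite !ffunE; case: ifP; rewrite ?scaler0 ?addr0.
have H i : exists f : topdual E, forall x, f x = G (d i x).
  apply: (@topdual_ex_bounded _ E _ (M i)).
    by move=> c x y; rewrite dlin lG.
  move=> x; have := Gp (d i x); rewrite le_cabs => h; rewrite (le_trans h)//.
  rewrite /p (bigD1 i)//= big1 ?addr0 ?ffunE ?eqxx// => j ji.
  by rewrite ffunE (negbTE ji) nrm0 mulr0.
have [f fE] := choice H; exists f.
  move=> i x; rewrite fE; have := Gp (d i x); rewrite le_cabs => h; rewrite (le_trans h)//.
  rewrite /p (bigD1 i)//= big1 ?addr0 ?ffunE ?eqxx// => j ji.
  by rewrite ffunE (negbTE ji) nrm0 mulr0.
move=> v; rewrite -GL (_ : L v = \sum_i d i (D i v)); last first.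
  apply/ffunP => j; rewrite sum_ffunE ffunE (bigD1 j)//= ffunE eqxx big1 ?addr0//.
  by move=> i ij; rewrite ffunE eq_sym (negbTE ij).
by rewrite (lin_sum lG); apply: eq_bigr => i _; rewrite fE.
Qed.

Lemma norming_functional (E : normedModType C) (x : E) :
  exists2 f : topdual E, forall y, cabs (f y) <= nrm y & f x = (nrm x)%:C%C.
Proof.
pose Lf (c : C^o) : E := c *: x.
have linL : linear Lf by move=> c a b; rewrite /Lf scalerDl scalerA.
pose L : {linear C^o -> E} := HB.pack Lf (GRing.isLinear.Build _ _ _ _ Lf linL).
pose g (c : C^o) : C^o := c * (nrm x)%:C%C.
have lg : linear g by move=> c a b; rewrite /g mulrDl -scalerAl.
have [||c|G [lG Gp GL]] := @hahn_banach R C^o E (@nrm R E) L g _ _ lg.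
- exact: nrmD.
- by move=> c y; rewrite nrmZ rmorphM/= -cabsE.
- by rewrite le_cabs /g cabsM /= /Lf nrmZ cabs_nneg ?nrm_ge0.
have [f fE] : exists f : topdual E, forall v, f v = G v.
  by apply: (@topdual_ex_bounded _ E G 1) => // y; rewrite mul1r -le_cabs.
exists f => [y|]; first by rewrite fE -le_cabs.
by rewrite fE; have := GL 1; rewrite /= /Lf scale1r /g mul1r.
Qed.

(** If [f] kept distance at least e from the range of [J], then a f + J v -> a e would be dominated
    by the dual norm and extend to the bidual. Reflexivity turns the extension into a point killed
    by the range of [J], hence into 0, although it takes the value e at [f]. *)
Lemma dense_in_dual (E : normedModType C) (V : lmodType C) (J : V -> topdual E) :
  reflexive_space E -> linear J -> (forall x, (forall v, J v x = 0) -> x = 0) ->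
  forall (f : topdual E) (e : R), 0 < e ->
  exists v, forall x, cabs (f x - J v x) <= e * nrm x.
Proof.
move=> rE lJ sep f e e0; apply: contrapT => nv.
have N0 := @nrm_ge0 R E.
have bdd (h : topdual E) : op_bound (@nrm R E) h !=set0.
  by have [M M0 hM] := topdual_bounded h; exists M; split => //; exact: ltW.
pose p (h : topdual E) := op_norm (@nrm R E) h.
pose Lf (w : (C^o * V)%type) : topdual E := w.1 *: f + J w.2.
have linL : linear Lf.
  move=> c [a v] [b w]; rewrite /Lf /= lJ scalerDl scalerDr scalerA addrACA.
  by [].
pose L : {linear (C^o * V)%type -> topdual E} := HB.pack Lf (GRing.isLinear.Build _ _ _ _ Lf linL).
pose g (w : (C^o * V)%type) : C^o := w.1 * e%:C%C.
have lg : linear g by move=> c [a v] [b w]; rewrite /g /= mulrDl; congr (_ + _); exact: esym (mulrA _ _ _).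
have pZ c (h : topdual E) : p (c *: h) = cabs c * p h by exact: (@op_normZ R E (@nrm R E) N0 c h (bdd h)).
have [||w|G [lG Gp GL]] := @hahn_banach R _ _ p L g _ _ lg.
- by move=> h k; exact: (@op_normD R E (@nrm R E) N0 h k (bdd h) (bdd k)).
- by move=> c h; rewrite pZ rmorphM/= -cabsE.
- rewrite le_cabs /g cabsM (cabs_nneg (ltW e0)).
  case: w => a v /=; rewrite /Lf /=.
  have [->|a0] := eqVneq a 0; first by rewrite cabs0 mul0r op_norm_ge0.
  have -> : a *: f + J v = a *: (f - J (- a^-1 *: v)).
    by rewrite (linZ lJ) scalerBr scaleNr scalerN opprK scalerA mulfV// scale1r.
  rewrite pZ ler_wpM2l ?cabs_ge0// leNgt; apply/negP => lt_e.
  apply: nv; exists (- a^-1 *: v) => x.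
  rewrite (le_trans (op_normP (F := f - J (- a^-1 *: v)) N0 x (bdd _)))//.
  by rewrite ler_wpM2r// ltW.
have [x xP] : exists x, forall h : topdual E, G h = h x.
  apply: (@reflexive_rep _ E G 1) => // h h1.
  rewrite -le_cabs (le_trans (Gp _))// lecR op_norm_le//; split => // v.
  by rewrite mul1r.
have x0 : x = 0.
  apply: sep => v; rewrite -xP; have := GL (0, v).
  by rewrite /= /Lf /g /= scale0r add0r mul0r.
have := GL (1, 0); rewrite /= /Lf /g /= scale1r (lin0 lJ) addr0 mul1r xP x0 linear0.
by move=> /complexI/esym/eqP; rewrite gt_eqF.
Qed.

End hahn_banach_applications.

(** * A Baire category argument *)

Section baire.
Context {R : realType} (V : completeNormedModType R[i]).
Local Notation C := R[i].

Lemma lim_to_expr (c : R) : 0 <= c -> forall e : R, 0 < e ->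
  exists N, forall k, (N <= k)%N -> c * 2^-1 ^+ k <= e.
Proof.
move=> c0 e e0.
have c1 : 0 < c + 1 by rewrite ltr_wpDl.
have : (fun k => 2^-1 ^+ k : R^o) @ \oo --> (0 : R^o).
  by apply: cvg_expr; rewrite ger0_norm ?invr_ge0// invf_lt1 ?ltr1n.
have ec : 0 < e / (c + 1) by rewrite divr_gt0.
move=> /cvgrPdist_le /(_ _ ec)[N _ HN]; exists N => k /HN /=.
have h0 : 0 <= (2^-1 ^+ k : R) by rewrite exprn_ge0 ?invr_ge0.
rewrite sub0r normrN ger0_norm// => h.
rewrite (@le_trans _ _ ((c + 1) * 2^-1 ^+ k)) ?ler_wpM2r ?lerDl//.
by rewrite mulrC -ler_pdivlMr.
Qed.

Lemma geometric_cauchy (u : nat -> V) (c : R) : 0 <= c ->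
  (forall j k, (j <= k)%N -> nrm (u k - u j) <= c * 2^-1 ^+ j) ->
  exists l, lim_to u l.
Proof.
move=> c0 H; apply: complete_seq => e e0.
have [N HN] := @lim_to_expr (2 * c) (mulr_ge0 (ler0n _ 2) c0) _ e0; exists N => j k Nj Nk.
rewrite (le_trans (nrm_tri _ (u N) _))// (le_trans _ (HN _ (leqnn N)))//.
rewrite -mulrA mulr2n mulrDl mul1r lerD ?H//.
by rewrite nrm_distC H.
Qed.

(** Otherwise nested balls avoid the sets one after the other, and their centres converge to a point
    outside all of them. *)
Lemma baire_somewhere_dense (A : nat -> set V) : (forall x, exists N, A N x) ->
  exists N x0 (r : R), 0 < r /\
    forall x, nrm (x - x0) <= r -> forall e : R, 0 < e -> exists2 a, A N a & nrm (x - a) <= e.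
Proof.
move=> Acov; apply: contrapT => nd.
(* A ball is a pair of centre and radius. Halving the radius makes the centres a Cauchy sequence,
   and the inequality between distance plus new radius and old radius nests the closed balls. *)
have step (w : nat * (V * R)) : exists w' : V * R, 0 < w.2.2 ->
    [/\ 0 < w'.2, w'.2 <= w.2.2 / 2, nrm (w'.1 - w.2.1) + w'.2 <= w.2.2 &
        forall y, nrm (y - w'.1) <= w'.2 -> ~ A w.1 y].
  case: w => N [x r] /=; have [r0|] := ltP 0 r; last by move=> ?; exists (x, r).
  have r2 : 0 < r / 2 by rewrite divr_gt0.
  apply: contrapT => H; apply: nd; exists N, x, (r / 2); split => // y yx e e0.
  apply: contrapT => He; apply: H.
  have m0 : 0 < Num.min e (r / 2) by rewrite lt_min e0.
  exists (y, Num.min e (r / 2)) => _ /=; split => //.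
  - by rewrite ge_min lexx orbT.
  - by rewrite [leRHS](splitr r) lerD// ge_min lexx orbT.
  - move=> a ya Aa; apply: He; exists a => //.
    by rewrite nrm_distC (le_trans ya)// ge_min lexx.
have [f fP] := choice step.
pose w := fix w (k : nat) : V * R := if k is j.+1 then f (j, w j) else (0, 1).
have w0 k : 0 < (w k).2 by elim: k => //= k /(fP (k, w k))[].
have wP k := fP (k, w k) (w0 k).
have wr k : (w k).2 <= 1 * 2^-1 ^+ k.
  elim: k => [|k IH]; first by rewrite expr0 mulr1.
  by have [_ h _ _] := wP k; rewrite (le_trans h)//= exprSr mulrA ler_pM2r.
have wd j k : (j <= k)%N -> nrm ((w k).1 - (w j).1) + (w k).2 <= (w j).2.
  move=> /subnK <-; elim: (k - j)%N => [|i IH]; first by rewrite add0n subrr nrm0 add0r.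
  rewrite addSn; have [_ _ h _] := wP (i + j)%N; rewrite /= in h *.
  apply: le_trans IH; rewrite (le_trans _ (lerD (lexx (nrm ((w (i + j)%N).1 - (w j).1))) h))//.
  by rewrite addrA lerD2r addrC nrm_tri.
have wd' j k : (j <= k)%N -> nrm ((w k).1 - (w j).1) <= (w j).2.
  by move=> /wd; apply: le_trans; rewrite lerDl ltW.
have [|l lP] := @geometric_cauchy (fun k => (w k).1) 1 ler01.
  by move=> j k jk; rewrite (le_trans (wd' _ _ jk)).
have [N AN] := Acov l; have [_ _ _ /(_ l)] := wP N; apply => //=.
apply/ler_addgt0Pl => e e0; have [M HM] := lP _ e0.
have := wd' N.+1 (maxn M N.+1) (leq_maxr _ _); have := HM _ (leq_maxl M N.+1).
rewrite nrm_distC => h1 h2.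
by rewrite (le_trans (nrm_tri _ (w (maxn M N.+1)).1 _))// lerD.
Qed.

(* Covering by absolutely convex sets closed under 2^-k-weighted convergent
   series: as in the open mapping theorem, no closedness is needed. *)
Lemma baire_series (A : nat -> set V) :
  (forall x, exists N, A N x) -> (forall N, absconvex (A N)) ->
  (forall N (u : nat -> V) x, (forall k, A N ((2 ^+ k : R)%:C%C *: u k)) ->
     lim_to (fun m => \sum_(k < m) u k) x -> A N ((2^-1 : R)%:C%C *: x)) ->
  exists N (r : R), 0 < r /\ forall x, nrm x <= r -> A N x.
Proof.
move=> Acov Acvx Aser.
have [N [x0 [r [r0 rd]]]] := baire_somewhere_dense Acov.
(* Half the difference of approximants of x0 + x and of x0 - x approximates x, which moves the
   centre of the ball to 0. *)
have dense0 x : nrm x <= r -> forall e : R, 0 < e -> exists2 a, A N a & nrm (x - a) <= e.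
  move=> xr e e0.
  have [|a Aa xa] := rd (x0 + x) _ e e0; first by rewrite addrAC subrr add0r.
  have [|b Ab xb] := rd (x0 - x) _ e e0; first by rewrite addrAC subrr add0r nrmN.
  exists ((2^-1 : R)%:C%C *: a + (- 2^-1 : R)%:C%C *: b).
    by apply: Acvx => //; rewrite !cabsE -rmorphD lecR !cabs_real normrN ger0_norm//; lra.
  have -> : x - ((2^-1 : R)%:C%C *: a + (- 2^-1 : R)%:C%C *: b) =
      (2^-1 : R)%:C%C *: ((x0 + x - a) - (x0 - x - b)).
    have -> : x0 + x - a - (x0 - x - b) = x + x - (a - b).
      rewrite !opprB [b + (x - _)]addrC addrACA [- a + b]addrC.
      by rewrite [x - x0]addrC [X in X + _ = _]addrACA subrr add0r.
    rewrite scalerBr -[in x + x](scale1r x) -scalerDl scalerA scalerBr rmorphN/= scaleNr.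
    congr (_ - _); rewrite -[LHS]scale1r; congr (_ *: _).
    by rewrite -(rmorph1 (real_complex R)) -rmorphD -rmorphM mulVf ?pnatr_eq0.
  rewrite nrmZr ?invr_ge0// (le_trans (ler_wpM2l _ (nrmD _ _))) ?invr_ge0//.
  by rewrite nrmN ler_pdivrMl// mulr2n mulrDl !mul1r lerD.
have half j x : nrm x <= r * 2^-1 ^+ j ->
    exists a, A N ((2 ^+ j : R)%:C%C *: a) /\ nrm (x - a) <= r * 2^-1 ^+ j.+1.
  move=> xr; have p0 : 0 < (2 ^+ j : R) by rewrite exprn_gt0.
  have [||a Aa xa] := @dense0 ((2 ^+ j : R)%:C%C *: x) _ (r / 2).
  - rewrite nrmZr ?(ltW p0)// mulrC -ler_pdivlMr//.
    by rewrite -exprVn in xr *; exact: xr.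
  - by rewrite divr_gt0.
  exists ((2 ^- j : R)%:C%C *: a); split.
    by rewrite scalerA -rmorphM mulfV ?gt_eqF// scale1r.
  have -> : x - (2 ^- j : R)%:C%C *: a = (2 ^- j : R)%:C%C *: ((2 ^+ j : R)%:C%C *: x - a).
    by rewrite scalerBr scalerA -rmorphM mulVf ?gt_eqF// scale1r.
  rewrite nrmZr ?invr_ge0 ?(ltW p0)// ler_pdivrMl// (le_trans xa)//.
  rewrite exprVn exprS [leRHS](_ : _ = r / 2)//.
  by move: (gt_eqF p0) => /negbT p1; field; rewrite p1.
exists N, (r / 2); split; first by rewrite divr_gt0.
move=> x xr; pose y := (2 : R)%:C%C *: x.
have yr : nrm y <= r * 2^-1 ^+ 0 by rewrite expr0 mulr1 nrmZr// mulrC -ler_pdivlMr.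
have /choice[g gP] (w : nat * V) : exists a, nrm w.2 <= r * 2^-1 ^+ w.1 ->
    A N ((2 ^+ w.1 : R)%:C%C *: a) /\ nrm (w.2 - a) <= r * 2^-1 ^+ w.1.+1.
  have [h|h] := pselect (nrm w.2 <= r * 2^-1 ^+ w.1); last by exists 0.
  by have [a Ha] := half w.1 _ h; exists a.
(* Successive remainders, of norm at most r 2^-k. They start from 2 x because stability under series
   returns only half of the sum. *)
pose z := fix z (k : nat) : V := if k is j.+1 then z j - g (j, z j) else y.
have zr k : nrm (z k) <= r * 2^-1 ^+ k by elim: k => //= k /(gP (k, _))[].
have zP k := proj1 (gP (k, z k) (zr k)).
have zS m : \sum_(k < m) g (k : nat, z k) = y - z m.
  elim: m => [|m IH]; first by rewrite big_ord0 subrr.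
  by rewrite big_ord_recr IH /= opprB addrA addrAC.
have -> : x = (2^-1 : R)%:C%C *: y.
  by rewrite scalerA -rmorphM mulVf ?scale1r// pnatr_eq0.
apply: (Aser N (fun k => g (k, z k))) => //.
move=> e e0; have [M HM] := @lim_to_expr r (ltW r0) _ e0.
exists M => k Mk; rewrite zS addrAC subrr add0r nrmN (le_trans (zr k))//.
exact: HM.
Qed.

End baire.

(** * Cut-off functions *)

Section smooth_step.
Context {R : realType}.
Implicit Types (x y : R) (p q : {poly R}).

Lemma horner_expRN_bounded p : exists M, forall y, 0 <= y -> `|p.[y] * expR (- y)| <= M.
Proof.
have pow k : exists M, forall y, 0 <= y -> y ^+ k * expR (- y) <= M.
  exists (k`!%:R + 1) => y y0; rewrite expRN ler_pdivrMr ?expR_gt0//.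
  have e1 : 1 <= expR y by rewrite (le_trans _ (expR_ge1Dx y))// lerDl.
  case: k => [|k]; first by rewrite expr0 fact0; nra.
  have k0 : 0 < (k.+1)`!%:R :> R by rewrite ltr0n fact_gt0.
  rewrite mulrDl mul1r -[leLHS]addr0 lerD ?expR_ge0//.
  rewrite -ler_pdivrMl// mulrC (le_trans _ (expR_ge1Dxn k y0))//.
  by rewrite lerDr ler01.
have [M MP] := choice pow.
exists (\sum_(i < size p) `|p`_i| * M i) => y y0.
rewrite horner_coef mulr_suml (le_trans (ler_norm_sum _ _ _))//.
apply: ler_sum => i _; rewrite -mulrA normrM ler_wpM2l//.
by rewrite ger0_norm ?mulr_ge0 ?exprn_ge0 ?expR_ge0// MP.
Qed.

(** A family that contains the classical function exp (-1/x), extended by 0, and is closed under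
    derivation: [dflat p] collects the derivatives of both factors, each contributing 1/x^2. *)
Definition flat p x : R := if 0 < x then p.[x^-1] * expR (- x^-1) else 0.
Definition dflat p : {poly R} := 'X^2 * (p - p^`()).

Lemma is_derive_flat p x : is_derive x 1 (flat p) (flat (dflat p) x).
Proof.
have [x0|x0|->] := ltgtP x 0.
- rewrite /flat ltNge (ltW x0)/=; apply: (@near_eq_is_derive _ _ _ (cst 0)).
    near=> y; rewrite ltNge (ltW (_ : y < 0))//=.
    by near: y; exact: lt_nbhsl.
- rewrite /flat x0.
  apply: (@near_eq_is_derive _ _ _ (fun y => p.[y^-1] * expR (- y^-1))).
    by near=> y; rewrite (_ : 0 < y)//; near: y; exact: lt_nbhsr.
  have dV : is_derive x 1 (fun y : R => y^-1) (- x ^- 2).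
    by apply: is_derive_eq (is_deriveV (f := id) (lt0r_neq0 x0) _) _; rewrite scaler1.
  have dh : is_derive (x^-1) 1 (horner p) (p^`()).[x^-1].
    by apply: DeriveDef; [exact: derivable_horner|rewrite -derive1E derivE].
  have d1 := is_derive1_comp dh dV.
  have d2 : is_derive x 1 (fun y : R => - y^-1) (x ^- 2).
    by apply: is_derive_eq (is_deriveN dV) _; rewrite opprK.
  have d3 := @is_derive1_comp _ expR (fun y => - y^-1) x _ _ (is_derive_expR _) d2.
  apply: is_derive_eq (is_deriveM d1 d3) _.
  rewrite /dflat !hornerE /= -!exprVn /GRing.scale /=; ring.
- have [M HM] := horner_expRN_bounded ('X^2 * p).
  have f0 q : flat q 0 = 0 by rewrite /flat ltxx.
  (* Bounding 'X^2 * p in place of p gains the factor h^2, so that the difference quotient at 0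
     tends to 0. *)
  have b h : `|flat p h| <= M * h ^+ 2.
    rewrite /flat; case: ifPn => [h0|_]; last first.
      by rewrite normr0 mulr_ge0 ?sqr_ge0// (le_trans _ (HM 0 (lexx 0))).
    have H := HM h^-1 ltac:(by rewrite invr_ge0 ltW).
    rewrite !hornerE -mulrA normrM normrX gtr0_norm ?invr_gt0// exprVn in H.
    by rewrite [leRHS]mulrC -ler_pdivrMl ?exprn_gt0.
  have lim : (fun h => h^-1 *: ((flat p \o shift 0) (h *: (1 : R)) - flat p 0)) @ 0^' --> (0 : R).
    apply/cvgrPdist_le => e e0; have M0 : 0 < `|M| + 1 by rewrite ltr_wpDl.
    exists (e / (`|M| + 1)); first by rewrite /= divr_gt0.
    move=> h /=; rewrite sub0r normrN => he h0.
    rewrite sub0r normrN f0 subr0 /= addr0 scaler1 /GRing.scale/= normrM normfV.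
    have nh : 0 < `|h| by rewrite normr_gt0.
    rewrite ler_pdivrMl// (le_trans (b h))// -(real_normK (num_real h)) expr2 mulrCA.
    rewrite ler_wpM2l// (le_trans (ler_wpM2r (normr_ge0 _) (ler_norm M)))//.
    move: he; rewrite ltr_pdivlMr// => /ltW; rewrite mulrDr mulr1 mulrC.
    by apply: le_trans; rewrite lerDl.
  rewrite f0; apply: DeriveDef; first by apply/cvg_ex; exists 0.
  exact: cvg_lim lim.
Unshelve. all: by end_near. Qed.

Lemma flat1_gt0 x : 0 < x -> 0 < flat 1 x.
Proof. by move=> x0; rewrite /flat x0 hornerE mul1r expR_gt0. Qed.

Lemma flat_le0 p x : x <= 0 -> flat p x = 0.
Proof. by move=> x0; rewrite /flat ltNge x0. Qed.

Lemma flat1_ge0 x : 0 <= flat 1 x.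
Proof. by have [/flat_le0 ->//|/flat1_gt0/ltW] := leP x 0. Qed.

Definition flat_sum x := flat 1 x + flat 1 (1 - x).

Lemma flat_sum_gt0 x : 0 < flat_sum x.
Proof.
have [x0|x0] := leP x 0; last by rewrite ltr_pwDl ?flat1_gt0 ?flat1_ge0.
by rewrite ltr_wpDl ?flat1_ge0 ?flat1_gt0//; lra.
Qed.

Lemma is_derive_flip (f : R -> R) x d : is_derive (1 - x) 1 f d ->
  is_derive x 1 (fun y => f (1 - y)) (- d).
Proof.
move=> df; have d1 : is_derive x 1 (fun y : R => 1 - y) (- 1).
  rewrite -[- 1]add0r; exact: (@is_deriveB R R R (cst 1) id x 1 0 1).
by have := @is_derive1_comp _ f (fun y => 1 - y) x _ _ df d1; rewrite mulrN1.
Qed.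

(* Stable under derivation, whence the smoothness of [flat 1 x / flat_sum x]. *)
Inductive step_alg : (R -> R) -> Prop :=
| step_flat p : step_alg (flat p)
| step_flip p : step_alg (fun x => flat p (1 - x))
| step_inv : step_alg (fun x => (flat_sum x)^-1)
| step_opp f : step_alg f -> step_alg (fun x => - f x)
| step_add f g : step_alg f -> step_alg g -> step_alg (fun x => f x + g x)
| step_mul f g : step_alg f -> step_alg g -> step_alg (fun x => f x * g x).

Lemma step_alg_derive f : step_alg f ->
  exists2 g, step_alg g & forall x, is_derive x 1 f (g x).
Proof.
elim=> {f}.
- by move=> p; exists (flat (dflat p)); [exact: step_flat|exact: is_derive_flat].
- move=> p; exists (fun x => - flat (dflat p) (1 - x)).
    exact/step_opp/step_flip.
  by move=> x; apply: is_derive_flip; exact: is_derive_flat.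
- exists (fun x => - ((flat_sum x)^-1 * (flat_sum x)^-1 *
      (flat (dflat 1) x + - flat (dflat 1) (1 - x)))).
    apply/step_opp/step_mul; first by apply: step_mul; exact: step_inv.
    by apply: step_add; [exact: step_flat|exact/step_opp/step_flip].
  move=> x.
  have d : is_derive x 1 flat_sum (flat (dflat 1) x + - flat (dflat 1) (1 - x)).
    by apply: is_deriveD; [exact: is_derive_flat|apply: is_derive_flip; exact: is_derive_flat].
  apply: is_derive_eq (is_deriveV (lt0r_neq0 (flat_sum_gt0 x)) d) _.
  by rewrite /GRing.scale /= -exprVn expr2 mulNr.
- move=> f _ [g Sg fg]; exists (fun x => - g x); first exact: step_opp.
  by move=> x; exact: is_deriveN.
- move=> f1 f2 _ [g1 S1 d1] _ [g2 S2 d2]; exists (fun x => g1 x + g2 x); first exact: step_add.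
  by move=> x; exact: is_deriveD.
- move=> f1 f2 S1' [g1 S1 d1] S2' [g2 S2 d2]; exists (fun x => f1 x * g2 x + f2 x * g1 x).
    by apply: step_add; exact: step_mul.
  by move=> x; exact: is_deriveM.
Qed.

Lemma is_derive1_continuous (f g : R -> R) : (forall x, is_derive x 1 f (g x)) -> continuous f.
Proof. by move=> fg x; apply/differentiable_continuous/derivable1_diffP; case: (fg x). Qed.

(** The transition function is flat 1 x / flat_sum x, with successive derivatives chosen inside
    [step_alg]. It is locally constant on the open sets x < 0 and x > 1, so all its derivatives
    vanish there, and compactness of [0, 1] bounds the rest. *)
Lemma smooth_step_ex : exists th : nat -> R -> R,
  [/\ forall k x, is_derive x 1 (th k) (th k.+1 x),
      forall x, x < 0 -> th 0%N x = 0,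
      forall x, 1 < x -> th 0%N x = 1,
      forall k x, x < 0 \/ 1 < x -> th k.+1 x = 0 &
      forall k, exists B, forall x, `|th k x| <= B].
Proof.
have /choice[D DP] (f : R -> R) : exists g, step_alg f ->
    step_alg g /\ forall x, is_derive x 1 f (g x).
  have [Sf|] := pselect (step_alg f); last by exists f.
  by have [g Sg fg] := step_alg_derive Sf; exists g.
pose t0 x := flat 1 x * (flat_sum x)^-1.
pose th k := iter k D t0.
have thS k : step_alg (th k).
  elim: k => [|k IH]; first by apply: step_mul; [exact: step_flat|exact: step_inv].
  by have [] := DP _ IH.
have thD k x : is_derive x 1 (th k) (th k.+1 x) by have [_] := DP _ (thS k).
have th0 x : x < 0 -> th 0%N x = 0.
  by move=> x0; rewrite /th /= /t0 flat_le0 ?mul0r// ltW.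
have th1 x : 1 < x -> th 0%N x = 1.
  move=> x1; rewrite /th /= /t0 /flat_sum [flat 1 (1 - x)]flat_le0 ?addr0; last by lra.
  by rewrite mulfV// gt_eqF// flat1_gt0; lra.
have key k x (c : R) : (\near x, th k x = c) -> th k.+1 x = 0.
  move=> nx; have d := thD k x.
  have d' : is_derive x 1 (th k) 0.
    apply: (@near_eq_is_derive _ _ _ (cst c)).
    by apply: filterS nx.
  by rewrite -(@derive_val _ _ _ _ _ _ _ d) (@derive_val _ _ _ _ _ _ _ d').
have thS0 k x : x < 0 \/ 1 < x -> th k.+1 x = 0.
  elim: k x => [|k IH] x [x0|x0].
  - by apply: (key _ _ 0); near=> y; apply: th0; near: y; exact: lt_nbhsl.
  - by apply: (key _ _ 1); near=> y; apply: th1; near: y; exact: lt_nbhsr.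
  - by apply: (key _ _ 0); near=> y; apply: IH; left; near: y; exact: lt_nbhsl.
  - by apply: (key _ _ 0); near=> y; apply: IH; right; near: y; exact: lt_nbhsr.
exists th; split => // k.
have ct : continuous (th k) by exact: is_derive1_continuous (thD k).
have cpt : compact (th k @` `[0, 1]).
  by apply: continuous_compact; [exact: continuous_subspaceT|exact: segment_compact].
have [M [_ /(_ (M + 1))]] := compact_bounded cpt.
rewrite ltrDl ltr01 => /(_ isT) HM.
exists (`|M + 1| + 1) => x.
have [x0|x0] := ltP x 0.
  by case: k {ct cpt HM} => [|k]; rewrite ?th0 ?thS0 ?normr0 ?addr_ge0//; left.
have [x1|x1] := ltP 1 x.
  by case: k {ct cpt HM} => [|k]; rewrite ?th1 ?thS0 ?normr0 ?normr1 ?addr_ge0 ?lerDr//; right.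
rewrite (@le_trans _ _ (M + 1))//; last by rewrite (le_trans (ler_norm _))// lerDl.
by apply: HM; exists x => //=; rewrite in_itv /= x0 x1.
Unshelve. all: by end_near. Qed.

End smooth_step.

(** * Products of smooth functions and the Leibniz rule *)

Section products.
Context {R : realType} {n : nat}.
Local Notation Rn := 'rV[R]_n.
Local Notation C := R[i].
Implicit Types (f g : Rn -> C^o) (s : seq 'I_n).

Lemma C1M f g : C1 f -> C1 g -> C1 (fun x => f x * g x : C^o).
Proof.
move=> [cf1 cf2 df] [cg1 cg2 dg].
have reM : re (fun x => f x * g x) = re f * re g - im f * im g.
  by apply/funext => x; rewrite /re /im !fctE; case: (f x) (g x) => [? ?] [? ?].
have imM : im (fun x => f x * g x) = re f * im g + im f * re g.
  by apply/funext => x; rewrite /re /im !fctE; case: (f x) (g x) => [? ?] [? ?].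
split.
- rewrite reM => x.
  exact: (cvgB (cvgM (cf1 x) (cg1 x)) (cvgM (cf2 x) (cg2 x))).
- rewrite imM => x.
  exact: (cvgD (cvgM (cf1 x) (cg2 x)) (cvgM (cf2 x) (cg1 x))).
- move=> j x; have [f1 f2] := df j x; have [g1 g2] := dg j x; rewrite reM imM; split.
    exact: (derivableB (derivableM f1 g1) (derivableM f2 g2)).
  exact: (derivableD (derivableM f1 g2) (derivableM f2 g1)).
Qed.

Lemma partialM j f g : C1 f -> C1 g ->
  partial j (fun x => f x * g x : C^o) = (fun x => partial j f x * g x) + (fun x => f x * partial j g x).
Proof.
move=> [cf1 cf2 df] [cg1 cg2 dg].
have reM : re (fun x => f x * g x) = re f * re g - im f * im g.
  by apply/funext => x; rewrite /re /im !fctE; case: (f x) (g x) => [? ?] [? ?].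
have imM : im (fun x => f x * g x) = re f * im g + im f * re g.
  by apply/funext => x; rewrite /re /im !fctE; case: (f x) (g x) => [? ?] [? ?].
apply/funext => x; have [f1 f2] := df j x; have [g1 g2] := dg j x.
rewrite /partial reM imM.
rewrite (deriveB (derivableM f1 g1) (derivableM f2 g2)).
rewrite (deriveD (derivableM f1 g2) (derivableM f2 g1)).
rewrite (deriveM f1 g1) (deriveM f2 g2) (deriveM f1 g2) (deriveM f2 g1).
rewrite !fctE /re /im; case: (f x) (g x) => [a b] [c d] /=.
by rewrite /GRing.scale /=; apply/eqP; rewrite eq_complex /=; apply/andP; split; apply/eqP; ring.
Qed.

Lemma C1_sum (I : Type) (r : seq I) (F : I -> Rn -> C^o) :
  (forall i, C1 (F i)) -> C1 (\sum_(i <- r) F i).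
Proof.
move=> H; elim/big_ind : _ => //; first exact: C1_0.
by move=> f g Cf Cg; have := C1_lin 1 Cf Cg; rewrite scale1r.
Qed.

Lemma partial_sum j (I : Type) (r : seq I) (F : I -> Rn -> C^o) :
  (forall i, C1 (F i)) -> partial j (\sum_(i <- r) F i) = \sum_(i <- r) partial j (F i).
Proof.
move=> H; elim: r => [|i r IH]; first by rewrite !big_nil partial0.
have := partial_lin j 1 (H i) (@C1_sum _ r _ H).
by rewrite !scale1r IH !big_cons.
Qed.

(** All distributions of the letters of [s] over two factors, listed with repetition: the Leibniz
    rule then has no binomial coefficients, and 2 ^ size s counts its terms. *)
Fixpoint splits s : seq (seq 'I_n * seq 'I_n) :=
  if s is j :: s' then
    [seq (j :: p.1, p.2) | p <- splits s'] ++ [seq (p.1, j :: p.2) | p <- splits s']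
  else [:: ([::], [::])].

Lemma splits_size s p : p \in splits s -> (size p.1 <= size s)%N /\ (size p.2 <= size s)%N.
Proof.
elim: s p => [|j s IH] p /=; first by rewrite inE => /eqP ->.
rewrite mem_cat => /orP[] /mapP[q /IH[q1 q2] ->] /=; split=> //; exact: leqW.
Qed.

Lemma size_splits s : size (splits s) = (2 ^ size s)%N.
Proof. by elim: s => //= j s IH; rewrite size_cat !size_map IH expnS mul2n addnn. Qed.

Lemma leibniz s f g : smooth f -> smooth g ->
  partials s (fun x => f x * g x : C^o) =
  \sum_(p <- splits s) (fun x => partials p.1 f x * partials p.2 g x : C^o).
Proof.
move=> sf sg; elim: s => [|j s IH] /=; first by rewrite big_seq1.
rewrite IH partial_sum; last by move=> p; apply: C1M.
rewrite big_cat !big_map /=; elim: (splits s) => [|p r IHr].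
  by rewrite !big_nil addr0.
by rewrite !big_cons IHr partialM// addrACA.
Qed.

Lemma smoothM f g : smooth f -> smooth g -> smooth (fun x => f x * g x : C^o).
Proof.
by move=> sf sg s; rewrite leibniz//; apply: C1_sum => p; apply: C1M.
Qed.

Lemma sum_fctE (I : Type) (r : seq I) (F : I -> Rn -> C^o) x :
  (\sum_(i <- r) F i) x = \sum_(i <- r) F i x.
Proof. by elim/big_ind2 : _ => // a b c d <- <-. Qed.

Lemma leibniz_le s f g x (D : R) : smooth f -> smooth g ->
  (forall p, p \in splits s -> cabs (partials p.1 f x * partials p.2 g x) <= D) ->
  cabs (partials s (fun x => f x * g x : C^o) x) <= 2 ^+ size s * D.
Proof.
move=> sf sg H; rewrite leibniz// sum_fctE (le_trans (cabs_sum _ _ _))//.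
rewrite big_seq_cond (le_trans (ler_sum _ (G := fun=> D) _))//.
  by move=> p; rewrite andbT => /H.
rewrite -big_seq_cond big_const_seq count_predT size_splits iter_addr_0.
by rewrite -[leLHS]mulr_natl natrX.
Qed.

End products.

(** * Products of functions of one variable *)

Section tensor_functions.
Context {R : realType} {n : nat}.
Local Notation Rn := 'rV[R]_n.
Local Notation C := R[i].

(** Carrying all derivatives of [rho 0] along makes differentiation of a product over the
    coordinates a mere shift of the indices [kappa]. *)
Definition tower (rho : nat -> R -> R) := forall k (x : R), is_derive x (1 : R) (rho k) (rho k.+1 x).

Definition tensor (rho : nat -> R -> R) (kappa : 'I_n -> nat) : Rn -> C^o :=
  fun x => (\prod_i rho (kappa i) (x ord0 i))%:C%C.

Context (rho : nat -> R -> R) (rhoD : tower rho).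

Lemma tower_continuous k : continuous (rho k).
Proof. exact: is_derive1_continuous (rhoD k). Qed.

Lemma coord_continuous (i : 'I_n) : continuous (fun x : Rn => x ord0 i).
Proof. exact: coord_continuous. Qed.

Lemma re_tensor kappa : re (tensor rho kappa) = (fun x => \prod_i rho (kappa i) (x ord0 i)).
Proof. by []. Qed.

Lemma im_tensor kappa : im (tensor rho kappa) = cst 0.
Proof. by []. Qed.

Lemma is_derive_tensor kappa j x :
  is_derive x 'e_j (fun x : Rn => \prod_i rho (kappa i) (x ord0 i) : R^o)
    (\prod_i rho (kappa i + (i == j))%N (x ord0 i)).
Proof.
pose c := \prod_(i | i != j) rho (kappa i) (x ord0 i).
have d := rhoD (kappa j) (x ord0 j).
have E : (fun h : R => h^-1 *: (((fun x : Rn => \prod_i rho (kappa i) (x ord0 i) : R^o) \o shift x) (h *: 'e_j)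
      - (\prod_i rho (kappa i) (x ord0 i) : R^o))) =
    (fun h : R => c *: (h^-1 *: ((rho (kappa j) \o shift (x ord0 j)) (h *: (1 : R)) - rho (kappa j) (x ord0 j) : R^o))).
  apply/funext => h /=.
  rewrite (bigD1 j)//= [in X in _ - X](bigD1 j)//= (eq_bigr (fun i => rho (kappa i) (x ord0 i))); last first.
    by move=> i ij; rewrite !mxE /= (negbTE ij) mulr0 add0r.
  rewrite -/c !mxE !eqxx /= -mulrBl /GRing.scale /= !mulr1; ring.
have -> : \prod_i rho (kappa i + (i == j))%N (x ord0 i) = c *: (rho (kappa j).+1 (x ord0 j) : R^o).
  rewrite (bigD1 j)//= eqxx addn1 mulrC; congr (_ * _).
  by apply: eq_bigr => i ij; rewrite (negbTE ij) addn0.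
have cv : (fun h : R => c *: (h^-1 *: ((rho (kappa j) \o shift (x ord0 j)) (h *: (1 : R)) - rho (kappa j) (x ord0 j) : R^o)))
   @ 0^' --> c *: (rho (kappa j).+1 (x ord0 j) : R^o).
  apply: cvgZl_tmp; rewrite -(@derive_val _ _ _ _ _ _ _ d).
  exact: (@ex_derive _ _ _ _ _ _ _ d).
apply: DeriveDef; first by rewrite /derivable E; apply/cvg_ex; eexists; exact: cv.
by rewrite /derive E; exact: cvg_lim cv.
Qed.

Lemma tensor_C1 kappa : C1 (tensor rho kappa).
Proof.
split.
- rewrite re_tensor => x.
  have : forall (r : seq 'I_n), (fun x : Rn => \prod_(i <- r) rho (kappa i) (x ord0 i) : R^o) @ x -->
     (\prod_(i <- r) rho (kappa i) (x ord0 i) : R^o).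
    elim=> [|i r IH].
      rewrite big_nil (_ : (fun _ => _) = cst 1); first exact: (@cvg_cst R^o 1 Rn (nbhs x)).
      by apply/funext => y; rewrite big_nil.
    rewrite big_cons (_ : (fun _ => _) = (fun x : Rn => rho (kappa i) (x ord0 i) : R^o) *
      (fun x : Rn => \prod_(j <- r) rho (kappa j) (x ord0 j) : R^o)); last first.
      by apply/funext => y; rewrite big_cons.
    apply: cvgM IH; apply: (@continuous_comp _ _ _ (fun x : Rn => x ord0 i) (rho (kappa i))).
      exact: coord_continuous.
    exact: tower_continuous.
  by apply.
- by rewrite im_tensor; exact: cst_continuous.
- move=> j x; rewrite re_tensor im_tensor; split; last exact: derivable_cst.
  exact: (@ex_derive _ _ _ _ _ _ _ (is_derive_tensor kappa j x)).
Qed.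

Lemma partial_tensor kappa j : partial j (tensor rho kappa) =
  tensor rho (fun i => kappa i + (i == j))%N.
Proof.
apply/funext => x; rewrite /partial re_tensor im_tensor derive_cst.
by rewrite (@derive_val _ _ _ _ _ _ _ (is_derive_tensor kappa j x)).
Qed.

Lemma partials_tensor kappa s : partials s (tensor rho kappa) =
  tensor rho (fun i => kappa i + count_mem i s)%N.
Proof.
elim: s => [|j s IH] /=; first by congr tensor; apply/funext => i; rewrite addn0.
rewrite IH partial_tensor; congr tensor; apply/funext => i.
by rewrite -addnA [X in (_ + X)%N]addnC eq_sym.
Qed.

Lemma tensor_smooth kappa : smooth (tensor rho kappa).
Proof. by move=> s; rewrite partials_tensor; exact: tensor_C1. Qed.

Lemma tensor_le kappa (B : R) (x : Rn) : (forall i, `|rho (kappa i) (x ord0 i)| <= B) ->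
  cabs (tensor rho kappa x) <= B ^+ n.
Proof.
move=> H; rewrite cabs_real normr_prod.
rewrite -[X in _ ^+ X]card_ord -prodr_const; apply: ler_prod => i _.
by rewrite normr_ge0 H.
Qed.

End tensor_functions.

(** * Plateaus, bumps and an enumeration of the integers *)

Section one_dim_cutoffs.
Context {R : realType}.

Lemma tower_shift (rho : nat -> R -> R) c : tower rho -> tower (fun k x => rho k (x + c)).
Proof.
move=> rD k x; have d : is_derive x (1 : R) (fun y : R => y + c) 1.
  by rewrite -[1 in X in is_derive _ _ _ X]addr0; exact: (@is_deriveD R R R id (cst c) x 1 1 0).
by have := @is_derive1_comp _ (rho k) _ x _ _ (rD k (x + c)) d; rewrite mulr1.
Qed.

Lemma towerB (rho sigma : nat -> R -> R) : tower rho -> tower sigma ->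
  tower (fun k x => rho k x - sigma k x).
Proof. by move=> rD sD k x; exact: is_deriveB. Qed.

Definition step : nat -> R -> R := sval (cid (@smooth_step_ex R)).

Lemma step_tower : tower step.
Proof. by rewrite /step; case: cid => th /= []. Qed.

Lemma step_lt0 x : x < 0 -> step 0 x = 0.
Proof. by rewrite /step; case: cid => th /= [_ + _ _ _]; apply. Qed.

Lemma step_gt1 x : 1 < x -> step 0 x = 1.
Proof. by rewrite /step; case: cid => th /= [_ _ + _ _]; apply. Qed.

Lemma step_bounded k : exists B, forall x, `|step k x| <= B.
Proof. by rewrite /step; case: cid => th /= []. Qed.

Definition step_bound k : R := sval (cid (step_bounded k)).

Lemma step_le k x : `|step k x| <= step_bound k.
Proof. exact: (svalP (cid (step_bounded k))). Qed.

Lemma step_bound_ge0 k : 0 <= step_bound k.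
Proof. exact: le_trans (normr_ge0 _) (step_le k 0). Qed.

Definition plateau (N : nat) k x := step k (x + N%:R) - step k (x - N%:R).
(** Integer translates telescope: those from -(M - 1) to M add up to [plateau M], which makes the
    bumps a smooth partition of unity. *)
Definition bump1 k x := step k (x + 1) - step k x.

Lemma plateau_tower N : tower (plateau N).
Proof. by apply: towerB; apply: tower_shift; exact: step_tower. Qed.

Lemma bump1_tower : tower bump1.
Proof. by apply: towerB; [apply: tower_shift|]; exact: step_tower. Qed.

Lemma plateau_le N k x : `|plateau N k x| <= 2 * step_bound k.
Proof. by rewrite (le_trans (ler_normB _ _))// mulr_natl mulr2n lerD ?step_le. Qed.

Lemma bump1_le k x : `|bump1 k x| <= 2 * step_bound k.
Proof. by rewrite (le_trans (ler_normB _ _))// mulr_natl mulr2n lerD ?step_le. Qed.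

Lemma plateau1 N x : `|x| < N%:R - 1 -> plateau N 0 x = 1.
Proof.
rewrite ltr_norml => /andP[h1 h2].
by rewrite /plateau step_gt1 ?step_lt0 ?subr0//; lra.
Qed.

Lemma plateau0 N x : N%:R + 1 < `|x| -> plateau N 0 x = 0.
Proof.
have N0 : 0 <= N%:R :> R by [].
rewrite lter_normr => /orP[h|h].
  by rewrite /plateau !step_gt1 ?subrr//; lra.
by rewrite /plateau !step_lt0 ?subrr//; lra.
Qed.

Lemma bump1_0 x : 1 < `|x| -> bump1 0 x = 0.
Proof.
rewrite lter_normr => /orP[h|h]; first by rewrite /bump1 !step_gt1 ?subrr//; lra.
by rewrite /bump1 !step_lt0 ?subrr//; lra.
Qed.

(** The enumeration 0, 1, -1, 2, -2, ... of the integers; its first 2 M values are those from -(M -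
    1) to M. *)
Definition zigzag (k : nat) : R := if odd k then (k./2.+1)%:R else - (k./2)%:R.

Lemma zigzag_ge k : (k.+2)%:R <= 2 * (1 + `|zigzag k|).
Proof.
have -> : k.+2%:R = 2 + (odd k)%:R + 2 * (k./2)%:R :> R.
  by rewrite -natrM -!natrD -addnA add2n mul2n odd_double_half.
have : 0 <= (k./2)%:R :> R by [].
rewrite /zigzag; case: odd => /= k0; rewrite ?normrN ger0_norm//.
  by rewrite -[_.+1]addn1 natrD; lra.
by rewrite addr0; lra.
Qed.

Lemma sum_bump1 M x : \sum_(j < 2 * M) bump1 0 (x - zigzag j) = plateau M 0 x.
Proof.
elim: M => [|M IH]; first by rewrite muln0 big_ord0 /plateau addr0 subr0 subrr.
rewrite mulnS !big_ord_recr /= IH /zigzag.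
have -> : odd (2 * M) = false by rewrite oddM.
have -> : odd (2 * M).+1 by rewrite /= oddM.
have -> : (2 * M)./2 = M by rewrite mul2n doubleK.
have -> : (2 * M).+1./2 = M by rewrite mul2n /= uphalf_double.
rewrite /bump1 /plateau opprK -addn1 natrD.
have -> : x - (M%:R + 1) + 1 = x - M%:R by ring.
rewrite (addrA x); ring.
Qed.

(** A majorant of the inverse square weights that telescopes, being 4 / (j + 1) - 4 / (j + 2), with
    all partial sums at most 4. *)
Definition zigzag_weight (j : nat) : R := 4 / (j.+1%:R * j.+2%:R).

Lemma zigzag_weightP j : (1 + `|zigzag j|) ^- 2 <= zigzag_weight j.
Proof.
have h := zigzag_ge j; have p1 : 0 < j.+1%:R :> R by []; have p2 : 0 < j.+2%:R :> R by [].
have p3 : 0 < 1 + `|zigzag j| by rewrite ltr_pwDl.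
have e : j.+2%:R = j.+1%:R + 1 :> R by rewrite -[j.+2]addn1 natrD.
rewrite /zigzag_weight -[leLHS]mul1r ler_pdivrMr ?exprn_gt0// mulrAC ler_pdivlMr ?mulr_gt0//.
rewrite mul1r; set a := j.+1%:R in e p1 *; set b := j.+2%:R in e p2 h *; nra.
Qed.

Lemma sum_zigzag_weight M : \sum_(j < M) zigzag_weight j <= 4.
Proof.
suff -> : \sum_(j < M) zigzag_weight j = 4 - 4 / M.+1%:R by rewrite gerBl divr_ge0.
elim: M => [|M IH]; first by rewrite big_ord0 divr1 subrr.
rewrite big_ord_recr /= IH /zigzag_weight.
have p1 : M.+1%:R != 0 :> R by [rewrite pnatr_eq0].
have p2 : M.+2%:R != 0 :> R by [rewrite pnatr_eq0].
have e : M.+2%:R = M.+1%:R + 1 :> R by rewrite -[M.+2]addn1 natrD.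
by move: p1 p2; rewrite e; move: (M.+1%:R) => a p1 p2; field; rewrite p1 p2.
Qed.

End one_dim_cutoffs.

(** * Cut-off functions in several variables *)

Section cutoffs.
Context {R : realType} {n : nat}.
Local Notation Rn := 'rV[R]_n.
Local Notation C := R[i].
Implicit Types (chi : testfun R n) (phi : schwartzfun R n).

Definition box (M : R) : set Rn := [set x | forall i, `|x ord0 i| <= M].

Lemma box_compact M : compact (box M).
Proof.
have -> : box M = [set v | forall i, `[- M, M]%classic (v ord0 i)].
  by apply/seteqP; split => x /= H i; have := H i; rewrite in_itv /= ler_norml.
by apply: (@rV_compact R n (fun=> `[- M, M]%classic)) => i; exact: segment_compact.
Qed.

Lemma box_closed M : closed (box M).
Proof. by apply: compact_closed; [exact: norm_hausdorff|exact: box_compact]. Qed.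

Lemma box_out M (x : Rn) : ~ box M x -> exists i, M < `|x ord0 i|.
Proof.
move=> H; apply: contrapT => H'; apply: H => i.
by rewrite leNgt; apply/negP => h; apply: H'; exists i.
Qed.

Lemma tsupport_sub (A : set Rn) (f : Rn -> C^o) : closed A ->
  (forall x, ~ A x -> f x = 0) -> tsupport f `<=` A.
Proof.
move=> cA fA; rewrite /tsupport [X in _ `<=` X](iffLR (closure_id A))//.
apply: closure_subset => x /= fx; apply: contrapT => /fA fx0.
by rewrite fx0 eqxx in fx.
Qed.

Lemma test_of_box (f : Rn -> C^o) M : smooth f ->
  (forall x, ~ box M x -> f x = 0) -> f \in @test_pred R n.
Proof.
move=> sf fM; apply/asboolP; split => //.
have cB : compact (box M : set Rn) by exact: box_compact.
apply: (subclosed_compact _ cB); first exact: closed_closure.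
by apply: tsupport_sub => //; exact: box_closed.
Qed.

Lemma tensor_out (rho : nat -> R -> R) M : (forall x, M < `|x| -> rho 0%N x = 0) ->
  forall x, ~ box M x -> tensor rho (fun=> 0%N) x = 0 :> C.
Proof.
move=> r0 x /box_out[i xi]; rewrite /tensor (bigD1 i)//= r0// mul0r.
by [].
Qed.

Definition cutoff (N : nat) : testfun R n := TestFun (test_of_box
  (tensor_smooth (plateau_tower N) (fun=> 0%N)) (tensor_out (@plateau0 R N))).

Definition unit_bump : testfun R n := TestFun (test_of_box
  (tensor_smooth bump1_tower (fun=> 0%N)) (tensor_out (@bump1_0 R))).

Lemma test_smooth chi : smooth chi. Proof. exact: (testP chi).1. Qed.
Lemma schwartz_smooth phi : smooth phi. Proof. exact: (schwartzP phi).1. Qed.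

Lemma test_mul_subproof chi (f : Rn -> C^o) : smooth f ->
  (fun x => chi x * f x : C^o) \in @test_pred R n.
Proof.
move=> sf; apply/asboolP; split; first exact: smoothM (test_smooth chi) sf.
apply: (subclosed_compact _ (testP chi).2); first exact: closed_closure.
apply: closure_subset => x /=; apply: contra => /eqP ->.
by rewrite mul0r.
Qed.

Definition test_mul chi (f : Rn -> C^o) (sf : smooth f) : testfun R n :=
  TestFun (test_mul_subproof chi sf).

Definition cut_test (N : nat) phi : testfun R n := test_mul (cutoff N) (schwartz_smooth phi).

Lemma cutoff1 N (x : Rn) : (forall i, `|x ord0 i| < N%:R - 1) -> cutoff N x = 1.
Proof.
move=> H; rewrite /cutoff /= /tensor big1// => i _; exact: plateau1.
Qed.

(** The bound is the same for all N, which is what convergence of the cut-offs requires. *)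
Lemma cutoff_partial_le s k N x : (size s <= k)%N ->
  cabs (partials s (cutoff N) x) <= (2 * \sum_(j < k.+1) step_bound j) ^+ n.
Proof.
move=> sk; rewrite /cutoff /= (partials_tensor (plateau_tower N)) tensor_le// => i.
rewrite (le_trans (plateau_le _ _ _))// ler_wpM2l//.
have ck : (0 + count_mem i s < k.+1)%N by rewrite add0n ltnS (leq_trans (count_size _ _)).
rewrite (bigD1 (Ordinal ck))//= lerDl sumr_ge0// => j _; exact: step_bound_ge0.
Qed.

Lemma bump_partial_le s k x : (size s <= k)%N ->
  cabs (partials s unit_bump x) <= (2 * \sum_(j < k.+1) step_bound j) ^+ n.
Proof.
move=> sk; rewrite /unit_bump /= (partials_tensor bump1_tower) tensor_le// => i.
rewrite (le_trans (bump1_le _ _))// ler_wpM2l//.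
have ck : (0 + count_mem i s < k.+1)%N by rewrite add0n ltnS (leq_trans (count_size _ _)).
rewrite (bigD1 (Ordinal ck))//= lerDl sumr_ge0// => j _; exact: step_bound_ge0.
Qed.

Lemma bump_partial_out s x : ~ box 1 x -> partials s unit_bump x = 0.
Proof.
by apply: partials_out; [exact: box_closed|exact: (tensor_out (@bump1_0 R))].
Qed.

End cutoffs.

(** * Seminorms of Schwartz functions *)

Section schwartz_seminorms.
Context {R : realType} {n : nat}.
Local Notation Rn := 'rV[R]_n.
Local Notation C := R[i].
Implicit Types (chi : testfun R n) (phi psi : schwartzfun R n).

(** Upper bounds stand in for the seminorms themselves, so that no supremum has to be formed. Each
    exponent is bounded separately by k. *)
Definition semi_le (k : nat) phi (A : R) :=
  forall (a : 'I_n -> nat) (s : seq 'I_n) (x : Rn),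
    (forall i, a i <= k)%N -> (size s <= k)%N ->
    `|monom a x| * cabs (partials s phi x) <= A.

Lemma monom_partial_cabs (a : 'I_n -> nat) s phi (x : Rn) (A : R) :
  (`|(monom a x)%:C%C * partials s phi x| <= A%:C%C) =
  (`|monom a x| * cabs (partials s phi x) <= A).
Proof. by rewrite le_cabs cabsM cabs_real. Qed.

Lemma semi_leW k k' phi A A' : (k' <= k)%N -> A <= A' -> semi_le k phi A -> semi_le k' phi A'.
Proof.
move=> kk AA H a s x ak sk; apply: le_trans AA; apply: H => [i|].
  exact: leq_trans (ak i) kk.
exact: leq_trans sk kk.
Qed.

Lemma semi_leZ k phi A (c : C) : semi_le k phi A -> semi_le k (c *: phi) (cabs c * A).
Proof.
move=> H a s x ak sk.
rewrite (_ : partials s _ x = c * partials s phi x); last first.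
  by rewrite -[LHS](_ : partials s (c *: (phi : Rn -> C^o)) x = _)// partialsZ//; exact: schwartz_smooth.
by rewrite cabsM mulrCA ler_wpM2l ?cabs_ge0// H.
Qed.

Lemma semi_le_fin k (P : ('I_n -> nat) -> seq 'I_n -> R -> Prop) :
  (forall a s M M', M <= M' -> P a s M -> P a s M') ->
  (forall a s, exists M, P a s M) ->
  exists2 M, 0 <= M & forall a s, (forall i, a i <= k)%N -> (size s <= k)%N -> P a s M.
Proof.
move=> Pmono Pex.
have [M MP] := choice (fun w : ('I_n -> nat) * seq 'I_n => Pex w.1 w.2).
pose F (w : {ffun 'I_n -> 'I_k.+1} * (k.-bseq 'I_n)) :=
  `|M (fun i => w.1 i : nat, w.2 : seq 'I_n)|.
exists (\sum_w F w); first by rewrite sumr_ge0// => w _; exact: normr_ge0.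
move=> a s ak sk; pose b : {ffun 'I_n -> 'I_k.+1} := [ffun i => inord (a i)].
have ab : a = (fun i => b i : nat).
  by apply/funext => i; rewrite ffunE inordK// ltnS.
apply: (Pmono _ _ (M (a, s))); last exact: (MP (a, s)).
rewrite (bigD1 (b, Bseq sk))//= (le_trans (ler_norm _))//.
rewrite /F /= -ab lerDl sumr_ge0// => w _; exact: normr_ge0.
Qed.

Lemma semi_le_ex k phi : exists2 A, 0 <= A & semi_le k phi A.
Proof.
have [|a s|M M0 MP] := @semi_le_fin k (fun a s M => forall x : Rn,
    `|monom a x| * cabs (partials s phi x) <= M).
- by move=> a s M M' MM H x; exact: le_trans MM.
- have [_ /(_ a s)[M MP]] := schwartzP phi; exists M => x.
  by rewrite -monom_partial_cabs.
- by exists M => // a s x ak sk; exact: MP.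
Qed.

Lemma semi_le_nbhs k : nbhs (0 : schwartz_space R n) [set phi | semi_le k phi 1].
Proof.
pose P (w : {ffun 'I_n -> 'I_k.+1} * (k.-bseq 'I_n)) : set (schwartz_space R n) :=
  [set phi | forall x : Rn, `|monom (fun i => w.1 i : nat) x| *
    cabs (partials (w.2 : seq 'I_n) (phi : schwartzfun R n) x) <= 1].
have : nbhs (0 : schwartz_space R n) [set phi | forall w, P w phi].
  apply: (@filter_forall _ _ P (nbhs (0 : schwartz_space R n))) => w.
  have BU : lcbase_sets (schwartz_base R n) (P w).
    exists (fun i => w.1 i : nat), (w.2 : seq 'I_n); apply/seteqP; split => phi H x.
      by rewrite monom_partial_cabs; exact: H.
    by rewrite -monom_partial_cabs; exact: H.
  exact: (lcbase_nbhs1 BU).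
apply: filterS => phi H a s x ak sk.
have /= := H ([ffun i => inord (a i)], Bseq sk) x.
rewrite (_ : (fun i => _) = a)//; apply/funext => i.
by rewrite ffunE inordK// ltnS.
Qed.

Lemma tempered_semi (f : tempered R n) : exists k (D : R), 0 < D /\
  forall phi A, 0 < A -> semi_le k phi A -> cabs ((f : topdual (schwartz_space R n)) phi) <= D * A.
Proof.
have /nbhs0_lctvs[m [U [r [r0 BU UA]]]] := topdual_nbhs (f : topdual (schwartz_space R n)).
have /choice[k kP] i : exists k, forall phi, semi_le k phi 1 -> U i phi.
  have [a [s ->]] := BU i.
  exists (maxn (\max_j a j) (size s)) => phi H x /=; rewrite monom_partial_cabs.
  apply: H; last exact: leq_maxr.
  by move=> j; rewrite leq_max leq_bigmax.
exists (\max_i k i)%N, r; split => // phi A A0 H.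
have rA : 0 < r * A by rewrite mulr_gt0.
pose g : schwartzfun R n -> C^o := f : topdual (schwartz_space R n).
have lg : linear g := @topdual_linear _ (schwartz_space R n) f.
have : cabs (g (((r * A)^-1)%:C%C *: phi)) <= 1.
  apply: UA => i; apply: kP.
  rewrite scalerA -rmorphM invfM mulrA mulfV ?gt_eqF// mul1r.
  have := semi_leZ (A^-1)%:C%C H; rewrite cabs_nneg ?invr_ge0 ?(ltW A0)// mulVf ?gt_eqF//.
  by apply: semi_leW => //; exact: leq_bigmax.
rewrite (linZ lg) cabsM cabs_nneg ?invr_ge0 ?(ltW rA)//.
by rewrite ler_pdivrMl// mulr1.
Qed.

Lemma tempered_of_semi (f : schwartzfun R n -> C^o) k (D : R) : linear f ->
  (forall phi A, 0 < A -> semi_le k phi A -> cabs (f phi) <= D * A) ->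
  exists F : tempered R n, forall phi, (F : topdual (schwartz_space R n)) phi = f phi.
Proof.
move=> lf H; have D0 : 0 < `|D| + 1 by rewrite ltr_wpDl.
have [|F FE] := @topdual_ex R (schwartz_space R n) f lf; last by exists F.
have := scaled_nbhs0 D0 (semi_le_nbhs k); apply: filterS => phi /= Hphi.
have := H _ _ ltr01 Hphi; rewrite mulr1 (linZ lf) cabsM cabs_nneg ?(ltW D0)// => h.
rewrite -(ler_pM2l D0) (le_trans h)// mulr1 (le_trans (ler_norm D))// lerDl.
by [].
Qed.

(** A product weight, so that sums over the lattice and integral majorants factor over the
    coordinates; it still dominates 1 + [eucl_norm]. *)
Definition weight (x : Rn) : R := \prod_i (1 + `|x ord0 i|).

Lemma weight_ge1 x : 1 <= weight x.
Proof.
rewrite /weight; elim/big_ind : _ => // [a b a1 b1|i _]; last by rewrite lerDl.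
by rewrite -[1]mulr1 ler_pM.
Qed.

Lemma weight_gt0 x : 0 < weight x.
Proof. exact: lt_le_trans (weight_ge1 x). Qed.

(** Take exponent k in the coordinates with |y_i| >= 1 and 0 in the others, and use 1 + |y_i| <= 2
    max (1, |y_i|). The monomial depends on the point, hence the uniformity over exponents in
    [semi_le]. *)
Lemma weight_monom k (y : Rn) : exists2 a : 'I_n -> nat, forall i, (a i <= k)%N &
  weight y ^+ k <= (2 ^+ k) ^+ n * `|monom a y|.
Proof.
exists (fun i => if 1 <= `|y ord0 i| then k else 0%N); first by move=> i; case: ifP.
rewrite /weight /monom normr_prod -prodrXl -[X in _ ^+ X]card_ord -prodr_const.
rewrite -big_split /=; apply: ler_prod => i _; rewrite exprn_ge0 ?addr_ge0//=.
rewrite normrX; case: ifPn => [y1|]; last rewrite -ltNge => y1.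
  by rewrite -exprMn lerXn2r ?nnegrE ?addr_ge0 ?mulr_ge0//; lra.
by rewrite expr0 mulr1 lerXn2r ?nnegrE ?addr_ge0//; lra.
Qed.

Lemma semi_decay k phi A s y : semi_le k phi A -> (size s <= k)%N ->
  cabs (partials s phi y) <= (2 ^+ k) ^+ n * A / weight y ^+ k.
Proof.
move=> H sk; have [a ak ya] := weight_monom k y.
rewrite ler_pdivlMr ?exprn_gt0 ?weight_gt0// mulrC.
rewrite (le_trans (ler_wpM2r (cabs_ge0 _) ya))// -mulrA ler_wpM2l ?exprn_ge0//.
exact: H.
Qed.

Lemma weight_box x h : box 1 x -> weight h <= 2 ^+ n * weight (x + h).
Proof.
move=> x1; rewrite /weight -[X in _ ^+ X]card_ord -prodr_const -big_split /=.
apply: ler_prod => i _; rewrite addr_ge0//= mxE.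
have := ler_normB (x ord0 i + h ord0 i) (x ord0 i); rewrite addrAC subrr add0r.
have := x1 i; have := normr_ge0 (x ord0 i + h ord0 i); lra.
Qed.

Lemma eucl_norm_le_weight (h : Rn) : 1 + eucl_norm h <= weight h.
Proof.
have e1 (r : seq 'I_n) : Num.sqrt (\sum_(j <- r) h ord0 j ^+ 2) <= \sum_(j <- r) `|h ord0 j|.
  have s0 : 0 <= \sum_(j <- r) `|h ord0 j| by rewrite sumr_ge0.
  rewrite -(ger0_norm s0) -sqrtr_sqr ler_wsqrtr//.
  elim: r s0 => [|j r IH] s0; first by rewrite !big_nil expr0n.
  have s1 : 0 <= \sum_(j <- r) `|h ord0 j| by rewrite sumr_ge0.
  rewrite !big_cons sqrrD -real_normK ?num_real//; have := IH s1.
  have := normr_ge0 (h ord0 j); nra.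
have e2 (r : seq 'I_n) : 1 + \sum_(j <- r) `|h ord0 j| <= \prod_(j <- r) (1 + `|h ord0 j|).
  elim: r => [|j r IH]; first by rewrite !big_nil addr0.
  have s1 : 0 <= \sum_(j <- r) `|h ord0 j| by rewrite sumr_ge0.
  rewrite !big_cons; have := normr_ge0 (h ord0 j); nra.
by apply: le_trans (e2 _); rewrite lerD2l; exact: e1.
Qed.

Lemma eucl_norm_ge0 (h : Rn) : 0 <= eucl_norm h. Proof. exact: sqrtr_ge0. Qed.

End schwartz_seminorms.

(** * Lattice decomposition and convergence of cut-offs *)

Section lattice_estimate.
Context {R : realType} {n : nat}.
Local Notation Rn := 'rV[R]_n.
Local Notation C := R[i].
Implicit Types (chi : testfun R n) (phi psi : schwartzfun R n).

(** The part of [phi] around [h], moved to the origin, so that a single finite order estimate on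
    [box 1] serves for all [h]. *)
Definition piece (h : Rn) phi : testfun R n :=
  test_mul unit_bump (smooth_shift h (schwartz_smooth phi)).

Lemma piece_support h phi : tsupport (piece h phi) `<=` box 1.
Proof.
apply: tsupport_sub; first exact: box_closed.
by move=> x /(bump_partial_out [::]) /= ->; rewrite mul0r.
Qed.

(** The factors come, in this order, from the Leibniz rule, the derivatives of the bump,
    [semi_decay] and [weight_box]. *)
Definition piece_const (k N : nat) : R :=
  2 ^+ N * ((2 * \sum_(j < N.+1) step_bound j) ^+ n * ((2 ^+ k) ^+ n * (2 ^+ n) ^+ k)).

Lemma piece_const_ge0 k N : 0 <= piece_const k N.
Proof.
rewrite /piece_const !mulr_ge0// ?exprn_ge0// ?exprn_ge0// mulr_ge0// sumr_ge0// => j _.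
exact: step_bound_ge0.
Qed.

Lemma piece_partial_le k N h phi A s x : semi_le k phi A -> 0 <= A ->
  (size s <= N)%N -> (N <= k)%N ->
  cabs (partials s (piece h phi) x) <= piece_const k N * A / weight h ^+ k.
Proof.
move=> H A0 sN Nk.
have S0 : 0 <= 2 * \sum_(j < N.+1) step_bound j :> R.
  by rewrite mulr_ge0// sumr_ge0// => j _; exact: step_bound_ge0.
pose D := (2 * \sum_(j < N.+1) step_bound j) ^+ n * ((2 ^+ k) ^+ n * (2 ^+ n) ^+ k) * A / weight h ^+ k.
have D0 : 0 <= D.
  by rewrite /D divr_ge0 ?exprn_ge0 ?(ltW (weight_gt0 _))// !mulr_ge0// ?exprn_ge0// ?exprn_ge0.
rewrite (@le_trans _ _ (2 ^+ size s * D))//.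
  apply: leibniz_le; [exact: test_smooth|exact/smooth_shift/schwartz_smooth|].
  move=> p /splits_size[p1 p2]; rewrite cabsM partials_shift.
  have [x1|x1] := pselect (box 1 x); last by rewrite bump_partial_out// cabs0 mul0r.
  rewrite /D -2!mulrA ler_pM ?cabs_ge0//.
    exact: bump_partial_le (leq_trans p1 sN).
  rewrite (le_trans (semi_decay (x + h) H (leq_trans p2 (leq_trans sN Nk))))//.
  rewrite -!mulrA ler_wpM2l ?exprn_ge0 ?exprn_ge0// mulrCA ler_wpM2l//.
  rewrite ler_pdivlMr ?exprn_gt0 ?weight_gt0// ler_pdivrMl ?exprn_gt0 ?weight_gt0//.
  rewrite mulrC -exprMn lerXn2r ?nnegrE ?mulr_ge0 ?exprn_ge0 ?(ltW (weight_gt0 _))//.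
  exact: weight_box.
rewrite /piece_const /D !mulrA -!mulrA ler_wpM2r//; last first.
  by rewrite ler_eXn2l ?ltr1n.
by move: D0; rewrite /D !mulrA -!mulrA.
Qed.

Definition lattice M (m : {ffun 'I_n -> 'I_(2 * M)}) : Rn := \row_i zigzag (m i).

Lemma test_sumE (I : finType) (F : I -> testfun R n) x : (\sum_i F i) x = \sum_i F i x :> C.
Proof. by elim/big_ind2 : _ => // f a g b <- <-. Qed.

(** Each one-variable plateau is a sum of 2 M bumps; distributing the product over the coordinates
    leaves one bump per lattice point. *)
Lemma cut_sum M phi : cut_test M phi =
  \sum_(m : {ffun 'I_n -> 'I_(2 * M)}) translate (- lattice m) (piece (lattice m) phi).
Proof.
apply: val_inj; apply/funext => x /=; rewrite -[RHS]/((\sum_m _ : testfun R n) x) test_sumE.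
under eq_bigr => m _ do rewrite /= subrK.
rewrite -mulr_suml; congr (_ * _); rewrite /tensor -rmorph_sum; congr (_%:C%C).
under eq_bigr => i _ do rewrite -sum_bump1.
rewrite bigA_distr_bigA /=; apply: eq_bigr => m _; apply: eq_bigr => i _.
by rewrite !mxE.
Qed.

(* The cut-off of phi is a finite sum of lattice translates of pieces supported in
   a fixed box, and the decay of phi absorbs the growth of the translations. *)
Lemma seminorm_cut_bound (q : testfun R n -> R) (t : nat) (D : R) :
  q 0 = 0 -> (forall f g, q (f + g) <= q f + q g) ->
  (forall A, compact A -> exists N (E : R), 0 <= E /\
    forall (f : testfun R n) B, tsupport f `<=` A -> 0 <= B ->
      (forall s x, (size s <= N)%N -> cabs (partials s f x) <= B) -> q f <= E * B) ->
  0 <= D -> (forall h f, q (translate h f) <= D * (1 + eucl_norm h) ^+ t * q f) ->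
  exists k (E : R), 0 <= E /\ forall phi A, 0 <= A -> semi_le k phi A ->
    forall M, q (cut_test M phi) <= E * A.
Proof.
move=> q0 qD qK D0 qT.
have [N [E [E0 qE]]] := qK _ (@box_compact R n 1).
(* N derivatives are to be controlled; t powers of the weight absorb the growth of the translations,
   and 2 further powers make the lattice sum converge, with bound 4 in each coordinate. *)
pose k := maxn N (t + 2).
have P0 : 0 <= D * E * piece_const k N.
  by apply: mulr_ge0; [exact: mulr_ge0|exact: piece_const_ge0].
exists k, (D * E * piece_const k N * 4 ^+ n); split.
  by apply: mulr_ge0 => //; exact: exprn_ge0.
move=> phi A A0 H M; rewrite cut_sum.
have qsum (I : finType) (F : I -> testfun R n) : q (\sum_i F i) <= \sum_i q (F i).
  elim: (index_enum I) => [|i r IH]; first by rewrite !big_nil q0.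
  by rewrite !big_cons (le_trans (qD _ _))// lerD2l.
have qp h : q (translate (- h) (piece h phi)) <= D * E * piece_const k N * A * weight h ^- 2.
  have W0 := weight_gt0 h; have W1 := weight_ge1 h.
  have B0 : 0 <= piece_const k N * A / weight h ^+ k.
    apply: divr_ge0; last by rewrite exprn_ge0 ?(ltW W0).
    by apply: mulr_ge0 => //; exact: piece_const_ge0.
  have qp0 : q (piece h phi) <= E * (piece_const k N * A / weight h ^+ k).
    apply: qE => //; first exact: piece_support.
    by move=> s x sN; apply: piece_partial_le => //; rewrite leq_maxl.
  have e0 : 0 <= D * (1 + eucl_norm (- h)) ^+ t.
    by rewrite mulr_ge0// exprn_ge0// addr_ge0// eucl_norm_ge0.
  rewrite (le_trans (qT _ _))// (le_trans (ler_wpM2l e0 qp0))//.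
  have en : eucl_norm (- h) = eucl_norm h.
    by rewrite /eucl_norm; congr Num.sqrt; apply: eq_bigr => i _; rewrite mxE sqrrN.
  have h1 : D * (1 + eucl_norm (- h)) ^+ t <= D * weight h ^+ t.
    rewrite ler_wpM2l// lerXn2r ?nnegrE ?(ltW W0) ?addr_ge0 ?eucl_norm_ge0//.
    by rewrite en eucl_norm_le_weight.
  rewrite (le_trans (ler_wpM2r (mulr_ge0 E0 B0) h1))//.
  have -> : D * weight h ^+ t * (E * (piece_const k N * A / weight h ^+ k)) =
    D * E * piece_const k N * A * (weight h ^+ t / weight h ^+ k) by ring.
  rewrite (ler_wpM2l (mulr_ge0 P0 A0))//.
  rewrite ler_pdivrMr ?exprn_gt0// mulrC ler_pdivlMr ?exprn_gt0// -exprD.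
  by rewrite ler_weXn2l// leq_maxr.
rewrite (le_trans (qsum _ _))// (le_trans (ler_sum _ (fun m _ => qp (lattice m))))//.
rewrite -mulr_sumr [leRHS]mulrAC.
rewrite (ler_wpM2l (mulr_ge0 P0 A0))//.
rewrite (@le_trans _ _ (\sum_(m : {ffun 'I_n -> 'I_(2 * M)}) \prod_i zigzag_weight (m i)))//.
  apply: ler_sum => m _; rewrite /weight -prodrXl -prodfV; apply: ler_prod => i _.
  by rewrite invr_ge0 exprn_ge0 ?addr_ge0//= mxE zigzag_weightP.
rewrite -(bigA_distr_bigA (fun _ (j : 'I_(2 * M)) => zigzag_weight j)).
rewrite -[X in _ <= _ ^+ X]card_ord -prodr_const; apply: ler_prod => i _.
rewrite sum_zigzag_weight sumr_ge0// => j _.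
by rewrite /zigzag_weight divr_ge0 ?mulr_ge0.
Qed.

Definition cut_schwartz M phi : schwartzfun R n := test_schwartz (cut_test M phi).

Lemma partials_cst1 s : partials s (cst 1 : Rn -> C^o) = if s is [::] then cst 1 else 0.
Proof.
elim: s => //= j s ->; case: s => [|i s]; last exact: partial0.
by apply/funext => x; rewrite /partial (_ : re _ = cst 1)// (_ : im _ = cst 0)// !derive_cst.
Qed.

Lemma smooth_cst1 : smooth (cst 1 : Rn -> C^o).
Proof.
move=> s; rewrite partials_cst1; case: s => [|_ _]; last exact: C1_0.
have r1 : re (cst 1 : Rn -> C^o) = cst 1 by [].
have i0 : im (cst 1 : Rn -> C^o) = cst 0 by [].
split; rewrite ?r1 ?i0; [exact: cst_continuous..|].
by move=> j x; split; exact: derivable_cst.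
Qed.

Definition cocutoff M : Rn -> C^o := (-1 : C) *: (cutoff M : Rn -> C^o) + cst 1.

Lemma cocutoff_smooth M : smooth (cocutoff M).
Proof. exact: smooth_lin (test_smooth _) smooth_cst1. Qed.

Lemma cocutoff_partial_le s k M x : (size s <= k)%N ->
  cabs (partials s (cocutoff M) x) <= 1 + (2 * \sum_(j < k.+1) step_bound j) ^+ n.
Proof.
move=> sk; rewrite /cocutoff partials_lin; [|exact: test_smooth|exact: smooth_cst1].
rewrite addrC (le_trans (cabsD _ _))// lerD//.
  by rewrite partials_cst1; case: (s) => [|_ _] /=; rewrite ?cabs1 ?cabs0.
by rewrite [X in cabs X]mulN1r cabsN cutoff_partial_le.
Qed.

Lemma cocutoff_partial_in s M x : box (M%:R - 3) x -> partials s (cocutoff M) x = 0.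
Proof.
(* The cut-off equals 1 where all |x_i| < M - 1, hence on box (M - 2); the further unit leaves a
   neighbourhood of each point of box (M - 3) on which the function vanishes. *)
move=> xM; pose A := ~` (box (M%:R - 2) : set Rn)°.
apply: (@partials_out _ _ A).
- by apply: open_closedC; exact: open_interior.
- move=> y /contrapT /interior_subset yM.
  rewrite /cocutoff !fctE cutoff1 ?scaler1 ?addNr// => i.
  by rewrite (le_lt_trans (yM i))//; lra.
- move=> nx; apply: nx; rewrite /interior /=.
  apply/nbhs_ballP; exists 1 => //= y; rewrite -ball_normE /= => xy i.
  have : `|(x - y) ord0 i| <= `|x - y|.
    rewrite [leRHS](_ : _ = mx_norm (x - y))// mx_normrE.
    by apply/bigmax_geP; right; exists (ord0, i).
  rewrite !mxE => h; have := xM i.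
  have := ler_normD (x ord0 i) (y ord0 i - x ord0 i).
  rewrite [X in `|X| <= _]addrC subrK [`|y ord0 i - _|]distrC.
  lra.
Qed.

Lemma monom_shift (a : 'I_n -> nat) (j : 'I_n) (x : Rn) :
  monom (fun i => a i + (i == j))%N x = x ord0 j * monom a x.
Proof.
rewrite /monom (bigD1 j)//= eqxx addn1 exprS -mulrA [in RHS](bigD1 j)//=.
congr (_ * (_ * _)); apply: eq_bigr => i /negbTE ->.
by rewrite addn0.
Qed.

(** The derivatives of the remainder live where some |x_j| > M - 3. There a factor |x_j|, borrowed
    from the seminorms of order k + 1, makes the error of order 1 / (M - 3). *)
Lemma cut_approx k phi (e : R) : 0 < e -> exists M0, forall M, (M0 <= M)%N ->
  semi_le k (phi - cut_schwartz M phi) e.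
Proof.
move=> e0; have [A A0 H] := semi_le_ex k.+1 phi.
pose B : R := 1 + (2 * \sum_(j < k.+1) step_bound j) ^+ n.
have B0 : 0 <= B.
  rewrite addr_ge0// exprn_ge0// mulr_ge0// sumr_ge0// => j _; exact: step_bound_ge0.
have K0 : 0 <= 2 ^+ k * (B * A) by rewrite mulr_ge0 ?exprn_ge0// mulr_ge0.
exists (Num.truncn (3 + 2 ^+ k * (B * A) / e)).+1 => M M0 a s x ak sk.
have M3 : 2 ^+ k * (B * A) / e < M%:R - 3.
  rewrite ltrBrDl (lt_le_trans (truncnS_gt _))// ler_nat.
  exact: M0.
have Mp : 0 < M%:R - 3 :> R by rewrite (le_lt_trans _ M3)// divr_ge0// ltW.
have -> : partials s (phi - cut_schwartz M phi) = partials s (fun x => cocutoff M x * phi x).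
  congr partials; apply/funext => y; rewrite /cocutoff !fctE mulrDl mul1r addrC.
  by congr (_ + _); rewrite -[LHS]mulN1r mulrA.
have [xM|/box_out[j xj]] := pselect (box (M%:R - 3) x).
  have h : cabs (partials s (fun x => cocutoff M x * phi x : C^o) x) <= 2 ^+ size s * 0.
    apply: leibniz_le; [exact: cocutoff_smooth|exact: schwartz_smooth|].
    by move=> p _; rewrite cocutoff_partial_in// mul0r cabs0.
  by rewrite (le_trans (ler_wpM2l (normr_ge0 _) h))// !mulr0 ltW.
have xj0 : 0 < `|x ord0 j| by exact: lt_trans xj.
have [->|ma0] := eqVneq (monom a x) 0; first by rewrite normr0 mul0r ltW.
have ma : 0 < `|monom a x| by rewrite normr_gt0.
pose D := B * A / (`|x ord0 j| * `|monom a x|).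
have h : cabs (partials s (fun x => cocutoff M x * phi x : C^o) x) <= 2 ^+ size s * D.
  apply: leibniz_le; [exact: cocutoff_smooth|exact: schwartz_smooth|].
  move=> p /splits_size[p1 p2]; rewrite cabsM /D -mulrA ler_pM ?cabs_ge0//.
    exact: cocutoff_partial_le (leq_trans p1 sk).
  rewrite ler_pdivlMr ?mulr_gt0// mulrC -normrM -monom_shift.
  apply: H; last exact: leq_trans p2 (leqW sk).
  by move=> i; rewrite -addn1 leq_add// leq_b1.
rewrite (le_trans (ler_wpM2l (normr_ge0 _) h))//.
apply: (@le_trans _ _ (2 ^+ k * (B * A) / `|x ord0 j|)); last first.
  rewrite ler_pdivrMr// [leRHS]mulrC -ler_pdivrMr// ltW//.
  exact: lt_trans M3 xj.
have -> : `|monom a x| * (2 ^+ size s * D) = 2 ^+ size s * ((B * A) / `|x ord0 j|).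
  by rewrite /D; field; rewrite !gt_eqF.
rewrite -[leRHS]mulrA ler_wpM2r//; last by rewrite ler_weXn2l// ler1n.
by rewrite divr_ge0// mulr_ge0.
Qed.

Lemma tempered_cut (f : tempered R n) phi (e : R) : 0 < e -> exists M0, forall M, (M0 <= M)%N ->
  cabs ((f : topdual (schwartz_space R n)) phi -
        (f : topdual (schwartz_space R n)) (cut_schwartz M phi)) <= e.
Proof.
move=> e0; have [k [D [D0 fD]]] := tempered_semi f.
have e1 : 0 < e / D by rewrite divr_gt0.
have [M0 HM] := cut_approx k phi e1; exists M0 => M /HM H.
have lg := @topdual_linear _ (schwartz_space R n) f.
rewrite -(linB lg) (le_trans (fD _ _ e1 H))//.
by rewrite mulrC divfK// gt_eqF.
Qed.

End lattice_estimate.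

(** * Integration of rapidly decreasing functions *)

Section integral_one_dim.
Context {R : realType}.
Notation mu := (@lebesgue_measure R).

Definition quad (t : R) : R := (1 + t ^+ 2)^-1.

Lemma quad_gt0 t : 0 < quad t.
Proof. by rewrite invr_gt0 ltr_pwDl// sqr_ge0. Qed.

Lemma quad_le1 t : quad t <= 1.
Proof. by rewrite invf_le1 ?ltr_pwDl ?sqr_ge0// lerDl sqr_ge0. Qed.

Lemma quad_continuous : continuous quad.
Proof. exact: continuous_oneDsqrV. Qed.

Lemma quad_integrable : mu.-integrable setT (EFin \o quad).
Proof.
have E : (\int[mu]_x (quad x)%:E = 2%:E * (pi / 2)%:E)%E.
  rewrite ge0_symfun_integralT//.
  - rewrite (_ : [set x | _] = `[0, +oo[%classic) ?integral0y_oneDsqr//.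
    by apply/seteqP; split => x/=; rewrite in_itv/= andbT.
  - by move=> x; rewrite ltW// quad_gt0.
  - exact: quad_continuous.
  - by move=> x; rewrite /quad /= sqrrN.
apply/integrableP; split.
  by apply/measurable_EFinP; apply: continuous_measurable_fun; exact: quad_continuous.
rewrite [X in (X < _)%E](_ : _ = (2%:E * (pi / 2)%:E)%E) -?EFinM ?ltry// EFinM -E.
by apply: eq_integral => x _ /=; rewrite gtr0_norm// quad_gt0.
Qed.

(** Continuity settles measurability, and [quad] is an explicit integrable majorant for dominated
    convergence. *)
Definition dec1 (M : R) (f : R -> R) := continuous f /\ forall x, `|f x| <= M * quad x.

Lemma dec1_integrable M f : dec1 M f -> mu.-integrable setT (EFin \o f).
Proof.
move=> [cf fM].
have iM : mu.-integrable setT (EFin \o (fun x => M * quad x)).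
  have := integrableZl measurableT M quad_integrable.
  by apply: eq_integrable => // x _ /=; rewrite EFinM.
apply: le_integrable iM => //.
  by apply/measurable_EFinP; apply: continuous_measurable_fun.
by move=> x _ /=; rewrite lee_fin (le_trans (fM x))// ler_norm.
Qed.

Definition quad_int : R := \int[mu]_x quad x.

Lemma dec1_le M f : dec1 M f -> `|\int[mu]_x f x| <= M * quad_int.
Proof.
move=> df; have [cf fM] := df; have ifn := dec1_integrable df.
rewrite (le_trans (le_normr_Rintegral measurableT ifn))//.
rewrite /quad_int -RintegralZl//; last exact: quad_integrable.
apply: le_Rintegral => //.
  exact: integrable_norm ifn.
have := integrableZl measurableT M quad_integrable.
by apply: eq_integrable => // x _ /=; rewrite EFinM.
Qed.

Lemma dec1_cvg M (f : nat -> R -> R) (g : R -> R) :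
  (forall k, dec1 M (f k)) -> dec1 M g -> (forall x, f ^~ x @ \oo --> g x) ->
  (fun k => \int[mu]_x f k x) @ \oo --> \int[mu]_x g x.
Proof.
move=> df dg fg.
have mf h : dec1 M h -> measurable_fun setT (EFin \o h).
  by move=> [ch _]; apply/measurable_EFinP; exact: continuous_measurable_fun.
have iM : mu.-integrable setT (EFin \o (fun x => M * quad x)).
  have := integrableZl measurableT M quad_integrable.
  by apply: eq_integrable => // x _ /=; rewrite EFinM.
have [||_ _ H] := @dominated_convergence _ _ _ mu _ measurableT
  (fun k => EFin \o f k) (EFin \o g) (EFin \o (fun x => M * quad x))
  (fun k => mf _ (df k)) (mf _ dg) _ iM _.
- by apply: aeW => x _; apply: cvg_comp (fg x) _; exact: cvg_refl.
- by apply: aeW => x k _ /=; rewrite lee_fin; have [_] := df k; apply.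
rewrite /Rintegral; apply: fine_cvg.
by rewrite fineK; [exact: H|exact: integrable_fin_num (dec1_integrable dg)].
Qed.

Lemma is_derive_shift1 (h x : R) : is_derive x (1 : R) (fun y : R => y + h) 1.
Proof.
rewrite -[1 in X in is_derive _ _ _ X]addr0; exact: (@is_deriveD R R R id (cst h) x 1 1 0).
Qed.

Lemma integral_shift_ge0 (g : R -> R) h : continuous g -> (forall x, 0 <= g x) ->
  (\int[mu]_x (g (x + h))%:E = \int[mu]_x (g x)%:E)%E.
Proof.
move=> cg g0; pose F (x : R) := x + h.
have F1 : F^`()%classic = cst 1.
  by apply/funext => x; rewrite derive1E (@derive_val _ _ _ _ _ _ _ (is_derive_shift1 h x)).
rewrite [RHS](@increasing_ge0_integration_by_substitutionT _ F)//.
- by apply: eq_integral => x _; rewrite F1 !fctE mulr1.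
- by move=> x y xy; rewrite /F ltrD2r.
- by rewrite F1; exact: cst_continuous.
- by rewrite F1; exact: is_cvg_cst.
- by rewrite F1; exact: is_cvg_cst.
- by apply: cvg_addrr_Ny.
- by apply: cvg_addrr.
Qed.

(** With Q = M * quad, the function is (f + Q) - Q, a difference of nonnegative functions to which
    the substitution rule for nonnegative integrands applies. *)
Lemma dec1_shift M f h : dec1 M f -> \int[mu]_x f (x + h) = \int[mu]_x f x.
Proof.
move=> df; have [cf fM] := df.
have cs : continuous (fun x : R => x + h).
  by move=> x; exact: (cvgD (@cvg_id _ (nbhs x)) (@cvg_cst _ h _ _ _)).
pose Q x := M * quad x.
have cQ : continuous Q by move=> x; apply: cvgMl_tmp; exact: quad_continuous.
have Q0 x : 0 <= Q x by rewrite (le_trans (normr_ge0 (f x))).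
have dQ : dec1 M Q by split => // x; rewrite ger0_norm.
pose P x := f x + Q x.
have cP : continuous P by move=> x; exact: (cvgD (cf x) (cQ x)).
have P0 x : 0 <= P x by have := fM x; rewrite ler_norml /P /Q; lra.
have iQ := dec1_integrable dQ; have iF := dec1_integrable df.
have shift_int (g : R -> R) : continuous g -> (forall x, 0 <= g x) ->
    mu.-integrable setT (EFin \o g) -> mu.-integrable setT (EFin \o (fun x => g (x + h))).
  move=> cg g0 /integrableP[mg ig]; apply/integrableP; split.
    apply/measurable_EFinP; apply: continuous_measurable_fun => x.
    exact: (continuous_comp (cs x) (cg (x + h))).
  rewrite [X in (X < _)%E](_ : _ = \int[mu]_x (g (x + h))%:E)%E; last first.
    by apply: eq_integral => x _ /=; rewrite ger0_norm.
  rewrite integral_shift_ge0//; move: ig; congr (_ < _)%E.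
  by apply: eq_integral => x _ /=; rewrite ger0_norm.
have iP : mu.-integrable setT (EFin \o P).
  by have := integrableD measurableT iF iQ; apply: eq_integrable => // x _ /=; rewrite EFinD.
have fE x : f x = P x - Q x by rewrite /P addrK.
rewrite (@eq_Rintegral _ _ _ mu setT (fun x => P (x + h) - Q (x + h))); last by move=> x _; rewrite fE.
rewrite [RHS](@eq_Rintegral _ _ _ mu setT (fun x => P x - Q x)); last by move=> x _; rewrite fE.
rewrite !RintegralB//; [|exact: shift_int..].
by rewrite /Rintegral !integral_shift_ge0.
Qed.

End integral_one_dim.

Section row_vectors.
Context {R : realType}.

Lemma coord_le_norm n (x : 'rV[R]_n) i : `|x ord0 i| <= `|x|.
Proof.
rewrite [leRHS](_ : _ = mx_norm x)// mx_normrE.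
by apply/bigmax_geP; right; exists (ord0, i).
Qed.

Lemma norm_le_coord n (x : 'rV[R]_n) e : 0 <= e -> (forall i, `|x ord0 i| <= e) -> `|x| <= e.
Proof.
move=> e0 H; rewrite [leLHS](_ : _ = mx_norm x)// mx_normrE.
by apply/bigmax_leP; split => // -[i j] _ /=; rewrite (ord1 i).
Qed.

Lemma row_mx_lshift m (x : R) (y : 'rV[R]_m) (i : 'I_1) :
  (row_mx x%:M y : 'rV[R]_(1 + m)) ord0 (lshift m i) = x.
Proof. by rewrite row_mxEl !mxE (ord1 i) eqxx. Qed.

Lemma row_mx_rshift m (x : R) (y : 'rV[R]_m) (i : 'I_m) :
  (row_mx x%:M y : 'rV[R]_(1 + m)) ord0 (rshift 1 i) = y ord0 i.
Proof. by rewrite row_mxEr. Qed.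

Lemma row_mx_norm m (x x' : R) (y y' : 'rV[R]_m) :
  `|(row_mx x%:M y : 'rV[R]_(1 + m)) - row_mx x'%:M y'| <= `|x - x'| + `|y - y'|.
Proof.
apply: norm_le_coord => [|i]; first exact: addr_ge0.
rewrite !mxE; case: splitP => j _; rewrite ?mxE.
  by rewrite (ord1 j) eqxx lerDl.
by have := coord_le_norm (y - y') j; rewrite !mxE => h; rewrite (le_trans h)// lerDr.
Qed.

Lemma row_mx_continuousr m (x : R) :
  continuous (fun y : 'rV[R]_m => row_mx x%:M y : 'rV[R]_(1 + m)).
Proof.
move=> y; apply/(@cvgrPdist_le _ _ _ (nbhs y)) => e e0.
have /(@cvgrPdist_le _ _ _ (nbhs y))/(_ e e0) := @cvg_id _ (nbhs y).
apply: (@filterS _ (nbhs y)) => y' yy.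
by rewrite (le_trans (row_mx_norm _ _ _ _))// subrr normr0 add0r.
Qed.

Lemma row_mx_continuousl m (y : 'rV[R]_m) :
  continuous (fun x : R => row_mx x%:M y : 'rV[R]_(1 + m)).
Proof.
move=> x; apply/(@cvgrPdist_le _ _ _ (nbhs x)) => e e0.
have /(@cvgrPdist_le _ _ _ (nbhs x))/(_ e e0) := @cvg_id _ (nbhs x).
apply: (@filterS _ (nbhs x)) => x' xx.
by rewrite (le_trans (row_mx_norm _ _ _ _))// subrr normr0 addr0.
Qed.

End row_vectors.

(** * Iterated integrals over R^n *)

Section rintegral.
Context {R : realType}.
Notation mu := (@lebesgue_measure R).

Definition quadn n (x : 'rV[R]_n) : R := \prod_i quad (x ord0 i).

(** The majorant is a product, so every slice decays again, with constant M * quad x, and the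
    iterated integral can be handled one variable at a time. *)
Definition decay n (M : R) (f : 'rV[R]_n -> R) :=
  continuous f /\ forall x, `|f x| <= M * quadn x.

Lemma quadn_gt0 n (x : 'rV[R]_n) : 0 < quadn x.
Proof. by apply: prodr_gt0 => i _; exact: quad_gt0. Qed.

Lemma quadn_row m x (y : 'rV[R]_m) : quadn (row_mx x%:M y : 'rV[R]_(1 + m)) = quad x * quadn y.
Proof.
rewrite /quadn big_split_ord /= big_ord_recl big_ord0 mulr1 row_mx_lshift.
by congr (_ * _); apply: eq_bigr => i _; rewrite row_mx_rshift.
Qed.

Lemma decay_ge0 n M (f : 'rV[R]_n -> R) : decay M f -> 0 <= M.
Proof.
by move=> [_ /(_ 0)] h; rewrite -(pmulr_lge0 _ (quadn_gt0 (0 : 'rV[R]_n))) (le_trans _ h).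
Qed.

Lemma decayW n M M' (f : 'rV[R]_n -> R) : M <= M' -> decay M f -> decay M' f.
Proof.
move=> MM [cf fM]; split => // x; rewrite (le_trans (fM x))// ler_wpM2r//.
by rewrite ltW// quadn_gt0.
Qed.

Lemma decay_lin n M M' a (f g : 'rV[R]_n -> R) : decay M f -> decay M' g ->
  decay (`|a| * M + M') (fun x => a * f x + g x).
Proof.
move=> [cf fM] [cg gM]; split => x.
  exact: (cvgD (cvgMl_tmp (cf x)) (cg x)).
by rewrite (le_trans (ler_normD _ _))// mulrDl lerD// normrM -mulrA ler_wpM2l.
Qed.

Definition slice m (f : 'rV[R]_m.+1 -> R) (x : R) (y : 'rV[R]_m) : R :=
  f (row_mx x%:M y : 'rV[R]_(1 + m)).

Lemma decay_slice m M (f : 'rV[R]_m.+1 -> R) x : decay M f -> decay (M * quad x) (slice f x).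
Proof.
move=> [cf fM]; split => y.
  exact: (continuous_comp (row_mx_continuousr (x := x) (x0 := y)) (cf _)).
by rewrite -mulrA -quadn_row; exact: fM.
Qed.

Lemma rintegralS m (f : 'rV[R]_m.+1 -> R) :
  rintegral f = \int[mu]_x rintegral (slice f x).
Proof. by []. Qed.

(** The bound and dominated convergence go through one induction: the inner integral must be
    continuous in the outer variable before it can be integrated, and this is dominated convergence
    in one variable less. *)
Lemma rintegral_props n :
  (forall M (f : 'rV[R]_n -> R), decay M f -> `|rintegral f| <= M * quad_int ^+ n) /\
  (forall M (f : nat -> 'rV[R]_n -> R) g, (forall k, decay M (f k)) -> decay M g ->
     (forall x, f ^~ x @ \oo --> g x) -> (fun k => rintegral (f k)) @ \oo --> rintegral g).
Proof.
elim: n => [|m [IH1 IH2]].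
  split => [M f [_ /(_ 0)]|M f g _ _ /(_ 0)//].
  by rewrite /= /quadn big_ord0 expr0.
have outer M (f : 'rV[R]_m.+1 -> R) : decay M f ->
    dec1 (M * quad_int ^+ m) (fun x => rintegral (slice f x)).
  move=> df; split => x; last first.
    by rewrite (le_trans (IH1 _ _ (decay_slice x df)))// mulrAC.
  apply/(@cvg_nbhsP _ R^o) => u ux.
  apply: (IH2 M (fun k => slice f (u k))) => [k||y].
  - apply: decayW (decay_slice (u k) df).
    by rewrite ler_piMr ?quad_le1// (decay_ge0 df).
  - apply: decayW (decay_slice x df).
    by rewrite ler_piMr ?quad_le1// (decay_ge0 df).
  - apply: (cvg_comp u (fun t => slice f t y) ux).
    have c1 : {for x, continuous (fun t : R => row_mx t%:M y : 'rV[R]_(1 + m))} :=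
      @row_mx_continuousl R m y x.
    exact: (@continuous_comp _ _ _ (fun t : R => row_mx t%:M y : 'rV[R]_(1 + m)) f x c1 (df.1 _)).
split=> [M f df|M f g df dg fg].
  by rewrite rintegralS (le_trans (dec1_le (outer _ _ df)))// exprSr mulrA.
rewrite rintegralS; apply: (dec1_cvg (f := fun k x => rintegral (slice (f k) x)) _ (outer _ _ dg)).
  by move=> k; exact: outer.
move=> x; apply: (IH2 (M * quad x)) => [k||y]; [exact: decay_slice..|].
exact: fg.
Qed.

Lemma rintegral_le n M (f : 'rV[R]_n -> R) : decay M f -> `|rintegral f| <= M * quad_int ^+ n.
Proof. exact: (rintegral_props n).1. Qed.

Lemma rintegral_cvg n M (f : nat -> 'rV[R]_n -> R) g :
  (forall k, decay M (f k)) -> decay M g ->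
  (forall x, f ^~ x @ \oo --> g x) -> (fun k => rintegral (f k)) @ \oo --> rintegral g.
Proof. exact: (rintegral_props n).2. Qed.

Lemma decay_outer m M (f : 'rV[R]_m.+1 -> R) : decay M f ->
  dec1 (M * quad_int ^+ m) (fun x => rintegral (slice f x)).
Proof.
move=> df; split => x; last first.
  by rewrite (le_trans (rintegral_le (decay_slice x df)))// mulrAC.
apply/(@cvg_nbhsP _ R^o) => u ux.
apply: (@rintegral_cvg _ M (fun k => slice f (u k))) => [k||y].
- apply: decayW (decay_slice (u k) df).
  by rewrite ler_piMr ?quad_le1// (decay_ge0 df).
- apply: decayW (decay_slice x df).
  by rewrite ler_piMr ?quad_le1// (decay_ge0 df).
- apply: (cvg_comp u (fun t => slice f t y) ux).
  have c1 : {for x, continuous (fun t : R => row_mx t%:M y : 'rV[R]_(1 + m))} :=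
      @row_mx_continuousl R m y x.
    exact: (@continuous_comp _ _ _ (fun t : R => row_mx t%:M y : 'rV[R]_(1 + m)) f x c1 (df.1 _)).
Qed.

Lemma rintegral_lin n M M' a (f g : 'rV[R]_n -> R) : decay M f -> decay M' g ->
  rintegral (fun x => a * f x + g x) = a * rintegral f + rintegral g.
Proof.
elim: n M M' f g => [//|m IH] M M' f g df dg; rewrite !rintegralS.
under [LHS]eq_Rintegral => x _ do rewrite (IH _ _ _ _ (decay_slice x df) (decay_slice x dg)).
have iF := dec1_integrable (decay_outer df).
rewrite RintegralD//; last exact: dec1_integrable (decay_outer dg).
  by rewrite RintegralZl.
have := integrableZl measurableT a iF.
by apply: eq_integrable => // x _ /=; rewrite EFinM.
Qed.

Lemma rintegral_shift n M (f : 'rV[R]_n -> R) h : decay M f ->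
  rintegral (fun x => f (x + h)) = rintegral f.
Proof.
elim: n M f h => [|m IH] M f h df.
  by rewrite /= [h]thinmx0 addr0.
rewrite !rintegralS -(dec1_shift (h ord0 (lshift m ord0 : 'I_(1 + m))) (decay_outer df)).
apply: eq_Rintegral => x _.
rewrite -(IH _ _ (rsubmx (h : 'rV[R]_(1 + m))) (decay_slice _ df)).
congr rintegral; apply/funext => y; rewrite /slice; congr f.
apply/rowP => i; rewrite !mxE; case: splitP => j ij; rewrite ?mxE.
  rewrite (ord1 j) eqxx !mulr1n; congr (_ + h _ _); apply: val_inj.
  by move: ij; rewrite (ord1 j) /= => ->.
by congr (_ + h _ _); apply: val_inj.
Qed.

End rintegral.

(** * Integrals of partial derivatives *)

Section rintegral_derivative.
Context {R : realType} {n : nat}.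
Local Notation Rn := 'rV[R]_n.

Lemma quadn_shift (x : Rn) (j : 'I_n) (s : R) : 0 <= s <= 1 ->
  quadn (x + s *: 'e_j) <= 3 * quadn x.
Proof.
move=> /andP[s0 s1]; rewrite /quadn (bigD1 j)//= [in leRHS](bigD1 j)//= mulrA.
apply: ler_pM.
- by rewrite ltW// quad_gt0.
- by apply: prodr_ge0 => i _; rewrite ltW// quad_gt0.
- rewrite /quad !mxE !eqxx mulr1; set t := x ord0 j.
  have p1 : 0 < 1 + (t + s) ^+ 2 by rewrite ltr_pwDl// sqr_ge0.
  have p2 : 0 < 1 + t ^+ 2 by rewrite ltr_pwDl// sqr_ge0.
  rewrite ler_pdivlMr// ler_pdivrMl// mulrC.
  have ss : s * s <= 1 by rewrite mulr_ile1.
  by have := sqr_ge0 (2 * t + 3 * s); rewrite !expr2; lra.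
- rewrite le_eqVlt; apply/orP; left; apply/eqP; apply: eq_bigr => i ij.
  by rewrite !mxE /= (negbTE ij) mulr0 addr0.
Qed.

(** Difference quotients have integral 0 by translation invariance. The mean value theorem and
    [quadn_shift] bound them by 3 M quadn, so dominated convergence passes to the derivative; the
    order of integration never has to be changed. *)
Lemma rintegral_derive (f g : Rn -> R^o) (j : 'I_n) (M : R) :
  decay M f -> decay M g -> (forall x, is_derive x 'e_j f (g x)) -> rintegral g = 0.
Proof.
move=> df dg fg.
pose t (k : nat) : R := k.+1%:R^-1.
have t0 k : 0 < t k by rewrite invr_gt0.
have t1 k : t k <= 1 by rewrite invf_le1// ler1n.
pose F k (x : Rn) : R := (t k)^-1 * f (x + t k *: 'e_j) + - (t k)^-1 * f x.
have line x s : is_derive s (1 : R) (fun s : R => f (x + s *: 'e_j)) (g (x + s *: 'e_j)).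
  have E : (fun h : R => h^-1 *: (((fun s : R => f (x + s *: 'e_j)) \o shift s) (h *: (1 : R)) - f (x + s *: 'e_j)))
    = (fun h : R => h^-1 *: ((f \o shift (x + s *: 'e_j)) (h *: 'e_j) - f (x + s *: 'e_j))).
    apply/funext => h /=; congr (_ *: (f _ - _)).
    by rewrite [h *: 1]mulr1 scalerDl addrCA.
  have [d1 d2] := fg (x + s *: 'e_j).
  by apply: DeriveDef; [rewrite /derivable E|rewrite /derive E].
have cF k : continuous (F k).
  have [cf _] := df; move=> x.
  have cs : {for x, continuous (fun y : Rn => y + t k *: 'e_j)}.
    exact: (cvgD (@cvg_id _ (nbhs x)) (@cvg_cst _ (t k *: 'e_j) _ _ _)).
  exact: (cvgD (cvgMl_tmp (continuous_comp cs (cf _))) (cvgMl_tmp (cf x))).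
have dF k : decay (3 * M) (F k).
  split => // x.
  have [|c /[!in_itv]/= /andP[c0 c1] cE] := @MVT R (fun s : R => f (x + s *: 'e_j)) (fun s => g (x + s *: 'e_j)) 0 (t k) (t0 k).
  - apply: continuous_subspaceT => s; apply/differentiable_continuous/derivable1_diffP.
    by case: (line x s).
  have -> : F k x = g (x + c *: 'e_j).
    rewrite /F mulNr -mulrBr; move: cE; rewrite scale0r addr0 subr0 => ->.
    by rewrite mulrCA mulVf ?mulr1// gt_eqF.
  rewrite (le_trans (dg.2 _))// -[leRHS]mulrA [leRHS]mulrCA ler_wpM2l ?(decay_ge0 dg)//.
  by rewrite quadn_shift// (ltW c0)/= (le_trans (ltW c1)).
have M3 : M <= 3 * M by have := decay_ge0 dg; lra.
have lim : (fun k => rintegral (F k)) @ \oo --> rintegral g.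
  apply: (rintegral_cvg dF (decayW M3 dg)) => x.
  have [d1 d2] := fg x.
  have d3 : (fun h : R => h^-1 *: ((f \o shift x) (h *: 'e_j) - f x)) @ 0^' --> g x.
    by rewrite -d2; exact: d1.
  have ht : t @ \oo --> (0 : R) by exact: cvg_harmonic.
  have /cvgr_dnbhsP := d3.
  move=> /(_ t) H; have := H (conj (fun k => lt0r_neq0 (t0 k)) ht).
  rewrite (_ : F ^~ x = fun k => (t k)^-1 *: ((f \o shift x) (t k *: 'e_j) - f x))//.
  by apply/funext => k; rewrite /F /= mulNr -mulrBr [_ *: _ + x]addrC.
have F0 k : rintegral (F k) = 0.
  have dfs : decay (3 * M) (fun x => f (x + t k *: 'e_j)).
    have [cf fM] := df; split => x.
      have cs : {for x, continuous (fun y : Rn => y + t k *: 'e_j)}.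
        exact: (cvgD (@cvg_id _ (nbhs x)) (@cvg_cst _ (t k *: 'e_j) _ _ _)).
      exact: (continuous_comp cs (cf _)).
    rewrite (le_trans (fM _))// -[leRHS]mulrA [leRHS]mulrCA ler_wpM2l ?(decay_ge0 df)//.
    by rewrite quadn_shift// (ltW (t0 k)) t1.
  have dl := rintegral_lin (- 1) df dfs.
  have d1 : decay (`|-1| * M + 3 * M) (fun x => -1 * f x + f (x + t k *: 'e_j)) by exact: decay_lin.
  have d0 : decay 0 (cst 0 : Rn -> R).
    by split; [exact: cst_continuous|move=> x; rewrite normr0 mul0r].
  have := rintegral_lin (t k)^-1 d1 d0; rewrite dl (rintegral_shift _ df).
  rewrite mulN1r addNr mulr0 add0r => h.
  have -> : F k = (fun x => (t k)^-1 * (-1 * f x + f (x + t k *: 'e_j)) + cst 0 x).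
    by apply/funext => x; rewrite /F /= addr0 mulN1r mulrDr mulrN mulNr addrC.
  by rewrite h; have := rintegral_le d0; rewrite mul0r normr_le0 => /eqP.
have : (fun=> 0 : R) @ \oo --> rintegral g.
  by rewrite (_ : (fun=> 0) = (fun k => rintegral (F k)))//; apply/funext => k; rewrite F0.
by move=> /cvg_unique; apply => //; exact: cvg_cst.
Qed.

End rintegral_derivative.

(** * Complex integrals *)

Section complex_integral.
Context {R : realType} {n : nat}.
Local Notation Rn := 'rV[R]_n.
Local Notation C := R[i].
Implicit Types (f g : Rn -> C^o).

Definition cdecay (M : R) f := decay M (re f) /\ decay M (im f).

Lemma cdecay_cabs M f : C1 f -> (forall x, cabs (f x) <= M * quadn x) -> cdecay M f.
Proof.
move=> [cr ci _] H; split; split => // x; apply: le_trans (H x).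
  exact: Re_le_cabs.
exact: Im_le_cabs.
Qed.

Lemma cintegral_lin M M' (a : C) f g : cdecay M f -> cdecay M' g ->
  cintegral (a *: f + g) = a * cintegral f + cintegral g.
Proof.
move=> [fr fi] [gr gi]; rewrite /cintegral re_lin im_lin.
have E1 : rintegral (complex.Re a *: re f - complex.Im a *: im f + re g) =
    complex.Re a * rintegral (re f) - complex.Im a * rintegral (im f) + rintegral (re g).
  have d1 := decay_lin (- complex.Im a) fi gr.
  have := rintegral_lin (complex.Re a) fr d1; rewrite (rintegral_lin _ fi gr) => h.
  rewrite -[X in _ = _ + X + _]mulNr -[RHS]addrA -h; congr rintegral; apply/funext => x.
  by rewrite !fctE /GRing.scale /= mulNr addrA.
have E2 : rintegral (complex.Re a *: im f + complex.Im a *: re f + im g) =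
    complex.Re a * rintegral (im f) + complex.Im a * rintegral (re f) + rintegral (im g).
  have d1 := decay_lin (complex.Im a) fr gi.
  have := rintegral_lin (complex.Re a) fi d1; rewrite (rintegral_lin _ fr gi) => h.
  rewrite -[RHS]addrA -h; congr rintegral; apply/funext => x.
  by rewrite !fctE /GRing.scale /= addrA.
rewrite E1 E2; case: a {E1 E2} => a b /=.
by apply/eqP; rewrite eq_complex /=; apply/andP; split; apply/eqP; ring.
Qed.

Lemma cintegral_le M f : cdecay M f -> cabs (cintegral f) <= 2 * M * quad_int ^+ n.
Proof.
move=> [fr fi]; rewrite (le_trans (cabs_le _))//= -mulrA mulr_natl mulr2n.
by rewrite lerD// rintegral_le.
Qed.

Lemma cintegral_shift M f h : cdecay M f -> cintegral (fun x => f (x + h)) = cintegral f.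
Proof.
move=> [fr fi]; rewrite /cintegral; congr (_ +i* _)%C.
  exact: (rintegral_shift h fr).
exact: (rintegral_shift h fi).
Qed.

Lemma cintegral_partial M M' f j : C1 f -> cdecay M f -> cdecay M' (partial j f) ->
  cintegral (partial j f) = 0.
Proof.
move=> [_ _ df] [fr fi] [gr gi].
have MM : M <= Num.max M M' by rewrite le_max lexx.
have MM' : M' <= Num.max M M' by rewrite le_max lexx orbT.
have dr x : is_derive x 'e_j (re f) (re (partial j f) x).
  by apply: DeriveDef => //; have [] := df j x.
have di x : is_derive x 'e_j (im f) (im (partial j f) x).
  by apply: DeriveDef => //; have [] := df j x.
rewrite /cintegral (@rintegral_derive R n _ _ j _ (decayW MM fr) (decayW MM' gr) dr).
by rewrite (@rintegral_derive R n _ _ j _ (decayW MM fi) (decayW MM' gi) di).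
Qed.

Lemma weight_quadn (x : Rn) : (weight x ^+ 2)^-1 <= quadn x.
Proof.
rewrite /weight /quadn -prodrXl -prodfV; apply: ler_prod => i _.
rewrite invr_ge0 exprn_ge0 ?addr_ge0//= lef_pV2 ?posrE ?exprn_gt0 ?ltr_pwDl ?sqr_ge0//.
by rewrite -(real_normK (num_real (x ord0 i))) sqrrD expr1n; have := normr_ge0 (x ord0 i); lra.
Qed.

End complex_integral.

(** * The pairing of Schwartz functions and integration by parts *)

Section pairing.
Context {R : realType} {n : nat}.
Local Notation Rn := 'rV[R]_n.
Local Notation C := R[i].
Implicit Types (phi psi chi : schwartzfun R n).

Lemma schwartz_quadn phi A x : semi_le 2 phi A -> cabs (phi x) <= (2 ^+ 2) ^+ n * A * quadn x.
Proof.
move=> H; have A0 : 0 <= A.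
  by apply: le_trans (H (fun=> 0%N) [::] 0 _ _) => //; rewrite mulr_ge0// cabs_ge0.
apply: (le_trans (semi_decay x H (s := [::]) isT)).
by rewrite ler_wpM2l ?weight_quadn// mulr_ge0// !exprn_ge0.
Qed.

Lemma schwartz_le phi A x : semi_le 0 phi A -> cabs (phi x) <= A.
Proof.
move=> H; have := H (fun=> 0%N) [::] x (fun=> isT) isT.
by rewrite /monom big1 ?normr1 ?mul1r// => i _; rewrite expr0.
Qed.

Lemma schwartz_mul_decay phi psi A B : semi_le 2 phi A -> semi_le 0 psi B ->
  cdecay ((2 ^+ 2) ^+ n * A * B) (fun x => phi x * psi x : C^o).
Proof.
move=> HA HB; apply: cdecay_cabs.
  exact: (smoothM (schwartz_smooth phi) (schwartz_smooth psi) [::]).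
move=> x; rewrite cabsM mulrAC ler_pM ?cabs_ge0//; first exact: schwartz_quadn.
exact: schwartz_le.
Qed.

Lemma schwartz_mul_cdecay phi psi : exists M, cdecay M (fun x => phi x * psi x : C^o).
Proof.
have [A _ HA] := semi_le_ex 2 phi; have [B _ HB] := semi_le_ex 0 psi.
by eexists; exact: schwartz_mul_decay HA HB.
Qed.

Lemma pairingC (f g : Rn -> C^o) : pairing f g = pairing g f.
Proof. by rewrite /pairing; congr cintegral; apply/funext => x; rewrite mulrC. Qed.

Lemma pairing_lin phi : linear (fun psi => pairing phi psi : C^o).
Proof.
move=> a psi chi; have [M d1] := schwartz_mul_cdecay phi psi.
have [M' d2] := schwartz_mul_cdecay phi chi.
have := cintegral_lin a d1 d2; rewrite /pairing => <-; congr cintegral.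
by apply/funext => x; rewrite !fctE mulrDr; congr (_ + _); exact: mulrCA.
Qed.

Lemma regular_tempered_ex phi : exists f : tempered R n, regular_tempered f phi.
Proof.
have [A A0 HA] := semi_le_ex 2 phi.
have [|F FE] := @tempered_of_semi R n (fun psi => pairing phi psi) 0
  (2 * ((2 ^+ 2) ^+ n * A) * quad_int ^+ n) (pairing_lin phi).
- move=> psi B B0 HB; apply: (le_trans (cintegral_le (schwartz_mul_decay HA HB))).
  by rewrite !mulrA mulrAC.
- by exists F => chi; exact: FE.
Qed.

Lemma pairing_translate (f g : testfun R n) h :
  pairing (translate h f) g = pairing f (translate (- h) g).
Proof.
have [M d] := schwartz_mul_cdecay (test_schwartz f) (test_schwartz (translate (- h) g)).
rewrite /pairing -(cintegral_shift h d); congr cintegral; apply/funext => x /=.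
by rewrite addrK.
Qed.

Lemma pairing_partial phi psi j :
  pairing phi (schwartz_partials [:: j] psi) = - pairing (schwartz_partials [:: j] phi) psi.
Proof.
have [M d] := schwartz_mul_cdecay phi psi.
have [M1 d1] := schwartz_mul_cdecay phi (schwartz_partials [:: j] psi).
have [M2 d2] := schwartz_mul_cdecay (schwartz_partials [:: j] phi) psi.
have s1 := schwartz_smooth phi [::]; have s2 := schwartz_smooth psi [::].
have E := @partialM R n j phi psi s1 s2.
have d3 : cdecay (M2 + M1) (partial j (fun x => phi x * psi x : C^o)).
  rewrite E; split.
    have := decay_lin 1 d2.1 d1.1; rewrite normr1 mul1r; congr decay.
    by apply/funext => x; rewrite mul1r /re !fctE raddfD.
  have := decay_lin 1 d2.2 d1.2; rewrite normr1 mul1r; congr decay.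
  by apply/funext => x; rewrite mul1r /im !fctE raddfD.
have := cintegral_partial (smoothM (schwartz_smooth phi) (schwartz_smooth psi) [::]) d d3.
rewrite E => h; have := cintegral_lin 1 d2 d1; rewrite scale1r mul1r /= h.
move=> /esym/eqP; rewrite addrC addr_eq0 => /eqP.
by [].
Qed.

Lemma pairing_partials phi psi s :
  pairing phi (schwartz_partials s psi) = (-1) ^+ size s * pairing (schwartz_partials (rev s) phi) psi.
Proof.
elim: s phi => [|j s IH] phi.
  by rewrite /= mul1r.
have -> : pairing phi (schwartz_partials (j :: s) psi) =
    pairing phi (schwartz_partials [:: j] (schwartz_partials s psi)) by [].
rewrite pairing_partial IH /= exprS mulN1r mulNr; congr (- (_ * pairing _ _)).
by rewrite rev_cons /partials foldr_rcons.
Qed.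

Lemma size_multi_seq (a : 'I_n -> nat) : size (multi_seq a) = (\sum_j a j)%N.
Proof.
rewrite /multi_seq size_flatten /shape -map_comp sumnE big_map big_enum /=.
by apply: eq_bigr => j _; rewrite size_nseq.
Qed.

(** Integration by parts transfers the outermost letter first, which reverses the word; its sign
    cancels the one in the definition of the distributional derivative. *)
Lemma regular_derivative (f : tempered R n) phi a psi : regular_tempered f phi ->
  tempered_derivative a f psi = pairing (schwartz_partials (rev (multi_seq a)) phi) psi.
Proof.
move=> fphi; rewrite /tempered_derivative fphi pairing_partials size_multi_seq mulrA.
by rewrite -expr2 -exprM mulnC exprM sqrrN expr1n expr1n mul1r.
Qed.

End pairing.

(** * Bounded sets and seminorms on test functions *)

Section test_space_lemmas.
Context {R : realType} {n : nat}.
Local Notation Rn := 'rV[R]_n.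
Local Notation C := R[i].

Lemma test_in_box (f : testfun R n) : exists K : nat, forall x, ~ box K%:R x -> f x = 0.
Proof.
have [_ /compact_bounded[M [_ /(_ (M + 1))]]] := testP f.
rewrite ltrDl ltr01 => /(_ isT) HM; exists (Num.truncn (M + 1)).+1 => x /box_out[i xi].
apply: tsupport_out => /HM xM.
have := lt_trans (le_lt_trans xM (truncnS_gt _)) xi.
by rewrite ltNge coord_le_norm.
Qed.

Lemma test_scaleE c (f : testfun R n) x : (c *: f) x = c * f x.
Proof. by []. Qed.

Lemma tsupport_scale c (f : testfun R n) : tsupport (c *: f) `<=` tsupport f.
Proof.
apply: closure_subset => x /eqP cfx; apply/eqP => fx; apply: cfx.
by rewrite test_scaleE fx mulr0.
Qed.

Lemma partials_scale s c (f : testfun R n) x : partials s (c *: f) x = c * partials s f x.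
Proof.
by rewrite -[LHS](_ : partials s (c *: (f : Rn -> C^o)) x = _)// partialsZ//; exact: test_smooth.
Qed.

Lemma test_sets_bounded (B : set (testfun R n)) (A : set Rn) (M : nat -> R) : compact A ->
  (forall f, B f -> tsupport f `<=` A) ->
  (forall N f s x, B f -> (size s <= N)%N -> cabs (partials s f x) <= M N) ->
  tvs_bounded (B : set (test_space R n)).
Proof.
move=> cA BA BM; apply: tvs_bounded_lctvs => U [Ucvx _ /(_ A cA)[N [e [e0 UP]]]].
have M0 : 0 < `|M N| + 1 by rewrite ltr_wpDl.
exists (e / (`|M N| + 1)); first by rewrite divr_gt0.
move=> f Bf; apply: UP; first exact: subset_trans (@tsupport_scale _ f) (BA _ Bf).
move=> s sN x; rewrite partials_scale le_cabs.
rewrite cabsM cabs_nneg ?divr_ge0 ?(ltW e0) ?(ltW M0)// mulrAC ler_pdivrMr//.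
rewrite ler_wpM2l ?(ltW e0)// (le_trans (BM _ _ _ _ Bf sN))//.
by rewrite (le_trans (ler_norm _))// lerDl.
Qed.

Lemma test_bounded1 (f : testfun R n) : tvs_bounded ([set f] : set (test_space R n)).
Proof.
move=> U /nbhs0_lctvs[m [W [r [r0 BW WU]]]].
have := @tvs_bounded_lctvs R (testfun R n) (test_base R n) [set f] _ U _; apply.
  move=> V /lcbase_absorbing/(_ f)[c c0 Vc].
  have [cE _] := Re_ge0 (ltW c0); exists (complex.Re c); first by rewrite -ltcR cE.
  by move=> _ ->; rewrite cE.
by apply/nbhs0_lctvs; exists m, W, r.
Qed.

(* A sequence violating the estimate for every order would be bounded. *)
Lemma bounded_finite_order (q : testfun R n -> R) :
  (forall f, 0 <= q f) -> (forall c f, q (c *: f) = cabs c * q f) ->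
  (forall B : set (test_space R n), tvs_bounded B -> exists M, forall f, B f -> q f <= M) ->
  forall A, compact A -> exists N (D : R), 0 <= D /\
    forall (f : testfun R n) (B : R), tsupport f `<=` A -> 0 <= B ->
      (forall s x, (size s <= N)%N -> cabs (partials s f x) <= B) -> q f <= D * B.
Proof.
move=> q0 qZ qB A cA; apply: contrapT => H.
have key (N : nat) : exists f : testfun R n, [/\ tsupport f `<=` A,
    forall s x, (size s <= N)%N -> cabs (partials s f x) <= 1 & N%:R < q f].
  apply: contrapT => nf; apply: H; exists N, N%:R; split => // f B fA B0 fB.
  apply/ler_addgt0Pl => e e0; rewrite addrC.
  have N0 : 0 <= N%:R :> R by [].
  pose B1 := B + e / (N%:R + 1).
  have N1 : 0 < N%:R + 1 :> R by rewrite ltr_wpDl.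
  have eN : 0 < e / (N%:R + 1) by rewrite divr_gt0.
  have B10 : 0 < B1 by rewrite ltr_wpDl.
  rewrite (@le_trans _ _ (N%:R * B1))//; last first.
    rewrite /B1 mulrDr lerD2l mulrCA ler_piMr ?(ltW e0)//.
    by rewrite ler_pdivrMr// mul1r lerDl.
  rewrite leNgt; apply/negP => Nq; apply: nf; exists ((B1^-1)%:C%C *: f).
  have b0 : 0 <= B1^-1 by rewrite invr_ge0 ltW.
  split; first exact: subset_trans (@tsupport_scale _ f) fA.
  - move=> s x sN; rewrite partials_scale.
    rewrite cabsM cabs_nneg// ler_pdivrMl// mulr1 (le_trans (fB _ _ sN))//.
    by rewrite lerDl ltW.
  - by rewrite qZ cabs_nneg// ltr_pdivlMl// mulrC.
have [F FP] := choice key.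
(* For a given order N the bound 1 holds from index N on, and the finitely many earlier terms are
   Schwartz functions with bounds of their own. *)
have /choice[M MP] N : exists M, forall k s x, (size s <= N)%N -> cabs (partials s (F k) x) <= M.
  have /choice[G GP] k : exists G, semi_le N (test_schwartz (F k)) G.
    by have [G _ h] := semi_le_ex N (test_schwartz (F k)); exists G.
  exists (1 + \sum_(k < N) `|G k|) => k s x sN.
  have [Nk|kN] := leqP N k.
    have [_ h _] := FP k; rewrite (le_trans (h _ _ (leq_trans sN Nk)))//.
    by rewrite lerDl sumr_ge0.
  have := GP k (fun=> 0%N) s x (fun=> leq0n _) sN.
  rewrite /monom big1 ?normr1 ?mul1r; last by move=> i _; rewrite expr0.
  move=> h; rewrite (le_trans h)// (bigD1 (Ordinal kN))//= (le_trans (ler_norm _))//.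
  by rewrite addrCA lerDl addr_ge0// sumr_ge0.
have [||K KP] := qB (range F) (test_sets_bounded cA _ (M := M) _).
- by move=> _ [k _ <-]; have [] := FP k.
- by move=> N _ s x [k _ <-]; exact: MP.
- have [_ _] := FP (Num.truncn K).+1; rewrite ltNge; apply/negP/negPn.
  have := KP (F (Num.truncn K).+1) ltac:(by exists (Num.truncn K).+1).
  by move=> h; rewrite (le_trans h)// ltW// truncnS_gt.
Qed.

Lemma test_partials_subproof s (f : testfun R n) : partials s f \in @test_pred R n.
Proof.
have [K fK] := test_in_box f.
apply: (@test_of_box R n _ K%:R).
  by move=> t; have := test_smooth f (t ++ s); rewrite /partials foldr_cat.
exact: partials_out (@box_closed R n _) fK.
Qed.

Definition test_partials s (f : testfun R n) : testfun R n :=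
  TestFun (test_partials_subproof s f).

Lemma schwartz_partials_test s (f : testfun R n) :
  schwartz_partials s (test_schwartz f) = test_schwartz (test_partials s f).
Proof. exact: val_inj. Qed.

Lemma cut_test_id (f : testfun R n) : exists M0, forall M, (M0 <= M)%N ->
  cut_test M (test_schwartz f) = f.
Proof.
have [K fK] := test_in_box f; exists (K + 2)%N => M KM.
apply: val_inj; apply/funext => x /=.
have [xK|/fK ->] := pselect (box K%:R x); last by rewrite mulr0.
rewrite (_ : tensor _ _ x = 1) ?mul1r//; apply: (@cutoff1 R n M) => i.
have : (K + 2)%:R <= M%:R :> R by rewrite ler_nat.
by rewrite natrD; have := xK i; lra.
Qed.

End test_space_lemmas.

(** * Translation-invariant Banach spaces of tempered distributions *)

Section tibs_lemmas.
Context {R : realType} {n : nat} (E : tibs R n).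
Local Notation Rn := 'rV[R]_n.
Local Notation C := R[i].
Implicit Types (e : E) (f g : testfun R n) (phi psi : schwartzfun R n) (h : Rn).

Definition act e f : C^o := (tibs_incl E e : topdual (test_space R n)) f.

Lemma act_linl f : linear (act ^~ f : E -> C^o).
Proof. by move=> c e e'; rewrite /act linearP. Qed.

Lemma act_linr e : linear (act e).
Proof. exact: (@topdual_linear _ (test_space R n) (tibs_incl E e)). Qed.

Lemma act_inj e e' : (forall f, act e f = act e' f) -> e = e'.
Proof.
move=> H; have [inj _ _] := tibs_incl_emb E; apply: inj.
by apply: (@topdual_ext _ (test_space R n)) => f; exact: H.
Qed.

Lemma act_bounded (B : set (test_space R n)) : tvs_bounded B ->
  exists M : R, 0 < M /\ forall e f, B f -> cabs (act e f) <= M * nrm e.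
Proof.
move=> bB; have [_ ci _] := tibs_incl_emb E.
pose U : set (topdual (test_space R n)) := [set F | forall f, B f -> `|F f| <= 1].
have SU : lcbase_sets (strong_base (test_space R n)) U by exists B.
have nU : nbhs (0 : distr R n) U := lcbase_nbhs1 SU.
have /nbhs0_normed[r r0 rU] := continuous_linear0 (f := tibs_incl E) ci nU.
exists (1 / r); split; first by rewrite divr_gt0.
move=> e f Bf; apply: (@bounded_of_ball R E (fun e => cabs (act e f))) => //.
  by move=> c x; rewrite (linZ (act_linl f)) cabsM.
by move=> x /rU /(_ f Bf); rewrite le_cabs.
Qed.

Lemma act_cont f : exists F : topdual E, forall e, F e = act e f.
Proof.
have [M [_ HM]] := act_bounded (@test_bounded1 R n f).
by apply: (topdual_ex_bounded (act_linl f) (M := M)) => e; exact: HM.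
Qed.

Lemma act_test f g : act (tibs_test E f) g = pairing f g.
Proof. exact: tibs_testE. Qed.

Definition transl h e : E := sval (cid (tibs_translate h e)).

Lemma transl_def h e : distr_translate h (tibs_incl E e) = tibs_incl E (transl h e).
Proof. exact: svalP (cid (tibs_translate h e)). Qed.

Lemma translE h e f : act (transl h e) f = act e (translate (- h) f).
Proof. by have := transl_def h e => /(congr1 (fun F : testfun R n -> C^o => F f)). Qed.

Lemma transl_lin h : linear (transl h).
Proof.
by move=> c e e'; apply: act_inj => f; rewrite (act_linl f) !translE (act_linl (translate _ f)).
Qed.

Lemma transl_test h f : tibs_test E (translate h f) = transl h (tibs_test E f).
Proof. by apply: act_inj => g; rewrite translE !act_test pairing_translate. Qed.

(** The sets [A N] are not known to be closed, as no [transl h] is known to be continuous. A series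
    with terms in 2^-k [A N] is translated term by term: the translated series converges by
    completeness, and pairing with test functions identifies its sum as the translate of the
    original sum. *)
Lemma transl_growth : exists (t : nat) (D : R), 0 <= D /\
  forall h e, nrm (transl h e) <= D * (1 + eucl_norm h) ^+ t * nrm e.
Proof.
have w0 h : 0 < 1 + eucl_norm h by rewrite ltr_wpDr// eucl_norm_ge0.
have w1 h : 1 <= 1 + eucl_norm h by rewrite lerDl eucl_norm_ge0.
pose A (N : nat) := [set e : E | forall h, nrm (transl h e) <= N%:R * (1 + eucl_norm h) ^+ N].
have AZ N c e b : (forall h, nrm (transl h e) <= b * (1 + eucl_norm h) ^+ N) ->
    forall h, nrm (transl h (c *: e)) <= cabs c * b * (1 + eucl_norm h) ^+ N.
  by move=> H h; rewrite (linZ (transl_lin h)) nrmZ -mulrA ler_wpM2l ?cabs_ge0.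
have [|N|N u x uA ux|N [r [r0 rA]]] := @baire_series R E A.
- move=> e; have [M [tau [M0 tau0 H]]] := tibs_growth e.
  pose N := (maxn (Num.truncn M) (Num.truncn tau)).+1; exists N => h.
  have MN : M <= N%:R.
    by rewrite (le_trans (ltW (truncnS_gt _)))// ler_nat ltnS leq_maxl.
  have tN : tau <= N%:R.
    by rewrite (le_trans (ltW (truncnS_gt _)))// ler_nat ltnS leq_maxr.
  have := H h (transl h e) (transl_def h e); rewrite le_nrm => He.
  rewrite (le_trans He)// ler_pM ?(ltW M0) ?powR_ge0//.
  by rewrite -powR_mulrn ?(ltW (w0 h))// ler_powR.
- move=> e e' c d eA eA' cd h.
  rewrite (linD (transl_lin h)) (le_trans (nrmD _ _))//.
  rewrite (le_trans (lerD (AZ _ c _ _ eA h) (AZ _ d _ _ eA' h)))//.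
  rewrite -!mulrDl -mulrA ler_piMl//.
    by rewrite mulr_ge0// exprn_ge0// ltW.
  by move: cd; rewrite !cabsE -rmorphD lecR.
- have w h : 0 <= N%:R * (1 + eucl_norm h) ^+ N by rewrite mulr_ge0// exprn_ge0// ltW.
  have uh h k : nrm (transl h (u k)) <= N%:R * (1 + eucl_norm h) ^+ N * 2^-1 ^+ k.
    have := uA k h; rewrite (linZ (transl_lin h)) nrmZr ?exprn_ge0//.
    by rewrite -ler_pdivlMl ?exprn_gt0// exprVn mulrC.
  move=> h; rewrite (linZ (transl_lin h)) nrmZr ?invr_ge0//.
  rewrite ler_pdivrMl//; pose c := N%:R * (1 + eucl_norm h) ^+ N.
  have c0 : 0 <= c by exact: w.
  have c2 j : 0 <= 2 * c * 2^-1 ^+ j.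
    by apply: mulr_ge0; [exact: mulr_ge0|rewrite exprn_ge0// invr_ge0].
  pose s m := \sum_(k < m) transl h (u k).
  (* The subtracted tail makes the induction close exactly, each new term contributing c 2^-k. *)
  have sjk j i : nrm (s (i + j)%N - s j) <= 2 * c * 2^-1 ^+ j - 2 * c * 2^-1 ^+ (i + j).
    elim: i => [|i IH]; first by rewrite add0n !subrr nrm0.
    rewrite addSn /s big_ord_recr /= -/(s _) addrAC (le_trans (nrmD _ _))//.
    rewrite (le_trans (lerD IH (uh h _)))// -/c [in leRHS]exprS; lra.
  have [||y yP] := @geometric_cauchy R E s (2 * c).
  + exact: mulr_ge0.
  + move=> j k /subnK <-; rewrite (le_trans (sjk _ _))// gerBl.
    exact: c2.
  have -> : transl h x = y.
    apply: act_inj => f; rewrite translE.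
    have [F FE] := act_cont f; have [F' FE'] := act_cont (translate (- h) f).
    rewrite -FE -FE'; apply: (@lim_to_unique R C^o (fun m => F (s m))).
      have -> : (fun m => F (s m) : C^o) = (fun m => F' (\sum_(k < m) u k) : C^o).
        apply/funext => m; rewrite /s (lin_sum (@topdual_linear _ _ F)) (lin_sum (@topdual_linear _ _ F')).
        apply: eq_bigr => k _.
        by rewrite FE FE' translE.
      exact: topdual_lim.
    exact: topdual_lim.
  apply: (@lim_to_le R E s) => // m.
  have := sjk 0%N m; rewrite addn0 {2}/s big_ord0 subr0 expr0 mulr1 => h1.
  by rewrite (le_trans h1)// gerBl c2.
- exists N, (N%:R / r); split; first by rewrite divr_ge0// ltW.
  move=> h e; have w : 0 <= N%:R * (1 + eucl_norm h) ^+ N.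
    by rewrite mulr_ge0// exprn_ge0// ltW.
  have := @bounded_of_ball R E (fun e => nrm (transl h e)) r _ r0 _ _ w e.
  rewrite [N%:R / r * _]mulrAC; apply=> [c x|x xr].
    by rewrite (linZ (transl_lin h)) nrmZ.
  exact: rA.
Qed.

Lemma test_cut_bound : exists k (D : R), 0 <= D /\ forall phi A, 0 <= A -> semi_le k phi A ->
  forall M, nrm (tibs_test E (cut_test M phi)) <= D * A.
Proof.
have [t [D [D0 HD]]] := transl_growth; have [_ ct _] := tibs_test_emb E.
apply: (@seminorm_cut_bound R n (fun f => nrm (tibs_test E f)) t D) => //.
- by rewrite linear0 nrm0.
- by move=> f g; rewrite linearD nrmD.
- apply: bounded_finite_order => [f|c f|B bB]; first exact: nrm_ge0.
    by rewrite linearZ nrmZ.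
  have /bB[r r0 rB] := continuous_linear_normed (f := tibs_test E) (@ltr01 R) ct.
  have [rE _] := Re_ge0 (ltW r0); have r1 : 0 < complex.Re r by rewrite -ltcR rE.
  exists (complex.Re r)^-1 => f /rB /=; rewrite linearZ -rE nrmZr ?(ltW r1)//.
  by rewrite -ler_pdivlMl// mulr1.
- by move=> h f; rewrite transl_test.
Qed.

(** The lattice estimate is applied to the norm of [f] as a functional on [E]. Translating [f] by h
    amounts to acting on elements translated by -h, so this seminorm inherits the growth of
    [transl]. *)
Lemma act_cut_bound : exists k (D : R), 0 <= D /\ forall phi A, 0 <= A -> semi_le k phi A ->
  forall e M, cabs (act e (cut_test M phi)) <= D * A * nrm e.
Proof.
have N0 := @nrm_ge0 R E.
pose q f := op_norm (@nrm R E) (act ^~ f).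
have bdd f : op_bound (@nrm R E) (act ^~ f) !=set0.
  have [M [M0 H]] := act_bounded (@test_bounded1 R n f).
  by exists M; split => [|e]; [exact: ltW|exact: H].
have [t [D [D0 HD]]] := transl_growth.
have qZ c f : q (c *: f) = cabs c * q f.
  rewrite /q -(op_normZ N0 c (bdd f)); congr op_norm; apply/funext => e.
  by rewrite (linZ (act_linr e)).
have [||||k [K [K0 HK]]] := @seminorm_cut_bound R n q t D _ _ _ D0.
- by rewrite -(scale0r (0 : testfun R n)) qZ cabs0 mul0r.
- move=> f g; rewrite /q (le_trans _ (op_normD N0 (bdd f) (bdd g)))//.
  rewrite le_eqVlt; apply/orP; left; apply/eqP; congr op_norm; apply/funext => e.
  by rewrite (linD (act_linr e)).
- apply: bounded_finite_order => [f|//|B /act_bounded[M [M0 H]]].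
    exact: op_norm_ge0.
  by exists M => f Bf; apply: op_norm_le; split => [|e]; [exact: ltW|exact: H].
- move=> h f; apply: op_norm_le; split.
    by rewrite !mulr_ge0 ?exprn_ge0 ?op_norm_ge0// addr_ge0// eucl_norm_ge0.
  move=> e; have -> : act e (translate h f) = act (transl (- h) e) f by rewrite translE opprK.
  rewrite (le_trans (op_normP _ _ (bdd f)))// [leRHS]mulrAC [leRHS]mulrC.
  rewrite ler_wpM2l ?op_norm_ge0//.
  have := HD (- h) e; rewrite (_ : eucl_norm (- h) = eucl_norm h)//.
  by rewrite /eucl_norm; congr Num.sqrt; apply: eq_bigr => i _; rewrite mxE sqrrN.
- exists k, K; split => // phi A A0 H e M.
  rewrite (le_trans (op_normP _ e (bdd _)))// ler_wpM2r//.
  exact: HK.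
Qed.

Section ultra.
Context (E_reflexive : reflexive_space E).

(** The cut-offs of [phi] are bounded in [E] and have a weak limit; tested against a given [f] they
    agree with [phi] as soon as they equal it on the support of [f]. *)
Lemma schwartz_in_tibs phi : exists e, forall f, act e f = pairing phi f.
Proof.
have [U [UF sU]] := ultraFilterLemma (eventually_filter : ProperFilter (\oo : set_system nat)).
have [k [D [D0 HD]]] := test_cut_bound; have [A A0 HA] := semi_le_ex k phi.
have [|x xP] := @weak_limit R nat U UF E (fun M => tibs_test E (cut_test M phi)) (D * A) E_reflexive.
  by apply: filterS (filterT : U setT) => M _ /=; exact: HD.
exists x => f; have [F FE] := act_cont f.
apply: (@ultra_lim_unique R nat U UF (fun M => F (tibs_test E (cut_test M phi)))).
  by rewrite -FE; exact: xP.
move=> e e0; apply: sU.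
have [K fK] := test_in_box f; exists (K + 2)%N => // M /= KM.
rewrite FE act_test (_ : pairing _ _ = pairing phi f) ?subrr ?cabs0 ?(ltW e0)//.
rewrite /pairing; congr cintegral; apply/funext => x' /=.
have [xK|/fK ->] := pselect (box K%:R x'); last by rewrite !mulr0.
rewrite (_ : tensor _ _ x' = 1) ?mul1r//; apply: (@cutoff1 R n M) => i.
have : (K + 2)%:R <= M%:R :> R by rewrite ler_nat.
by rewrite natrD; have := xK i; lra.
Qed.

(** The value at phi is the limit of the action on cut-offs along one fixed ultrafilter, which makes
    it linear in phi; the bound uniform in the cut-off radius makes it continuous. *)
Lemma tibs_tempered e : exists g : tempered R n,
  forall f, (g : topdual (schwartz_space R n)) (test_schwartz f) = act e f.
Proof.
have [U [UF sU]] := ultraFilterLemma (eventually_filter : ProperFilter (\oo : set_system nat)).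
have [k [D [D0 HD]]] := act_cut_bound.
have /choice[l lP] phi : exists l, forall eps : R, 0 < eps ->
    U [set M | cabs (act e (cut_test M phi) - l) <= eps].
  have [A A0 HA] := semi_le_ex k phi.
  apply: (@ultra_lim R nat U UF _ (D * A * nrm e)).
  by apply: filterS (filterT : U setT) => M _ /=; exact: HD.
have [||g gE] := @tempered_of_semi R n l k (D * nrm e).
- move=> c phi psi; apply: (ultra_lim_unique UF (lP _)) => eps eps0.
  have := ultra_lim_lin UF c (lP phi) (lP psi) eps0.
  have cutD M : act e (cut_test M (c *: phi + psi)) = c * act e (cut_test M phi) + act e (cut_test M psi).
    rewrite -[RHS](act_linr e c); congr act; apply: val_inj; apply/funext => x.
    by rewrite /= !fctE mulrDr; congr (_ + _); exact: mulrCA.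
  by apply: filterS => M /=; rewrite -cutD.
- move=> phi A A0 HA; apply: (ultra_lim_le UF (lP phi)).
  apply: filterS (filterT : U setT) => M _ /=; rewrite mulrAC.
  by apply: HD => //; exact: ltW.
exists g => f; rewrite gE; apply: (ultra_lim_unique UF (lP _)) => eps eps0.
apply: sU; have [M0 HM] := cut_test_id f; exists M0 => // M /= /HM ->.
by rewrite subrr cabs0 ltW.
Qed.

End ultra.

Lemma tempered_ext (f g : tempered R n) :
  (forall t, (f : topdual (schwartz_space R n)) (test_schwartz t) = (g : topdual (schwartz_space R n)) (test_schwartz t)) ->
  f = g.
Proof.
move=> fg; apply: (@topdual_ext _ (schwartz_space R n)) => phi.
apply/eqP; rewrite -subr_eq0 -cabs_eq0 eq_le cabs_ge0 andbT.
apply/ler_addgt0Pl => e e0; rewrite addr0.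
have e2 : 0 < e / 2 by rewrite divr_gt0.
have [M1 H1] := tempered_cut f phi e2; have [M2 H2] := tempered_cut g phi e2.
have h1 := H1 _ (leq_maxl M1 M2); have h2 := H2 _ (leq_maxr M1 M2).
rewrite fg in h1; rewrite (splitr e); apply: le_trans (lerD h1 h2).
rewrite [X in _ <= _ + X]cabs_distC (le_trans _ (cabsD _ _))//.
by rewrite addrA subrK.
Qed.

End tibs_lemmas.

(** * Weak compactness *)

Section weak_compactness.
Context {R : realType}.
Local Notation C := R[i].

Lemma weak_nbhs_ultra (X : normedModType C) (U : set_system (weak_space X)) (y : weak_space X) :
  UltraFilter U ->
  (forall (g : topdual X) (e : R), 0 < e -> U [set x | cabs (g x - g y) <= e]) -> U --> y.
Proof.
move=> UF H A /nbhs0_translate/nbhs0_lctvs[m [W [r [r0 BW WA]]]].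
have r1 : 0 < r^-1 by rewrite invr_gt0.
have : U [set x | forall i, W i (r%:C%C *: (x - y : X))].
  apply: (@filter_forall _ _ (fun i x => W i (r%:C%C *: (x - y : X))) U) => i.
  have [g ->] := BW i; apply: filterS (H g _ r1) => x /=.
  rewrite linearZ linearB le_cabs cabsM (cabs_nneg (ltW r0)) => h.
  by rewrite -ler_pdivlMl// mulr1.
apply: filterS => x /WA /=; rewrite addrC subrK.
by [].
Qed.

Lemma nrm_le_dual (X : normedModType C) (x : X) (M : R) :
  (forall g : topdual X, (forall y, cabs (g y) <= nrm y) -> cabs (g x) <= M) -> nrm x <= M.
Proof.
move=> H; have [g g1 gx] := norming_functional x.
by have := H g g1; rewrite gx cabs_nneg ?nrm_ge0.
Qed.

Lemma weak_ball_closed (X : normedModType C) (M : R) :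
  closed ([set x : X | nrm x <= M] : set (weak_space X)).
Proof.
rewrite -[X in closed X]setCK; apply: open_closedC; rewrite openE => x /= /negP.
rewrite -ltNge => Mx; have [g g1 gx] := norming_functional x.
apply/nbhs0_translate.
(* With this scale, |g v| is at most (nrm x - M) / 2 on the neighbourhood, half of the margin by
   which g x exceeds M. *)
have d0 : 0 < 2 / (nrm x - M) by rewrite divr_gt0// subr_gt0.
have BU : lcbase_sets (weak_base X) [set y | `|g y| <= 1] by exists g.
have := lcbase_nbhs BU d0.
apply: (@filterS (weak_space X) (nbhs (0 : weak_space X))) => v /= Hv; apply/negP; rewrite -ltNge.
have : cabs (g (x + v)) <= nrm (x + v : X) by exact: g1.
apply: lt_le_trans; rewrite (linD (@topdual_linear _ _ g)) gx.
have : cabs (nrm x)%:C%C <= cabs ((nrm x)%:C%C + g v) + cabs (g v).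
  by rewrite -[cabs (g v)]cabsN (le_trans _ (cabsD _ _))// addrK.
move: Hv; rewrite (linZ (@topdual_linear _ _ g)) le_cabs cabsM (cabs_nneg (ltW d0)) mulrAC ler_pdivrMr ?subr_gt0// mul1r.
rewrite cabs_nneg ?nrm_ge0// => h1 h2; lra.
Qed.

(** A weak limit of points of the ball stays in the ball, since the norm is attained by a functional
    of norm at most 1; what remains is to produce limits of ultrafilters. *)
Lemma weak_ball_precompact (X : normedModType C) (M : R) :
  (forall U : set_system X, UltraFilter U -> U [set x | nrm x <= M] ->
    exists y : X, forall (g : topdual X) (e : R), 0 < e -> U [set x | cabs (g x - g y) <= e]) ->
  precompact ([set x : X | nrm x <= M] : set (weak_space X)).
Proof.
move=> H; rewrite precompact_closed; last exact: weak_ball_closed.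
rewrite compact_ultra => U UF UM; have [y yP] := H U UF UM.
exists y; split; last exact: weak_nbhs_ultra.
apply: nrm_le_dual => g g1; apply: (ultra_lim_le UF (yP g)).
by apply: filterS UM => x /=; apply: le_trans.
Qed.

Lemma weakly_compact_bounded (X Y : normedModType C) (u : {linear X -> Y}) (M : R) :
  0 <= M -> (forall x, nrm (u x) <= M * nrm x) ->
  precompact ([set y : Y | nrm y <= M] : set (weak_space Y)) -> weakly_compact u.
Proof.
move=> M0 uM; apply: precompact_subset => _ [x /= x1 <-] /=.
rewrite (le_trans (uM x))// ler_piMr//.
by rewrite -le_nrm.
Qed.

End weak_compactness.

(** * The space D_E and its functionals *)

Section DE_lemmas.
Context {R : realType} {n : nat} (E : tibs R n).
Local Notation C := R[i].
Implicit Types (e : E) (t : testfun R n) (phi psi : schwartzfun R n) (f : DE_type E).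

Definition tempered_eval (f : tempered R n) : schwartzfun R n -> C^o :=
  (f : topdual (schwartz_space R n)).

Lemma tempered_eval_lin (f : tempered R n) : linear (tempered_eval f).
Proof. exact: (@topdual_linear _ (schwartz_space R n) f). Qed.

Definition msign (a : 'I_n -> nat) : C := (-1) ^+ (\sum_j a j)%N.

Lemma act_derivative a f t :
  act (DE_derivative a f) t = msign a * tempered_eval f (test_schwartz (test_partials (multi_seq a) t)).
Proof.
rewrite /act (DE_derivativeP a f t) /tempered_derivative /msign.
by rewrite schwartz_partials_test.
Qed.

Lemma multi_seq0 : multi_seq (fun=> 0%N : nat) = [::] :> seq 'I_n.
Proof. by apply: size0nil; rewrite size_multi_seq big1. Qed.

Lemma msign0 : msign (fun=> 0%N) = 1.
Proof. by rewrite /msign big1// expr0. Qed.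

Lemma act_derivative0 f t :
  act (DE_derivative (fun=> 0%N) f) t = tempered_eval f (test_schwartz t).
Proof.
rewrite act_derivative msign0 mul1r multi_seq0; congr tempered_eval.
by congr test_schwartz; apply: val_inj.
Qed.

Lemma DE_derivative0_inj f g :
  DE_derivative (fun=> 0%N) f = DE_derivative (fun=> 0%N) g -> f = g.
Proof.
move=> fg; apply: val_inj; apply: tempered_ext => t.
by have := act_derivative0 f t; rewrite fg act_derivative0.
Qed.

Lemma derivative_eq a f e : (forall t, act e t = act (DE_derivative a f) t) -> DE_derivative a f = e.
Proof. by move=> H; apply: act_inj => t; rewrite H. Qed.

(** The value at [psi] is a limit of values at cut-offs, which act on [E] with a uniform bound.
    Hence only the norm of f itself enters, and evaluation at [psi] has order 0. *)
Lemma eval_bound psi : exists K : R, 0 < K /\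
  forall f, cabs (tempered_eval f psi) <= K * nrm (DE_derivative (fun=> 0%N) f).
Proof.
have [k [D [D0 HD]]] := act_cut_bound E; have [A A0 HA] := semi_le_ex k psi.
exists (D * A + 1); split; first by rewrite ltr_wpDl// mulr_ge0.
move=> f; apply: (@le_trans _ _ (D * A * nrm (DE_derivative (fun=> 0%N) f))); last first.
  by rewrite ler_wpM2r ?nrm_ge0// lerDl.
apply/ler_addgt0Pl => e e0; have [M HM] := tempered_cut f psi e0.
rewrite -[tempered_eval f psi](subrK (tempered_eval f (cut_schwartz M psi))).
rewrite (le_trans (cabsD _ _))// lerD//; first exact: HM.
by rewrite -act_derivative0; exact: HD.
Qed.

(* Bounding each a_j by k, rather than their sum, gives equivalent norms. *)
Definition mindex (k : nat) : finType := {ffun 'I_n -> 'I_k.+1}.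
Definition mval k (a : mindex k) : 'I_n -> nat := fun j => a j.
Definition Nk k f : R := \sum_(a : mindex k) nrm (DE_derivative (mval a) f).

Lemma Nk_ge0 k f : 0 <= Nk k f.
Proof. by rewrite sumr_ge0// => a _; exact: nrm_ge0. Qed.

Lemma NkZ k c f : Nk k (c *: f) = cabs c * Nk k f.
Proof. by rewrite /Nk mulr_sumr; apply: eq_bigr => a _; rewrite linearZ nrmZ. Qed.

Lemma nrm_le_Nk k (a : 'I_n -> nat) f : (forall j, a j <= k)%N ->
  nrm (DE_derivative a f) <= Nk k f.
Proof.
move=> ak; pose b : mindex k := [ffun j => inord (a j)].
have ab : a = mval b by apply/funext => j; rewrite /mval ffunE inordK// ltnS.
rewrite ab /Nk (bigD1 b)//= lerDl sumr_ge0// => c _; exact: nrm_ge0.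
Qed.

Lemma mval_le k (a : mindex k) j : (mval a j <= k)%N.
Proof. by rewrite -ltnS ltn_ord. Qed.

Lemma Nk_le k k' f : (k <= k')%N -> Nk k f <= #|mindex k|%:R * Nk k' f.
Proof.
move=> kk; rewrite /Nk mulr_natl -sumr_const; apply: ler_sum => a _.
by apply: nrm_le_Nk => j; exact: leq_trans (mval_le a j) kk.
Qed.

Lemma mindex_card k : 0 < #|mindex k|%:R :> R.
Proof. by rewrite ltr0n card_ffun expn_gt0 card_ord. Qed.

Lemma DE_nbhs k : nbhs (0 : DE E) [set f | Nk k f <= 1].
Proof.
(* Entries at most k give order at most n * k; scaling by the number of indices turns the bounds on
   single derivatives into a bound on their sum. *)
pose N := (n * k)%N.
have BU : lcbase_sets (DE_base E) [set f | forall a : 'I_n -> nat,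
    (\sum_j a j <= N)%N -> `|DE_derivative a f| <= 1] by exists N.
have := lcbase_nbhs BU (mindex_card k).
apply: (@filterS (DE E) (nbhs (0 : DE E))) => f /= Hf.
rewrite -(ler_pM2l (mindex_card k)) mulr1 -{1}(cabs_nneg (ltW (mindex_card k))) -NkZ.
rewrite -[leRHS]sumr_const; apply: ler_sum => a _; rewrite -le_nrm; apply: Hf.
apply: (@leq_trans (\sum_(j < n) k)); first by apply: leq_sum => j _; exact: mval_le.
by rewrite sum_nat_const card_ord.
Qed.

Lemma DE_nbhs_ex (U : set (DE_type E)) : nbhs (0 : DE E) U ->
  exists k (r : R), 0 < r /\ forall f, Nk k f <= r -> U f.
Proof.
move=> /nbhs0_lctvs[m [W [r [r0 BW WU]]]].
have /choice[N NP] i : exists N, W i = [set f | forall a : 'I_n -> nat,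
    (\sum_j a j <= N)%N -> `|DE_derivative a f| <= 1] by exact: BW.
exists (\max_i N i)%N, r^-1; split; first by rewrite invr_gt0.
move=> f fr; apply: WU => i; rewrite NP => a aN; rewrite linearZ le_nrm nrmZr ?(ltW r0)//.
rewrite -ler_pdivlMl// mulr1 (le_trans _ fr)// nrm_le_Nk// => j.
rewrite (leq_trans _ (leq_bigmax i))// (leq_trans _ aN)//.
by rewrite (bigD1 j)//= leq_addr.
Qed.

Lemma DE'_ex (F : DE_type E -> C^o) k (M : R) : linear F ->
  (forall f, cabs (F f) <= M * Nk k f) -> exists G : topdual (DE E), forall f, G f = F f.
Proof.
move=> lF FM; have M0 : 0 < `|M| + 1 by rewrite ltr_wpDl.
apply: (@topdual_ex R (DE E)) => //.
apply: filterS (scaled_nbhs0 M0 (DE_nbhs k)) => f /=.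
rewrite NkZ (cabs_nneg (ltW M0)); apply: le_trans; rewrite (le_trans (FM f))//.
by rewrite ler_wpM2r ?Nk_ge0// (le_trans (ler_norm M))// lerDl.
Qed.

Lemma topdual_Nk (F : topdual (DE E)) : exists k (M : R), 0 < M /\ forall f, cabs (F f) <= M * Nk k f.
Proof.
have [k [r [r0 HF]]] := DE_nbhs_ex (topdual_nbhs F).
exists k, r^-1; split => [|f]; first by rewrite invr_gt0.
have lF := @topdual_linear _ _ F.
(* The added r * e keeps the normalizing factor positive where the norm of f vanishes. *)
apply/ler_addgt0Pl => e e0; pose N1 := Nk k f + r * e.
have re : 0 < r * e by rewrite mulr_gt0.
have N10 : 0 < N1 by rewrite ltr_wpDl ?Nk_ge0.
have -> : e + r^-1 * Nk k f = N1 / r by rewrite /N1; field; rewrite gt_eqF.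
have rN : 0 < r / N1 by rewrite divr_gt0.
have : cabs (F ((r / N1)%:C%C *: f)) <= 1.
  apply: HF; rewrite NkZ cabs_nneg ?(ltW rN)// mulrAC ler_pdivrMr// ler_wpM2l ?(ltW r0)//.
  by rewrite /N1 lerDl ltW.
rewrite (linZ lF) cabsM cabs_nneg ?(ltW rN)//.
by rewrite -ler_pdivlMl// mulr1 invf_div.
Qed.

Lemma DE_bounded (A : set (DE E)) k : tvs_bounded A -> exists M : R, 0 < M /\ forall f, A f -> Nk k f <= M.
Proof.
move=> /(_ _ (DE_nbhs k))[r r0 rA]; have [rE _] := Re_ge0 (ltW r0).
have r1 : 0 < complex.Re r by rewrite -ltcR rE.
exists (complex.Re r)^-1; split; first by rewrite invr_gt0.
move=> f /rA /=; rewrite -rE NkZ (cabs_nneg (ltW r1)).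
by rewrite -ler_pdivlMl// mulr1.
Qed.

Section reflexive.
Context (E_reflexive : reflexive_space E).

Lemma schwartz_in_DE phi : exists f, regular_tempered f phi.
Proof.
have [f fphi] := regular_tempered_ex phi.
have fP : f \in DE_pred E.
  apply/asboolP => a.
  have [e eP] := schwartz_in_tibs E_reflexive (schwartz_partials (rev (multi_seq a)) phi).
  exists e => t; rewrite (regular_derivative a (test_schwartz t) fphi).
  exact: eP.
by exists (DEType fP).
Qed.

Lemma eval_in_DE' psi : exists F : DE' E,
  (forall f, (F : topdual (DE E)) f = tempered_eval f psi) /\ restricts_to F psi.
Proof.
have lF : linear (fun f : DE_type E => tempered_eval f psi) by move=> c f g.
have [K [K0 HK]] := eval_bound psi.
have [|F FE] := @DE'_ex (fun f : DE_type E => tempered_eval f psi) 0 K lF.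
  move=> f; rewrite (le_trans (HK f))// ler_wpM2l ?(ltW K0)//.
  exact: nrm_le_Nk.
exists F; split => // phi; have [f fphi] := schwartz_in_DE phi; exists f => //.
by rewrite FE pairingC; exact: fphi.
Qed.

End reflexive.

(** Temperedness comes for free from [tibs_tempered], so membership in [DE] only requires the
    distributional derivatives to be in [E]. *)
Lemma DE_of_tibs e : (forall a, exists e', forall t, act e' t = msign a * act e (test_partials (multi_seq a) t)) ->
  exists f, DE_derivative (fun=> 0%N) f = e.
Proof.
move=> He; have [g gE] := tibs_tempered e.
have gP : g \in DE_pred E.
  apply/asboolP => a; have [e' e'E] := He a; exists e' => t.
  rewrite /tempered_derivative schwartz_partials_test.
  by rewrite (gE (test_partials (multi_seq a) t)); exact: e'E.
exists (DEType gP); apply: derivative_eq => t.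
by rewrite act_derivative0 /tempered_eval gE.
Qed.

End DE_lemmas.

(** A single coordinate suffices to describe a neighbourhood because the norms of [DE] increase with
    the order, up to constants. *)
Lemma initial_prod_open {R : realType} (V : tvsType R[i]) (X : nat -> completeNormedModType R[i])
    (p : forall k, V -> X k) (P : V -> prod_topology X := fun v k => p k v) :
  (forall k, continuous (p k)) ->
  (forall (A : set V) v, nbhs v A -> exists k (r : R), 0 < r /\
     forall w, nrm (p k w - p k v) <= r -> A w) ->
  forall A : set V, open A <-> open (A : set (initial_topology P)).
Proof.
move=> cp pA A; split => [oA|[B oB <-]].
  rewrite openE => v Av.
  have [k [r [r0 rA]]] : exists k (r : R), 0 < r /\ forall w, nrm (p k w - p k v) <= r -> A w.
    by apply: pA; apply: open_nbhs_nbhs; split.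
  have cP : continuous (P : initial_topology P -> prod_topology X).
    exact: initial_continuous.
  have r0' : 0 < r%:C%C by rewrite ltcR.
  have ck : nbhs (v : initial_topology P) (P @^-1` (@proj _ X k @^-1` ball (p k v) r%:C%C)).
    apply: (cP v (@proj _ X k @^-1` ball (p k v) r%:C%C)).
    by apply: (@proj_continuous _ X k (P v)); exact: nbhsx_ballx.
  apply: (@filterS (initial_topology P) (nbhs (v : initial_topology P)) _ _ _ _ ck).
  move=> w; rewrite /preimage /mkset -ball_normE /= nrmE ltcR => /ltW vw.
  by apply: rA; rewrite nrm_distC.
apply: open_comp => // v _.
apply/cvg_sup => k A' [? [[B' oB' <-] B'v] /= sub].
by apply: filterS sub _; apply: cp; apply: open_nbhs_nbhs; split.
Qed.

(** * Jets and the projective limit *)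

Section jets.
Context {R : realType} {n : nat} (E : tibs R n) (k : nat).
Local Notation C := R[i].
Local Notation mindex := (@mindex n).

Definition mindex0 : mindex k := [ffun=> ord0].

Lemma mval0 : mval mindex0 = fun=> 0%N.
Proof. by apply/funext => j; rewrite /mval ffunE. Qed.

Definition jet_pred : {pred {ffun mindex k -> E}} :=
  [pred x : {ffun mindex k -> E} | `[< forall a t, act (x a) t =
     msign (R := R) (mval a) * act (x mindex0) (test_partials (multi_seq (mval a)) t) >]].

Let jet_pred_submod_closed : submod_closed jet_pred.
Proof.
split.
  apply/asboolP => a t; rewrite !ffunE (lin0 (act_linl t)).
  by rewrite (lin0 (act_linl (test_partials _ t))) mulr0.
move=> c x y /asboolP Hx /asboolP Hy; apply/asboolP => a t.
by rewrite !ffunE !act_linl Hx Hy mulrDr; congr (_ + _); exact: mulrCA.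
Qed.

HB.instance Definition _ :=
  GRing.isSubmodClosed.Build _ _ jet_pred jet_pred_submod_closed.

(* The entries of a jet are the derivatives, in the sense of distributions, of its
   entry of index 0: the jets form a closed subspace of a finite power of E. *)
Record jet := Jet { jet_val :> {ffun mindex k -> E}; _ : jet_val \in jet_pred }.
HB.instance Definition _ := [isSub for jet_val].
HB.instance Definition _ := [Choice of jet by <:].
HB.instance Definition _ := [SubChoice_isSubLmodule of jet by <:].

Lemma jetP (x : jet) a t : act (jet_val x a) t =
  msign (mval a) * act (jet_val x mindex0) (test_partials (multi_seq (mval a)) t).
Proof. by case: x => x /= /asboolP. Qed.

Definition jet_coord a (x : jet) : E := jet_val x a.

Lemma jet_coord_lin a : linear (jet_coord a).
Proof. by move=> c x y; rewrite /jet_coord /= !ffunE. Qed.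

HB.instance Definition _ a :=
  GRing.isLinear.Build C jet E *:%R (jet_coord a) (jet_coord_lin a).

Definition jet_sum (x : jet) : R := \sum_a nrm (jet_val x a).

Lemma nrm_le_jet a (x : jet) : nrm (jet_val x a) <= jet_sum x.
Proof. by rewrite /jet_sum (bigD1 a)//= lerDl sumr_ge0// => b _; exact: nrm_ge0. Qed.

Let jet_sumD (x y : jet) : jet_sum (x + y) <= jet_sum x + jet_sum y.
Proof. by rewrite /jet_sum -big_split; apply: ler_sum => a _; rewrite /= ffunE nrmD. Qed.

Let jet_sumZ c (x : jet) : jet_sum (c *: x) = cabs c * jet_sum x.
Proof. by rewrite /jet_sum mulr_sumr; apply: eq_bigr => a _; rewrite /= ffunE nrmZ. Qed.

Let jet_sum_eq0 (x : jet) : jet_sum x = 0 -> x = 0.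
Proof.
move=> x0; apply: val_inj; apply/ffunP => a; rewrite [RHS]ffunE; apply/eqP.
by rewrite -nrm_eq0 eq_le nrm_ge0 andbT -x0 nrm_le_jet.
Qed.

Let jet_complete (u : nat -> jet) :
  (forall e : R, 0 < e -> exists N, forall j l, (N <= j)%N -> (N <= l)%N ->
     jet_sum (u j - u l) <= e) ->
  exists x, forall e : R, 0 < e -> exists N, forall j, (N <= j)%N -> jet_sum (u j - x) <= e.
Proof.
move=> H.
have /choice[l lP] a : exists l : E, lim_to (fun j => jet_val (u j) a) l.
  apply: complete_seq => e /H[N HN]; exists N => i j Ni Nj.
  rewrite (le_trans _ (HN _ _ Ni Nj))// (le_trans _ (nrm_le_jet a _))//.
  by rewrite /= !ffunE.
have lim_act a t : lim_to (fun j => act (jet_val (u j) a) t) (act (l a) t).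
  have [F FE] := act_cont E t; rewrite -FE => e e0.
  have [N HN] := topdual_lim F (lP a) e0; exists N => j Nj.
  by rewrite -FE; exact: HN.
have jl : [ffun a => l a] \in jet_pred.
  apply/asboolP => a t; rewrite !ffunE; apply: (lim_to_unique (lim_act a t)).
  have [G GE] := act_cont E (test_partials (multi_seq (mval a)) t).
  have := topdual_lim (msign (mval a) *: G) (lP mindex0); rewrite topdualZ GE.
  congr lim_to; by apply/funext => j; rewrite topdualZ GE -jetP.
exists (Jet jl) => e e0.
have K0 : 0 < #|mindex k|%:R :> R by exact: mindex_card.
have /choice[N NP] a := lP a _ (divr_gt0 e0 K0).
exists (\max_a N a)%N => j Nj.
have -> : e = \sum_(a : mindex k) e / #|mindex k|%:R.
  by rewrite sumr_const -[_ *+ _]mulr_natr divfK// gt_eqF.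
apply: ler_sum => a _ /=; rewrite !ffunE.
by apply: NP; apply: leq_trans Nj; exact: leq_bigmax.
Qed.

Definition jet_norm : banach_norm jet :=
  BanachNorm jet_sumD jet_sumZ jet_sum_eq0 jet_complete.

Definition jet_space : completeNormedModType C := banach_of jet_norm.

(** Weak limits are taken entry by entry. They form a jet again, since the relations between the
    entries are tested by functionals of [E], and every functional on jets is a finite sum of
    functionals of the entries. *)
Lemma jet_ball_precompact (M : R) : reflexive_space E ->
  precompact ([set x : jet_space | nrm x <= M] : set (weak_space jet_space)).
Proof.
move=> rE; apply: weak_ball_precompact => U UF UM.
have /choice[y yP] a : exists y : E, forall (f : topdual E) (e : R), 0 < e ->
    U [set x : jet_space | cabs (f (jet_val x a) - f y) <= e].
  apply: (@weak_limit R jet_space U UF E (fun x => jet_val x a) M) => //.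
  by apply: filterS UM => x /=; apply: le_trans; exact: nrm_le_jet.
have jy : [ffun a => y a] \in jet_pred.
  apply/asboolP => a t; rewrite !ffunE.
  have [F FE] := act_cont E t.
  have [G GE] := act_cont E (test_partials (multi_seq (mval a)) t).
  rewrite -FE -GE -[RHS](topdualZ (msign (mval a)) G).
  apply: (ultra_lim_unique UF (yP a F)) => e e0.
  apply: filterS (yP mindex0 (msign (mval a) *: G) e e0) => x.
  rewrite /mkset.
  have -> : F (jet_val x a) = (msign (mval a) *: G) (jet_val x mindex0) by rewrite topdualZ GE FE -jetP.
  by [].
exists (Jet jy) => g e e0.
have [M0 M00 gM] := topdual_bounded g.
have [|v|f _ gE] := @hahn_banach_family R jet E (mindex k)
    jet_coord (fun=> M0) g _ (@topdual_linear _ _ g).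
- by move=> a; exact: ltW.
- by rewrite -mulr_sumr; exact: gM.
have := ultra_lim_sum UF (fun a => yP a (f a)) e0.
have gy : g (Jet jy) = \sum_a f a (y a).
  by rewrite gE; apply: eq_bigr => a _; congr (f a _); exact: ffunE.
by apply: filterS => x; rewrite /mkset gy gE.
Qed.

Definition jet_fun (f : DE_type E) : {ffun mindex k -> E} :=
  [ffun a => DE_derivative (mval a) f].

Lemma jet_fun_subproof f : jet_fun f \in jet_pred.
Proof.
by apply/asboolP => a t; rewrite /jet_fun !ffunE act_derivative mval0 act_derivative0.
Qed.

Definition jet_of (f : DE E) : jet_space := Jet (jet_fun_subproof f).

Lemma jet_of_lin : linear jet_of.
Proof.
by move=> c f g; apply: val_inj; apply/ffunP => a; rewrite /= !ffunE linearP.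
Qed.

HB.instance Definition _ := GRing.isLinear.Build C (DE E) jet_space *:%R jet_of jet_of_lin.

Lemma nrm_jet_of f : nrm (jet_of f) = Nk k f.
Proof. by rewrite bnormE; apply: eq_bigr => a _; rewrite ffunE. Qed.

End jets.
Arguments mindex0 {n k}.

(** * The projective system of jets *)

Section FS_star.
Context {R : realType} {n : nat} (E : tibs R n).
Local Notation C := R[i].
Local Notation mindex := (@mindex n).

Definition mwiden k (a : mindex k) : mindex k.+1 :=
  [ffun j => widen_ord (leqnSn k.+1) (a j)].

Lemma mval_widen k (a : mindex k) : mval (mwiden a) = mval a.
Proof. by apply/funext => j; rewrite /mval ffunE. Qed.

Lemma mwiden0 k : mwiden mindex0 = mindex0 :> mindex k.+1.
Proof. by apply/ffunP => j; rewrite !ffunE; apply: val_inj. Qed.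

Lemma jet_restr_subproof k (x : jet E k.+1) : [ffun a => jet_val x (mwiden a)] \in @jet_pred R n E k.
Proof. by apply/asboolP => a t; rewrite !ffunE jetP mval_widen mwiden0. Qed.

Definition jet_restr k (x : jet_space E k.+1) : jet_space E k := Jet (jet_restr_subproof x).

Lemma jet_restr_lin k : linear (@jet_restr k).
Proof. by move=> c x y; apply: val_inj; apply/ffunP => a; rewrite /= !ffunE. Qed.

HB.instance Definition _ k :=
  GRing.isLinear.Build C (jet_space E k.+1) (jet_space E k) *:%R (@jet_restr k) (@jet_restr_lin k).

Lemma jet_restr_le k (x : jet_space E k.+1) :
  nrm (jet_restr x) <= #|mindex k|%:R * nrm x.
Proof.
rewrite mulr_natl -sumr_const; apply: ler_sum => a _; rewrite ffunE.
exact: nrm_le_jet.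
Qed.

Lemma jet_thread (x : forall k, jet_space E k) : (forall k, jet_restr (x k.+1) = x k) ->
  exists f : DE E, forall k, jet_of k f = x k.
Proof.
move=> xP; have x0 k : jet_val (x k) mindex0 = jet_val (x 0%N) mindex0.
  by elim: k => // k <-; rewrite -(xP k) ffunE mwiden0.
have [a|f fE] := @DE_of_tibs R n E (jet_val (x 0%N) mindex0).
  (* The entries of index 0 of a thread coincide; the derivative of index a is found at any level
     bounding all a_j. *)
  pose K := (\max_j a j)%N; pose b : mindex K := [ffun j => inord (a j)].
  have ab : a = mval b.
    by apply/funext => j; rewrite /mval ffunE inordK// ltnS leq_bigmax.
  by exists (jet_val (x K) b) => t; rewrite jetP (x0 K) -ab.
exists f => k; apply: val_inj; apply/ffunP => a; rewrite ffunE.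
apply: derivative_eq => t.
by rewrite act_derivative -act_derivative0 fE [LHS]jetP (x0 k).
Qed.

Lemma jet_of_continuous k : continuous (@jet_of R n E k).
Proof.
apply: linear_continuous_normed; have := DE_nbhs E k.
by apply: (@filterS (DE E) (nbhs (0 : DE E))) => g /=; rewrite nrm_jet_of.
Qed.

Lemma jet_nbhs (A : set (DE E)) f : nbhs f A -> exists k (r : R), 0 < r /\
  forall g, nrm (jet_of k g - jet_of k f) <= r -> A g.
Proof.
move=> /nbhs0_translate/DE_nbhs_ex[k [r [r0 rA]]]; exists k, r; split => // g.
rewrite -linearB nrm_jet_of => /rA /=.
by rewrite addrC subrK.
Qed.

Lemma DE_FS_star : reflexive_space E -> FS_star (DE E).
Proof.
move=> rE; exists (jet_space E), (fun k => @jet_restr k), (fun k => @jet_of R n E k); split.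
- by move=> k; apply: bounded_continuous_linear; exact: jet_restr_le.
- move=> k; apply: (weakly_compact_bounded _ (@jet_restr_le k)) => //.
  exact: jet_ball_precompact.
- split; last exact: (initial_prod_open jet_of_continuous jet_nbhs).
  + move=> f g fg; apply: DE_derivative0_inj.
    have := congr1 (fun x => jet_val (x 0%N) mindex0) fg.
    by rewrite /= !ffunE mval0.
  + apply/seteqP; split => [_ [f _ <-] k|x xP].
      by apply: val_inj; apply/ffunP => a; rewrite /= !ffunE mval_widen.
    have [f fE] := jet_thread xP; exists f => //.
    by apply/functional_extensionality_dep => k; exact: fE.
Qed.

End FS_star.

(** * Functionals of finite order and the inductive limit *)

Section dual_order.
Context {R : realType} {n : nat} (E : tibs R n) (k : nat).
Local Notation C := R[i].
Local Notation mindex := (@mindex n).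
Local Notation N := (@Nk R n E k).

Lemma DE_eval_lin (F : topdual (DE E)) : linear (F : DE_type E -> C^o).
Proof. exact: (@topdual_linear _ _ F). Qed.

Lemma Nk_functional_rep (F : topdual (DE E)) (M : R) : 0 <= M ->
  (forall f, cabs (F f) <= M * N f) ->
  exists2 h : mindex k -> topdual E, forall a x, cabs (h a x) <= M * nrm x &
    forall f, F f = \sum_a h a (DE_derivative (mval a) f).
Proof.
move=> M0 FM; apply: (@hahn_banach_family R (DE_type E) E (mindex k)
  (fun a => DE_derivative (mval a)) (fun=> M) F) => // [|f].
  exact: DE_eval_lin.
by rewrite -mulr_sumr; exact: FM.
Qed.

Definition dual_pred : {pred topdual (DE E)} :=
  [pred F : topdual (DE E) | `[< op_bound N F !=set0 >]].

Let dual_pred_submod_closed : submod_closed dual_pred.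
Proof.
split.
  apply/asboolP; exists 0; split => // f; by rewrite mul0r cabs0.
move=> c F G /asboolP[M HF] /asboolP[M' HG]; apply/asboolP.
by exists (cabs c * M + M'); exact: (op_boundD (op_boundZ c HF) HG).
Qed.

HB.instance Definition _ :=
  GRing.isSubmodClosed.Build _ _ dual_pred dual_pred_submod_closed.

Record dual_type := DualType { dual_val :> topdual (DE E); _ : dual_val \in dual_pred }.
HB.instance Definition _ := [isSub for dual_val].
HB.instance Definition _ := [Choice of dual_type by <:].
HB.instance Definition _ := [SubChoice_isSubLmodule of dual_type by <:].

Lemma dual_bound (F : dual_type) : op_bound N (dual_val F) !=set0.
Proof. by case: F => F /= /asboolP. Qed.

Definition dual_opn (F : dual_type) : R := op_norm N (dual_val F).

Lemma dual_opnP (F : dual_type) f : cabs (dual_val F f) <= dual_opn F * N f.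
Proof. by apply: op_normP; [exact: Nk_ge0|exact: dual_bound]. Qed.

Lemma dual_ext (F G : dual_type) : (forall f, dual_val F f = dual_val G f) -> F = G.
Proof. by move=> FG; apply: val_inj; apply: topdual_ext. Qed.

Lemma dual_ex (F : DE_type E -> C^o) (M : R) : 0 <= M -> linear F ->
  (forall f, cabs (F f) <= M * N f) ->
  exists2 G : dual_type, forall f, dual_val G f = F f & dual_opn G <= M.
Proof.
move=> M0 lF FM; have [G GE] := DE'_ex lF FM.
have GM : op_bound N G M by split => // f; rewrite GE.
have GP : G \in dual_pred by apply/asboolP; exists M.
exists (DualType GP) => [f|]; first exact: GE.
exact: op_norm_le.
Qed.

Let dual_opnD (F G : dual_type) : dual_opn (F + G) <= dual_opn F + dual_opn G.
Proof. exact: (op_normD (@Nk_ge0 R n E k) (dual_bound F) (dual_bound G)). Qed.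

Let dual_opnZ c (F : dual_type) : dual_opn (c *: F) = cabs c * dual_opn F.
Proof. exact: (op_normZ (@Nk_ge0 R n E k) c (dual_bound F)). Qed.

Let dual_opn_eq0 (F : dual_type) : dual_opn F = 0 -> F = 0.
Proof.
move=> F0; apply: dual_ext => f; apply/eqP; rewrite -cabs_eq0 eq_le cabs_ge0 andbT.
by have := dual_opnP F f; rewrite F0 mul0r.
Qed.

(** The limit is taken pointwise along an ultrafilter, which preserves linearity, and the Cauchy
    estimates pass to it. *)
Let dual_complete (u : nat -> dual_type) :
  (forall e : R, 0 < e -> exists m, forall j l, (m <= j)%N -> (m <= l)%N ->
     dual_opn (u j - u l) <= e) ->
  exists F, forall e : R, 0 < e -> exists m, forall j, (m <= j)%N -> dual_opn (u j - F) <= e.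
Proof.
move=> H.
have [U [UF sU]] := ultraFilterLemma (eventually_filter : ProperFilter (\oo : set_system nat)).
have Hf e : 0 < e -> exists m, forall j l, (m <= j)%N -> (m <= l)%N ->
    forall f, cabs (dual_val (u j) f - dual_val (u l) f) <= e * N f.
  move=> /H[m Hm]; exists m => j l mj ml f.
  rewrite (le_trans (dual_opnP (u j - u l) f))// ler_wpM2r ?Nk_ge0//.
  exact: Hm.
have [m1 Hm1] := Hf 1 ltr01.
have /choice[F0 F0P] f : exists l, forall e : R, 0 < e ->
    U [set j | cabs (dual_val (u j) f - l) <= e].
  apply: (@ultra_lim R nat U UF _ (1 * N f + cabs (dual_val (u m1) f))).
  apply: sU; exists m1 => // j /= mj.
  by rewrite -[dual_val (u j) f](subrK (dual_val (u m1) f)) (le_trans (cabsD _ _))// lerD// Hm1.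
have F0lin : linear (F0 : DE_type E -> C^o).
  move=> c f g; apply: (ultra_lim_unique UF (F0P _)) => e e0.
  have := ultra_lim_lin UF c (F0P f) (F0P g) e0.
  by apply: filterS => j; rewrite /mkset DE_eval_lin.
have F0u e m : (forall j l, (m <= j)%N -> (m <= l)%N ->
    forall f, cabs (dual_val (u j) f - dual_val (u l) f) <= e * N f) ->
    forall j f, (m <= j)%N -> cabs (F0 f - dual_val (u j) f) <= e * N f.
  move=> Hm j f mj.
  have hl : forall d : R, 0 < d -> U [set l | cabs (1 * dual_val (u l) f + - dual_val (u j) f - (1 * F0 f + - dual_val (u j) f)) <= d].
    apply: (ultra_lim_lin UF 1 (F0P f)) => d d0.
    by apply: filterS (filterT : U setT) => l _; rewrite /mkset subrr cabs0 ltW.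
  rewrite -[F0 f]mul1r; apply: (ultra_lim_le UF hl); apply: sU; exists m => // l /= ml.
  by rewrite mul1r; exact: Hm.
have F0M f : cabs (F0 f) <= (1 + dual_opn (u m1)) * N f.
  rewrite -[F0 f](subrK (dual_val (u m1) f)) (le_trans (cabsD _ _))// mulrDl lerD//.
    exact: (F0u 1 m1 Hm1).
  exact: dual_opnP.
have M0 : 0 <= 1 + dual_opn (u m1) by rewrite addr_ge0// op_norm_ge0.
have [G GE _] := dual_ex M0 F0lin F0M.
exists G => e e0; have [m Hm] := Hf _ e0; exists m => j mj.
apply: op_norm_le; split => [|f]; first exact: ltW.
have -> : dual_val (u j - G) f = dual_val (u j) f - F0 f by rewrite -GE.
by rewrite cabs_distC; exact: (F0u e m Hm).
Qed.

Definition dual_norm : banach_norm dual_type :=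
  BanachNorm dual_opnD dual_opnZ dual_opn_eq0 dual_complete.

Definition dual_space : completeNormedModType C := banach_of dual_norm.

Lemma dual_val_lin : linear (dual_val : dual_space -> topdual (DE E)).
Proof. by []. Qed.

(** Each F is a sum of h_a o D^a with h_a bounded by the norm of F, and the h_a have weak-star
    limits. A functional on [dual_space], composed with g -> g o D^a, lies in the bidual of [E] and
    is therefore a point x_a: evaluating at x_a turns weak-star limits into weak ones. *)
Lemma dual_ball_precompact (M : R) : reflexive_space E -> 0 <= M ->
  precompact ([set F : dual_space | nrm F <= M] : set (weak_space dual_space)).
Proof.
move=> rE M0; apply: weak_ball_precompact => U UF UM.
have D_le (a : mindex k) f : nrm (DE_derivative (mval a) f) <= N f.
  by apply: nrm_le_Nk => j; exact: mval_le.
have /choice[h hP] (F : dual_space) : exists h : mindex k -> topdual E,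
    (forall a x, cabs (h a x) <= nrm F * nrm x) /\
    forall f, dual_val F f = \sum_a h a (DE_derivative (mval a) f).
  have [h h1 h2] := Nk_functional_rep (nrm_ge0 F) (dual_opnP F).
  by exists h.
have /choice[h0 h0P] a : exists h0 : topdual E, (forall x, cabs (h0 x) <= M * nrm x) /\
    forall x (e : R), 0 < e -> U [set F | cabs (h F a x - h0 x) <= e].
  have [|h0 h1 h2] := @weakstar_limit R dual_space U UF E (fun F => h F a) M; last by exists h0.
  apply: filterS UM => F /= FM x; rewrite (le_trans ((hP F).1 a x))//.
  by rewrite ler_wpM2r ?nrm_ge0.
have Qlin (a : mindex k) (g : topdual E) : linear (fun f : DE_type E => g (DE_derivative (mval a) f) : C^o).
  by move=> c f f'; rewrite /= linearP (topdual_linear g).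
have QM (a : mindex k) (g : topdual E) (K : R) : 0 <= K -> (forall x, cabs (g x) <= K * nrm x) ->
    forall f, cabs (g (DE_derivative (mval a) f)) <= K * N f.
  by move=> K0 gK f; rewrite (le_trans (gK _))// ler_wpM2l.
(* [Q (a, g)] is g o D^a as an element of the dual of order k. *)
have /choice[Q QP] (ag : mindex k * topdual E) : exists G : dual_space,
    forall f, dual_val G f = ag.2 (DE_derivative (mval ag.1) f).
  have [K K0 gK] := topdual_bounded ag.2.
  by have [G GE _] := dual_ex (ltW K0) (Qlin ag.1 ag.2) (QM _ _ _ (ltW K0) gK); exists G.
have Qsum (g : mindex k -> topdual E) f : dual_val (\sum_a Q (a, g a)) f =
    \sum_a g a (DE_derivative (mval a) f).
  rewrite (lin_sum dual_val_lin) topdual_sum.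
  by apply: eq_bigr => a _; exact: QP.
exists (\sum_a Q (a, h0 a)) => G e e0.
have [K K0 GK] := topdual_bounded G.
have /choice[x xP] a : exists x : E, forall g : topdual E, G (Q (a, g)) = g x.
  apply: (@reflexive_rep R E (fun g => G (Q (a, g))) K) => //.
    move=> c g g'; rewrite -(@topdual_linear _ _ G); congr (topdual_fun G _).
    apply: dual_ext => f; rewrite [RHS](_ : _ = c * dual_val (Q (a, g)) f + dual_val (Q (a, g')) f)//.
    by rewrite !QP.
  move=> g g1; rewrite (le_trans (GK _))// ler_piMr ?(ltW K0)//.
  apply: op_norm_le; split => // f; rewrite mul1r QP (le_trans (g1 _))//.
have GE (g : mindex k -> topdual E) : G (\sum_a Q (a, g a)) = \sum_a g a (x a).
  by rewrite (lin_sum (@topdual_linear _ _ G)); apply: eq_bigr => a _; exact: xP.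
have := ultra_lim_sum UF (fun a => (h0P a).2 (x a)) e0.
apply: filterS => F; rewrite /mkset -!GE.
have FE : F = \sum_a Q (a, h F a).
  by apply: dual_ext => f; rewrite Qsum; exact: (hP F).2.
by move=> H; rewrite [X in G X - _]FE.
Qed.

End dual_order.

(** * The inductive system of functionals of finite order *)

Section DFS_star.
Context {R : realType} {n : nat} (E : tibs R n).
Local Notation C := R[i].
Local Notation mindex := (@mindex n).

Lemma dual_incl_subproof k (F : dual_type E k) : dual_val F \in @dual_pred R n E k.+1.
Proof.
have [M [M0 FM]] := dual_bound F; apply/asboolP; exists (M * #|mindex k|%:R).
split => [|f]; first by rewrite mulr_ge0.
by rewrite (le_trans (FM f))// -mulrA ler_wpM2l// Nk_le.
Qed.

Definition dual_incl k (F : dual_space E k) : dual_space E k.+1 :=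
  DualType (dual_incl_subproof F).

Lemma dual_incl_lin k : linear (@dual_incl k).
Proof. by move=> c F G; apply: dual_ext. Qed.

HB.instance Definition _ k :=
  GRing.isLinear.Build C (dual_space E k) (dual_space E k.+1) *:%R (@dual_incl k) (@dual_incl_lin k).

Lemma dual_incl_le k (F : dual_space E k) :
  nrm (dual_incl F) <= #|mindex k|%:R * nrm F.
Proof.
apply: op_norm_le; split => [|f]; first by rewrite mulr_ge0 ?nrm_ge0.
rewrite (le_trans (dual_opnP F f))// mulrAC [leRHS]mulrC.
by rewrite ler_wpM2l ?op_norm_ge0// Nk_le.
Qed.

Definition dual_emb k (F : dual_space E k) : DE' E := dual_val F.

Lemma dual_emb_lin k : linear (@dual_emb k).
Proof. by []. Qed.

HB.instance Definition _ k :=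
  GRing.isLinear.Build C (dual_space E k) (DE' E) *:%R (@dual_emb k) (@dual_emb_lin k).

Lemma dual_emb_continuous k : continuous (@dual_emb k).
Proof.
apply: (@linear_continuous_lctvs R (dual_space E k) (topdual (DE E)) (strong_base (DE E)) (@dual_emb k)).
move=> _ [A bA ->]; have [M [M0 AM]] := DE_bounded k bA.
apply/nbhs0_normed; exists M^-1; first by rewrite invr_gt0.
move=> F FM f Af; rewrite le_cabs (le_trans (dual_opnP F f))//.
rewrite -(@mulVf _ M) ?gt_eqF// ler_pM ?op_norm_ge0 ?Nk_ge0//.
exact: AM.
Qed.

Lemma sum_tagged (V : nmodType) (J : finType) (T : J -> finType) (g : {k : J & T k} -> V) :
  \sum_i g i = \sum_k \sum_(a : T k) g (Tagged T a).
Proof. by rewrite sig_big_dep; apply: eq_bigr => -[]. Qed.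

(** The first term has weight 1/2 and the rest is half of a sum of the same kind, so the weights
    2^-(k+1) never leave [U], whatever the number of terms. *)
Lemma absconvex_series (V : lmodType C) (U : set V) m (G : 'I_m -> V) :
  absconvex U -> U 0 -> (forall k, U (G k)) ->
  U (\sum_(k < m) (2^-1 ^+ k.+1 : C) *: G k).
Proof.
move=> Uc U0; elim: m G => [|m IH] G UG; first by rewrite big_ord0.
rewrite big_ord_recl expr1.
have -> : \sum_(k < m) (2^-1 ^+ (lift ord0 k).+1 : C) *: G (lift ord0 k) =
    2^-1 *: (\sum_(k < m) (2^-1 ^+ k.+1 : C) *: G (lift ord0 k)).
  by rewrite scaler_sumr; apply: eq_bigr => k _; rewrite scalerA -exprS.
apply: Uc => //; first exact: IH.
by rewrite ger0_norm ?invr_ge0// -mulr2n -(mulr_natr (2^-1) 2) mulVf ?pnatr_eq0.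
Qed.

Section polar.
Context (E_reflexive : reflexive_space E) (eps : nat -> R).
Context (eps0 : forall k, 0 < eps k).

(* The weak limits of the derivatives of the f_j are the derivatives of their weak
   limit. *)
Lemma DE_weak_limit (f : nat -> DE_type E) :
  (forall j k, (k <= j)%N -> eps k * Nk k (f j) <= 1) ->
  exists (U : set_system nat) (UF : UltraFilter U) g,
    [/\ forall m, U [set j | (m <= j)%N],
        forall (F : topdual (DE E)) (e : R), 0 < e -> U [set j | cabs (F (f j) - F g) <= e] &
        forall k, eps k * Nk k g <= 1].
Proof.
move=> fe.
have [U [UF sU]] := ultraFilterLemma (eventually_filter : ProperFilter (\oo : set_system nat)).
have Uge m : U [set j | (m <= j)%N] by apply: sU; exists m.
have fM k j : (k <= j)%N -> Nk k (f j) <= (eps k)^-1.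
  by move=> /fe h; rewrite -(ler_pM2l (eps0 k)) mulfV ?gt_eqF.
have /choice[e eP] (a : 'I_n -> nat) : exists e : E, forall (h : topdual E) (d : R), 0 < d ->
    U [set j | cabs (h (DE_derivative a (f j)) - h e) <= d].
  pose k := (\max_j a j)%N.
  apply: (@weak_limit R nat U UF E (fun j => DE_derivative a (f j)) (eps k)^-1) => //.
  apply: filterS (Uge k) => j /= kj; apply: le_trans (fM k j kj).
  by apply: nrm_le_Nk => i; exact: leq_bigmax.
have e_act a t : act (e a) t =
    msign a * act (e (fun=> 0%N)) (test_partials (multi_seq a) t).
  have [F FE] := act_cont E t.
  have [G GE] := act_cont E (test_partials (multi_seq a) t).
  rewrite -FE -GE -[RHS](topdualZ (msign a) G).
  apply: (ultra_lim_unique UF (eP a F)) => d d0.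
  apply: filterS (eP (fun=> 0%N) (msign a *: G) d d0) => j; rewrite /mkset.
  have -> // : F (DE_derivative a (f j)) = (msign a *: G) (DE_derivative (fun=> 0%N) (f j)).
  by rewrite topdualZ GE FE act_derivative -act_derivative0.
have [|g gE] := @DE_of_tibs R n E (e (fun=> 0%N)).
  by move=> a; exists (e a) => t; exact: e_act.
have gD a : DE_derivative a g = e a.
  by apply: derivative_eq => t; rewrite act_derivative -act_derivative0 gE e_act.
exists U, UF, g; split => // [F d d0|k].
  have [k [M [M0 FM]]] := topdual_Nk F.
  have [h _ hE] := Nk_functional_rep (ltW M0) FM.
  have := ultra_lim_sum UF (fun a : mindex k => eP (mval a) (h a)) d0.
  have Fg : F g = \sum_a h a (e (mval a)).
    by rewrite hE; apply: eq_bigr => a _; congr (h a _); exact: gD.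
  by apply: filterS => j; rewrite /mkset Fg hE.
(* Weak lower semicontinuity of [Nk k]: functionals norming the derivatives of g are tested on the
   derivatives of f j. *)
have /choice[h hP] (a : mindex k) : exists h : topdual E,
    (forall y, cabs (h y) <= nrm y) /\
    h (DE_derivative (mval a) g) = (nrm (DE_derivative (mval a) g))%:C%C.
  by have [h h1 h2] := norming_functional (DE_derivative (mval a) g); exists h.
have hN : cabs (\sum_a h a (DE_derivative (mval a) g)) <= (eps k)^-1.
  have hl : forall d : R, 0 < d -> U [set j | cabs (\sum_a h a (DE_derivative (mval a) (f j)) -
      \sum_a h a (DE_derivative (mval a) g)) <= d].
    move=> d d0; apply: (ultra_lim_sum UF _ d0) => a; rewrite gD; exact: eP.
  apply: (ultra_lim_le UF hl); apply: filterS (Uge k) => j /= kj.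
  rewrite (le_trans _ (fM k j kj))// (le_trans (cabs_sum _ _ _))//.
  by apply: ler_sum => a _; exact: (hP a).1.
rewrite -(ler_pM2l (eps0 k)) mulfV ?gt_eqF// in hN.
rewrite (le_trans _ hN)// ler_wpM2l ?(ltW (eps0 k))//.
under [X in cabs X]eq_bigr => a _ do rewrite (hP a).2.
by rewrite -(rmorph_sum (real_complex R)) cabs_nneg ?Nk_ge0.
Qed.

(** The gap between the bounds 1 and 2 survives an error of 1/2 in the weak limit of
    counterexamples. The inequalities of index at most j are then merged into one sum, hence [j.+1]
    terms, and homogeneity gives the estimate. *)
Lemma polar_finite (F : topdual (DE E)) :
  (forall f, (forall k, eps k * Nk k f <= 1) -> cabs (F f) <= 1) ->
  exists j, forall f, cabs (F f) <= 2 * \sum_(k < j) eps k * Nk k f.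
Proof.
move=> F1.
have [j Hj] : exists j, forall f, (forall k, (k <= j)%N -> eps k * Nk k f <= 1) -> cabs (F f) <= 2.
  apply: contrapT => nj.
  have /choice[f fP] j : exists f, (forall k, (k <= j)%N -> eps k * Nk k f <= 1) /\ 2 < cabs (F f).
    apply: contrapT => nf; apply: nj; exists j => f fj.
    by rewrite leNgt; apply/negP => Ff; apply: nf; exists f.
  have [U [UF [g [_ Fg g1]]]] := DE_weak_limit (fun j => (fP j).1).
  have := F1 g g1; rewrite leNgt => /negP; apply.
  have h2 : 0 < 2^-1 :> R by rewrite invr_gt0.
  have [j0 /= hj] := filter_ex (Fg F _ h2).
  have := (fP j0).2; rewrite -[F (f j0)](subrK (F g)) => h.
  have := lt_le_trans h (cabsD _ _); lra.
exists j.+1 => f; apply/ler_addgt0Pl => e e0.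
pose s := \sum_(k < j.+1) eps k * Nk k f.
have s0 : 0 <= s by rewrite sumr_ge0// => k _; rewrite mulr_ge0 ?Nk_ge0// ltW.
pose N1 := s + e / 2; have N10 : 0 < N1 by rewrite ltr_wpDl// divr_gt0.
have := Hj (N1^-1%:C%C *: f); rewrite (linZ (@topdual_linear _ _ F)) cabsM.
rewrite (cabs_nneg (ltW _)) ?invr_gt0// ler_pdivrMl// /N1 => H.
rewrite (_ : e + 2 * s = (s + e / 2) * 2); last by field.
apply: H => k kj; rewrite NkZ (cabs_nneg (ltW _)) ?invr_gt0// mulrCA ler_pdivrMl// mulr1.
apply: (@le_trans _ _ s); last by rewrite lerDl divr_ge0// ltW.
have kj' : (k < j.+1)%N by [].
rewrite /s (bigD1 (Ordinal kj'))//= lerDl sumr_ge0// => i _.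
by rewrite mulr_ge0 ?Nk_ge0// ltW.
Qed.

End polar.

Lemma DE'_finest (B : lcbase (DE' E)) : reflexive_space E ->
  (forall k, continuous (@dual_emb k : dual_space E k -> lctvs B)) ->
  continuous (id : DE' E -> lctvs B).
Proof.
move=> rE ci.
apply: (@linear_continuous_lctvs R (DE' E) (DE' E) B idfun) => U BU.
have Uc := lcbase_absconvex BU.
have /choice[r rP] k : exists r : R, 0 < r /\ forall F : dual_space E k, nrm F <= r -> U (dual_emb F).
  have : nbhs (0 : dual_space E k) [set F | U (dual_emb F)].
    by apply: (ci k 0); exact: lcbase_nbhs1.
  by move=> /nbhs0_normed[r r0 rU]; exists r.
(* One factor 1/2 compensates the 2 of [polar_finite], and the remaining 2^-(k+1) are the weights of
   [absconvex_series]; exactly [r k] is left for the k-th functional. *)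
pose eps k := r k * 2^-1 ^+ k.+2.
have eps0 k : 0 < eps k by rewrite mulr_gt0 ?(rP k).1// exprn_gt0// invr_gt0.
pose A := [set f : DE E | forall k, eps k * Nk k f <= 1].
have bA : tvs_bounded A.
  move=> W /DE_nbhs_ex[k [d [d0 dW]]]; exists (d * eps k)%:C%C.
    by rewrite ltcR mulr_gt0.
  move=> f Af; apply: dW; rewrite NkZ (cabs_nneg (ltW (mulr_gt0 d0 (eps0 k)))).
  by rewrite -mulrA ler_piMr ?(ltW d0)//; exact: Af.
have : nbhs (0 : DE' E) [set F : topdual (DE E) | forall f, A f -> `|F f| <= 1].
  by apply: (@lcbase_nbhs1 R _ (strong_base (DE E))); exists A.
apply: (@filterS (DE' E) (nbhs (0 : DE' E))) => F F1 /=.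
have [|j Fj] := @polar_finite rE eps eps0 F.
  by move=> f Af; rewrite -le_cabs; exact: F1.
(* A derivative is counted once for each order k in which it occurs, so that every order keeps its
   own weight and yields one element of the k-th space. *)
pose I : finType := {k : 'I_j & mindex k}.
pose tg (k : 'I_j) (a : mindex k) : I := Tagged (fun k : 'I_j => mindex k) a.
have [||f|h hM hF] := @hahn_banach_family R (DE_type E) E I
    (fun i => DE_derivative (mval (tagged i))) (fun i => 2 * eps (tag i)) F.
- by move=> i; rewrite mulr_ge0// ltW.
- exact: DE_eval_lin.
- rewrite (le_trans (Fj f))// mulr_sumr.
  rewrite (@sum_tagged R 'I_j (fun k => mindex k)).
  by apply: ler_sum => k _; rewrite mulrA /Nk mulr_sumr.
have /choice[G GP] (k : 'I_j) : exists G : DE' E, U G /\ forall f, (G : topdual (DE E)) f =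
    2 ^+ k.+1 * \sum_(a : mindex k) h (tg k a) (DE_derivative (mval a) f).
  pose g f : C^o := 2 ^+ k.+1 * \sum_(a : mindex k) h (tg k a) (DE_derivative (mval a) f).
  have [||f|G GE Gr] := @dual_ex R n E k g (r k); first exact: ltW (rP k).1.
  - move=> c f f'; pose S f : C := \sum_(a : mindex k)
      h (tg k a) (DE_derivative (mval a) f).
    have Slin : S (c *: f + f') = c * S f + S f'.
      rewrite mulr_sumr -big_split; apply: eq_bigr => a _ /=.
      by rewrite linearP (topdual_linear (h _)).
    by rewrite /g -!/(S _) Slin mulrDr; congr (_ + _); exact: mulrCA.
  - rewrite /g cabsM (le_trans (ler_wpM2l (cabs_ge0 _) (cabs_sum _ _ _)))//.
    rewrite (_ : cabs (2 ^+ k.+1) = 2 ^+ k.+1); last first.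
      by rewrite -[2 : C](rmorph_nat (real_complex R)) -rmorphXn cabs_nneg// exprn_ge0.
    rewrite -ler_pdivlMl ?exprn_gt0// mulrA /Nk mulr_sumr; apply: ler_sum => a _.
    apply: (le_trans (hM _ _)); rewrite /= /eps ler_wpM2r ?nrm_ge0// le_eqVlt; apply/orP; left; apply/eqP.
    by rewrite -exprVn [in LHS]exprS; field.
  by exists (dual_emb G); split => [|f]; [exact: (rP k).2|exact: GE].
have -> : F = \sum_(k < j) (2^-1 ^+ k.+1 : C) *: G k.
  apply: topdual_ext => f; rewrite (topdual_sum (V := DE E)) hF.
  rewrite (@sum_tagged C^o 'I_j (fun k => mindex k)).
  by apply: eq_bigr => k _; rewrite topdualZ (GP k).2 mulrA -exprMn mulVf ?expr1n ?mul1r// pnatr_eq0.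
apply: absconvex_series => // [|k]; last exact: (GP k).1.
exact: nbhs_singleton (lcbase_nbhs1 BU).
Qed.

Lemma DE'_DFS_star : reflexive_space E -> DFS_star (DE' E).
Proof.
move=> rE; exists (dual_space E), (fun k => @dual_incl k), (fun k => @dual_emb k); split.
- by move=> k; apply: bounded_continuous_linear; exact: dual_incl_le.
- by move=> k F G FG; apply: dual_ext => f; have := congr1 (fun F => dual_val F f) FG.
- move=> k; apply: (weakly_compact_bounded _ (@dual_incl_le k)) => //.
  exact: dual_ball_precompact.
- split => //.
  + by move=> k F G FG; apply: dual_ext => f; have := congr1 (fun F : DE' E => (F : topdual (DE E)) f) FG.
  + move=> F; have [k [M [M0 FM]]] := topdual_Nk (F : topdual (DE E)).
    have [G GE _] := dual_ex (ltW M0) (@DE_eval_lin R n E F) FM.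
    by exists k, G; apply: topdual_ext.
  + by move=> k; exact: dual_emb_continuous.
  + by move=> B; exact: DE'_finest.
Qed.

End DFS_star.

(** * Density of Schwartz functions *)

Section density.
Context {R : realType} {n : nat} (E : tibs R n).

(** The order k is fixed before e: the approximation takes place in one of the Banach spaces of the
    inductive system, hence uniformly on bounded sets of [DE]. *)
Lemma evaluation_approx (F : topdual (DE E)) : reflexive_space E ->
  exists k, forall e : R, 0 < e -> exists psi : schwartzfun R n,
    forall f, cabs (F f - tempered_eval f psi) <= e * Nk k f.
Proof.
move=> rE; have [k [M [M0 FM]]] := topdual_Nk F; exists k => e e0.
have [h _ hF] := Nk_functional_rep (ltW M0) FM.
have [J JE] := choice (act_cont E).
have lJ : linear J.
  move=> c t t'; apply: topdual_ext => x.
  by rewrite topdual_lin !JE (act_linr x).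
have sep x : (forall t, J t x = 0) -> x = 0.
  by move=> H; apply: act_inj => t; rewrite -JE H (lin0 (act_linl t)).
have [t tP] := choice (fun a => dense_in_dual rE lJ sep (h a) e0).
(* A test function acting on D^a f is, up to the sign [msign], the value of f at the derivative of
   that test function, so a sum of such terms is the evaluation at one Schwartz function. *)
exists (\sum_a msign (mval a) *: test_schwartz (test_partials (multi_seq (mval a)) (t a))) => f.
rewrite (lin_sum (tempered_eval_lin f)).
have -> : F f - \sum_a tempered_eval f (msign (mval a) *: test_schwartz (test_partials (multi_seq (mval a)) (t a))) =
    \sum_a (h a (DE_derivative (mval a) f) - J (t a) (DE_derivative (mval a) f)).
  rewrite hF -sumrB; apply: eq_bigr => a _; congr (_ - _).
  by rewrite JE act_derivative (linZ (tempered_eval_lin f)).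
rewrite (le_trans (cabs_sum _ _ _))// /Nk mulr_sumr.
by apply: ler_sum => a _; exact: tP.
Qed.

Lemma schwartz_dense_in_DE' : reflexive_space E -> dense (schwartz_in_DE' E).
Proof.
move=> rE O [F OF] oO.
have /nbhs0_translate/(@nbhs0_lctvs R _ (strong_base (DE E)))[m [U [r [r0 BU UO]]]] :
  nbhs F O by apply: open_nbhs_nbhs; split.
have /choice[A AP] i : exists A : set (DE E), tvs_bounded A /\
    U i = [set F : topdual (DE E) | forall f, A f -> `|F f| <= 1].
  by have [A bA UA] := BU i; exists A.
have [k Fk] := evaluation_approx F rE.
have /choice[M MP] i : exists M : R, 0 < M /\ forall f, A i f -> Nk k f <= M.
  exact: DE_bounded (AP i).1.
(* One constant for the finitely many bounded sets of the basic neighbourhood; the 1 keeps it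
   positive when there are none. *)
pose K := \sum_i M i + 1.
have M0 : 0 <= \sum_i M i by rewrite sumr_ge0// => i _; rewrite ltW// (MP i).1.
have K0 : 0 < K by rewrite ltr_wpDl.
have [psi psiP] := Fk (r * K)^-1 ltac:(by rewrite invr_gt0 mulr_gt0).
have [G [GE Gpsi]] := eval_in_DE' rE psi.
exists G; split; last by exists psi.
have -> : G = F + (G - F) by rewrite addrC subrK.
apply: UO => i; rewrite (AP i).2 => f Af; rewrite le_cabs.
have -> : topdual_fun (r%:C%C *: (G - F : topdual (DE E))) f = r%:C%C * (tempered_eval f psi - F f).
  by rewrite -GE.
rewrite cabsM (cabs_nneg (ltW r0)) cabs_distC.
rewrite (le_trans (ler_wpM2l (ltW r0) (psiP f)))// invfM mulrA mulrA mulfV ?gt_eqF// mul1r.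
rewrite ler_pdivrMl// mulr1 (le_trans ((MP i).2 f Af))//.
rewrite /K (bigD1 i)//= -addrA lerDl addr_ge0// sumr_ge0// => j _.
by rewrite ltW// (MP j).1.
Qed.

End density.

(** The third clause shows that every Schwartz function defines an element of [schwartz_in_DE'], so
    that the density concerns the image of the whole Schwartz space. *)
Theorem proposition9 (R : realType) (n : nat) (E : tibs R n)
    (E_reflexive : reflexive_space E) :
  [/\ FS_star (DE E),
      DFS_star (DE' E),
      (forall psi : schwartzfun R n, exists F : DE' E, restricts_to F psi) &
      dense (schwartz_in_DE' E)].
Proof.
split.
- exact: DE_FS_star.
- exact: DE'_DFS_star.
- by move=> psi; have [F [_ Fpsi]] := eval_in_DE' E_reflexive psi; exists F.
- exact: schwartz_dense_in_DE'.
Qed.
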